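(* Suppose $U\in C^2(\mathbb R)$, $e^{-U}\in L^1(\mathbb R)$, there are $\delta\in(0,1)$, $a\in\mathbb R$, $A>0$ with $a\le U''(x)\le \delta|U'(x)|^2+A$ for all $x\in\mathbb R$, and there are constants $c_1,c_2\ge0$ such that the continuous function $\lambda_{\mathrm{refr}}:\mathbb R\to[0,\infty)$ satisfies $\lambda_{\mathrm{refr}}(x)\le c_1+c_2|U'(x)|$ for all $x\in\mathbb R$. Let $L$ be the zigzag generator on $L^2(\mu)$. Then $\mathcal D(L)=W^{1,2}(\mu)$. If also $\lim_{x\to\infty}U'(x)=+\infty$ and $\lim_{x\to-\infty}U'(x)=-\infty$, then the embedding $W^{1,2}(\mu)\subset L^2(\mu)$ is compact and in particular, for any $\gamma>0$, the resolvent operator $(\gamma-L)^{-1}:L^2(\mu)\to L^2(\mu)$ is compact.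
   Context: $E=\mathbb R\times\{-1,+1\}$; for $f:E\to\mathbb C$ write $f^{\pm}(x)=f(x,\pm1)$. $\lambda(x,\theta)=\max(\theta U'(x),0)+\lambda_{\mathrm{refr}}(x)$ for $(x,\theta)\in E$. The measure $\nu$ on $\mathbb R$ is $\nu(dx)=e^{-U(x)}dx$ and $\mu$ on $E$ is $\mu(A\times\{\theta\})=\nu(A)$. $L^2(\mu)$ is the complex Hilbert space of square integrable functions on $E$. $W^{1,2}(\nu)$ is the Sobolev space of functions in $L^2(\nu)$ having a weak derivative in $L^2(\nu)$, and $W^{1,2}(\mu)$ is the set of $f$ on $E$ with $f^{\pm}\in W^{1,2}(\nu)$. $W^{1,2}_{\mathrm{loc}}(E)$ is the set of $f$ with $f^{\pm}\in W^{1,2}_{\mathrm{loc}}(\mathbb R)$. The zigzag generator is $Lf(x,\theta)=\theta\,\partial_xf(x,\theta)+\lambda(x,\theta)(f(x,-\theta)-f(x,\theta))$ with domain $\mathcal D(L)=\{f\in L^2(\mu)\cap W^{1,2}_{\mathrm{loc}}(E): Lf\in L^2(\mu)\}$; it generates a strongly continuous contraction semigroup on $L^2(\mu)$. *)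

(* Defs.v *)
From HB Require Import structures.
From mathcomp Require Import all_boot all_order all_algebra.
From mathcomp Require Import all_classical all_reals all_analysis.
From mathcomp Require Import measurable_realfun.
From mathcomp Require Import complex.

Set Implicit Arguments.
Unset Strict Implicit.
Unset Printing Implicit Defensive.

Import Order.TTheory GRing.Theory Num.Theory.
Import numFieldNormedType.Exports.

Local Open Scope ring_scope.
Local Open Scope classical_set_scope.
Local Open Scope complex_scope.

(* Elements of L^2 and of the Sobolev spaces are represented by everywhere
   defined Borel functions; all the sets of functions below are unions of
   classes modulo equality almost everywhere. *)

Section complex_L2.
Context d (T : measurableType d) (R : realType).
Variable mu : {measure set T -> \bar R}.
Implicit Types f g : T -> R[i].

Definition cmeasurable f :=
  measurable_fun [set: T] (fun x => complex.Re (f x)) /\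
  measurable_fun [set: T] (fun x => complex.Im (f x)).

Definition L2norm f : \bar R := 'N[mu]_2%:E[EFin \o (fun x => Normc.normc (f x))]%E.

Definition L2 : set (T -> R[i]) :=
  [set f | cmeasurable f /\ (L2norm f < +oo)%E].

(* S is relatively compact for the L^2 seminorm (sequentially). *)
Definition relatively_compact_L2 (S : set (T -> R[i])) :=
  forall u : nat -> T -> R[i], (forall n, S (u n)) ->
  exists (k : nat -> nat) (f : T -> R[i]),
    [/\ {homo k : m n / (m < n)%N}, L2 f &
        L2norm (fun x => u (k n) x - f x) @[n --> \oo] --> 0%E].

(* A is a compact linear operator L^2 -> L^2, linearity being meant modulo
   equality almost everywhere. *)
Definition compact_operator_L2 (A : (T -> R[i]) -> (T -> R[i])) :=
  [/\ forall g, L2 g -> L2 (A g),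
      forall (a : R[i]) g h, L2 g -> L2 h ->
        A (fun x => a * g x + h x) = (fun x => a * A g x + A h x) %[ae mu] &
      forall M : R,
        relatively_compact_L2 (A @` [set g | L2 g /\ (L2norm g <= M%:E)%E])].

End complex_L2.

Section weak_derivative.
Context (R : realType).
Implicit Types (f g : R -> R[i]) (phi : R -> R).

Local Notation leb := (@lebesgue_measure R).

Definition test_function phi :=
  (forall n x, derivable (derive1n n phi) x 1) /\
  exists2 K : set R, compact K & forall x, ~ K x -> phi x = 0.

Definition clocally_integrable f :=
  locally_integrable [set: R] (fun x => complex.Re (f x)) /\
  locally_integrable [set: R] (fun x => complex.Im (f x)).

Definition cintegral f : R[i] :=
  (\int[leb]_x complex.Re (f x)) +i* (\int[leb]_x complex.Im (f x)).

Definition is_weak_derivative f g :=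
  [/\ clocally_integrable f, clocally_integrable g &
      forall phi, test_function phi ->
        cintegral (fun x => f x * (derive1 phi x)%:C) =
        - cintegral (fun x => g x * (phi x)%:C)].

(* A weak derivative of f, unique modulo null sets; 0 if there is none. *)
Definition weak_derivative f : R -> R[i] :=
  xget (fun=> 0) [set g | is_weak_derivative f g].

Definition L2loc : set (R -> R[i]) :=
  [set f | cmeasurable f /\ forall K : set R, compact K ->
    (\int[leb]_(x in K) (Normc.normc (f x) ^+ 2)%:E < +oo)%E].

Definition W12loc : set (R -> R[i]) :=
  [set f | L2loc f /\ exists2 g, is_weak_derivative f g & L2loc g].

Definition W12 (nu : {measure set R -> \bar R}) : set (R -> R[i]) :=
  [set f | L2 nu f /\ exists2 g, is_weak_derivative f g & L2 nu g].

End weak_derivative.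

Section zigzag.
Context (R : realType).
Variable U : R -> R.

Definition C2 :=
  [/\ forall x, derivable U x 1, forall x, derivable (derive1 U) x 1 &
      continuous (derive1n 2 U)].

Lemma C2_continuous : C2 -> continuous U.
Proof.
by case=> dU _ _ x; apply/differentiable_continuous/derivable1_diffP/dU.
Qed.

Lemma C2_measurable_expR : C2 -> measurable_fun [set: R] (fun x => expR (- U x)).
Proof.
move=> /C2_continuous cU; apply: measurableT_comp => //.
by apply: measurableT_comp => //; exact: continuous_measurable_fun.
Qed.

Hypothesis hU : C2.

(* hU is what makes this set function a measure. *)
Definition nu of C2 : set R -> \bar R :=
  fun A => (\int[lebesgue_measure]_(x in A) (expR (- U x))%:E)%E.

Let nu0 : nu hU set0 = 0%E.
Proof. by rewrite /nu integral_set0. Qed.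

Let nu_ge0 A : (0 <= nu hU A)%E.
Proof. by apply: integral_ge0 => x _; rewrite lee_fin expR_ge0. Qed.

Let nu_sigma_additive : semi_sigma_additive (nu hU).
Proof.
have := @semi_sigma_additive_nng_induced _ _ _ lebesgue_measure
  (fun x : R => (expR (- U x))%:E).
apply; first by apply/measurable_EFinP; exact: C2_measurable_expR.
by move=> x; rewrite lee_fin expR_ge0.
Qed.

HB.instance Definition _ :=
  isMeasure.Build _ _ _ (nu hU) nu0 nu_ge0 nu_sigma_additive.

End zigzag.

Section zigzag_generator.
Context (R : realType).
Variables (U : R -> R) (hU : C2 U) (lambda_refr : R -> R).

(* The state space is R * {-1, +1}; the velocity +1 is encoded as true. *)
Implicit Types (f g : R * bool -> R[i]) (theta : bool).

Definition velocity theta : R := if theta then 1 else - 1.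

Definition slice f theta : R -> R[i] := fun x => f (x, theta).

Definition nu_at theta : set (R * bool) -> \bar R :=
  pushforward (nu hU) (pair^~ theta).

HB.instance Definition _ theta := Measure.copy (nu_at theta)
  (measure_function_pushforward__canonical__measure_function_Measure (nu hU)
    (pair2_measurable theta)).

Definition mu : {measure set (R * bool) -> \bar R} :=
  measure_add (nu_at true) (nu_at false).

Lemma mu_setX (A : set R) theta : mu (A `*` [set theta]) = nu hU A.
Proof.
have muE B : mu B = (nu_at true B + nu_at false B)%E by exact: measure_addE.
have same : nu_at theta (A `*` [set theta]) = nu hU A.
  by congr (nu hU _); apply/seteqP; split=> x /= => [[]|].
have diff : nu_at (~~ theta) (A `*` [set theta]) = 0%E.
  rewrite /nu_at /pushforward (_ : _ @^-1` _ = set0) ?measure0//.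
  by rewrite -subset0 => x /= [_]; case: (theta).
by rewrite muE; case: theta same diff => /= -> ->; rewrite ?adde0 ?add0e.
Qed.

Definition jump_rate (x : R) theta : R :=
  Num.max (velocity theta * derive1 U x) 0 + lambda_refr x.

Definition partial_x f : R * bool -> R[i] :=
  fun y => weak_derivative (slice f y.2) y.1.

Definition zigzag_generator f : R * bool -> R[i] := fun y =>
  let: (x, theta) := y in
  (velocity theta)%:C * partial_x f (x, theta)
  + (jump_rate x theta)%:C * (f (x, ~~ theta) - f (x, theta)).

Definition W12loc_E : set (R * bool -> R[i]) :=
  [set f | forall theta, W12loc (slice f theta)].

Definition zigzag_domain : set (R * bool -> R[i]) :=
  [set f | [/\ L2 mu f, W12loc_E f & L2 mu (zigzag_generator f)]].

Definition W12_mu : set (R * bool -> R[i]) :=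
  [set f | forall theta, W12 (nu hU) (slice f theta)].

Definition W12norm f : \bar R :=
  ((L2norm mu f `^ 2 + L2norm mu (partial_x f) `^ 2) `^ 2^-1)%E.

Definition compact_embedding_W12_L2 : Prop :=
  [/\ W12_mu `<=` L2 mu,
      exists C : R, forall f, W12_mu f -> (L2norm mu f <= C%:E * W12norm f)%E &
      forall M : R,
        relatively_compact_L2 mu [set f | W12_mu f /\ (W12norm f <= M%:E)%E]].

Definition shifted_generator (gamma : R) f : R * bool -> R[i] :=
  fun y => gamma%:C * f y - zigzag_generator f y.

(* gamma - L is a bijection from its domain onto L^2 (modulo equality almost
   everywhere) with bounded inverse. *)
Definition in_resolvent_set (gamma : R) : Prop :=
  [/\ forall g, L2 mu g -> exists2 f, zigzag_domain f &
        shifted_generator gamma f = g %[ae mu],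
      forall f1 f2, zigzag_domain f1 -> zigzag_domain f2 ->
        shifted_generator gamma f1 = shifted_generator gamma f2 %[ae mu] ->
        f1 = f2 %[ae mu] &
      exists C : R, forall f, zigzag_domain f ->
        (L2norm mu f <= C%:E * L2norm mu (shifted_generator gamma f))%E].

(* (gamma - L)^-1, for gamma in the resolvent set. *)
Definition resolvent (gamma : R) g : R * bool -> R[i] :=
  xget (fun=> 0) [set f | zigzag_domain f /\
                          shifted_generator gamma f = g %[ae mu]].

End zigzag_generator.

(* Main.v *)
(* Write s = f^+ + f^-, u = f^+ - f^- and nu = e^-U dx.  Since lambda^+ - lambda^- = U',
   u' = (Lf)^+ + (Lf)^- + U' u; the lower bound on U'' then controls u' in L^2(nu), the
   upper bound controls U' F by F and F' for every F in W^{1,2}(nu), and the growth of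
   lambda_refr gives the equality of the domain and W^{1,2}.  When |U'| tends to infinity,
   the bound on U' F makes the tails of a bounded sequence of W^{1,2}(nu) uniformly
   small, and Ascoli's theorem gives compactness on bounded intervals.  In the equation
   (gamma - L) f = g, i.e. gamma s - u' + U' u = g^+ + g^- and
   (gamma + Lambda) u - s' = g^+ - g^- with Lambda = |U'| + 2 lambda_refr, solving the
   second one for u makes the first one a coercive symmetric problem for s, which is solved
   by an orthogonal projection; testing with s and u gives the bound on the resolvent. *)
From HB Require Import structures.
Require Import Defs.
From mathcomp Require Import all_boot all_order all_algebra.
From mathcomp Require Import all_classical all_reals all_analysis.
From mathcomp Require Import measurable_realfun complex.
From mathcomp Require Import ring lra.

Set Implicit Arguments.
Unset Strict Implicit.
Unset Printing Implicit Defensive.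

Import Order.TTheory GRing.Theory Num.Theory.
Import numFieldNormedType.Exports.

Local Open Scope ring_scope.
Local Open Scope classical_set_scope.

(** * Smooth functions *)

Section smooth_functions.
Context {R : realType}.
Implicit Types (f g h : R -> R) (x : R).

(** Membership in the domain gives no control of f' in L^2(nu), so the inequalities behind the
    equality with W^{1,2} are proved in [0, +oo], for every locally absolutely continuous function:
    the derivative of a product containing cutoff^2 and w = e^-U is integrated over [-n, n], and the
    cutoff removes the boundary terms. With V = U', the identity u'^2 + V' u^2 = (u' - V u)^2 + (V
    u^2 w)' / w shows how V' >= a controls u', and V^2 F^2 = V' F^2 + 2 V F F' - (V F^2 w)' / w
    shows that delta < 1 is what lets the term delta V^2 F^2 be absorbed. Weak derivatives are
    defined by test functions. Bump functions are therefore constructed, and a weakly differentiable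
    function is shown to agree almost everywhere with an indefinite integral of its weak derivative;
    the calculus (product rule, continuity, oscillation) is done on that representative. The
    coefficients of L are real, so real and imaginary parts are treated separately and joined only
    at the end. The projection that solves the resolvent equation takes place in L^2(mu) itself,
    because the Dirichlet form for s is the squared norm of a pair of functions. *)

Definition smooth f := forall n x, derivable (derive1n n f) x 1.

(** Induction on the order of derivation with the whole class [P] as invariant; explicit formulas
    for higher derivatives are thereby avoided. *)
Lemma smooth_closure (P : (R -> R) -> Prop) :
  (forall f, P f -> exists2 g, P g & forall x, is_derive x 1 f (g x)) ->
  forall f, P f -> smooth f.
Proof.
move=> PD f Pf n; elim: n f Pf => [|n IH] f Pf x.
  by have [g _ /(_ x) []] := PD _ Pf.
have [g Pg fg] := PD _ Pf; rewrite derive1Sn.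
suff -> : (derive1 f) = g by exact: IH.
by apply/funext => y; rewrite derive1E; exact: derive_val.
Qed.

Lemma smooth_is_derive f : smooth f -> forall x, is_derive x 1 f (derive1 f x).
Proof. by move=> sf x; rewrite derive1E; apply: derivableP; exact: (sf 0%N). Qed.

Lemma smooth_derive1 f : smooth f -> smooth (derive1 f).
Proof. by move=> sf n x; rewrite -derive1Sn. Qed.

Lemma smooth_prim f g : smooth g -> (forall x, is_derive x 1 f (g x)) ->
  smooth f.
Proof.
move=> sg fg; apply: (@smooth_closure (fun h => h = f \/ smooth h)); last by left.
move=> h [->|sh]; first by exists g => //; right.
by exists (derive1 h); [right; exact: smooth_derive1|exact: smooth_is_derive].
Qed.

Lemma smooth_continuous f : smooth f -> continuous f.
Proof.
by move=> sf x; apply/differentiable_continuous/derivable1_diffP/(sf 0%N).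
Qed.

(** Derivation leads out of the class of products; adding finite sums gives a class that is stable
    under derivation, as [smooth_closure] requires. *)
Inductive sum_of_smooth_products : (R -> R) -> Prop :=
| SmoothProd f g : smooth f -> smooth g -> sum_of_smooth_products (f * g)
| SmoothSum f g : sum_of_smooth_products f -> sum_of_smooth_products g ->
    sum_of_smooth_products (f + g).

Lemma smoothM f g : smooth f -> smooth g -> smooth (f * g).
Proof.
move=> sf sg; apply: (@smooth_closure sum_of_smooth_products); last exact: SmoothProd.
move=> h; elim=> [{sf sg}f1 g1 sf sg|f1 g1 _ [f' Pf' Df] _ [g' Pg' Dg]].
  exists (f1 * (derive1 g1) + g1 * (derive1 f1)).
    exact: (SmoothSum (SmoothProd sf (smooth_derive1 sg))
                      (SmoothProd sg (smooth_derive1 sf))).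
  move=> x; have := smooth_is_derive sf x; have := smooth_is_derive sg x.
  by move=> ? ?; exact: is_deriveM.
exists (f' + g'); first exact: SmoothSum.
by move=> x; exact: is_deriveD.
Qed.

Lemma is_derive_affine (a b x : R) : is_derive x 1 (fun y => a * y + b) a.
Proof.
have := is_deriveD (is_deriveZ a (is_derive_id x (1:R))) (is_derive_cst b x (1:R)).
by rewrite [a *: _]mulr1 addr0; exact.
Qed.

Lemma is_derive1_comp f g x df dg :
  is_derive (g x) 1 f df -> is_derive x 1 g dg ->
  is_derive x 1 (f \o g) (df * dg).
Proof.
move=> [df1 dfE] [dg1 dgE]; apply: DeriveDef.
  apply/(derivable1_diffP (f \o g)).
  have dg2 := (derivable1_diffP g x).1 dg1.
  have df2 := (derivable1_diffP f (g x)).1 df1.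
  exact: (differentiable_comp dg2 df2).
by rewrite -derive1E (derive1_comp dg1 df1) !derive1E dfE dgE.
Qed.

Lemma is_derive_comp_affine f a b x : smooth f ->
  is_derive x 1 (fun y => f (a * y + b)) (a * derive1 f (a * x + b)).
Proof.
move=> sf; rewrite mulrC.
exact: (@is_derive1_comp f (fun y => a * y + b) x _ _
  (smooth_is_derive sf (a * x + b)) (is_derive_affine a b x)).
Qed.

Lemma smooth_affine f a b : smooth f -> smooth (fun x => f (a * x + b)).
Proof.
move=> sf.
apply: (@smooth_closure (fun h => exists2 g, smooth g &
  exists c, h = fun x => c * g (a * x + b))); last first.
  by exists f => //; exists 1; apply/funext => x; rewrite mul1r.
move=> h [g sg [c ->]]; exists (fun x => (c * a) * derive1 g (a * x + b)).
  by exists (derive1 g); [exact: smooth_derive1|exists (c * a)].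
by move=> x; rewrite -mulrA; exact: (is_deriveZ c (is_derive_comp_affine a b x sg)).
Qed.

Lemma smooth_lincomb f g a : smooth f -> smooth g -> smooth (fun x => f x + a * g x).
Proof.
move=> sf sg; apply: (@smooth_closure (fun h => exists f1 g1,
    [/\ smooth f1, smooth g1 & h = fun x : R => f1 x + a * g1 x :> R])).
  move=> h [f1 [g1 [sf1 sg1 ->]]]; exists (fun x => derive1 f1 x + a * derive1 g1 x).
    exists (derive1 f1), (derive1 g1).
    exact: And3 (smooth_derive1 sf1) (smooth_derive1 sg1) erefl.
  move=> x.
  exact: (is_deriveD (smooth_is_derive sf1 x) (is_deriveZ a (smooth_is_derive sg1 x))).
exists f, g; exact: And3 sf sg erefl.
Qed.

Lemma smoothB f g : smooth f -> smooth g -> smooth (fun x => f x - g x).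
Proof.
move=> sf sg; have := @smooth_lincomb f g (-1) sf sg.
by congr smooth; apply/funext => x; rewrite mulN1r.
Qed.

End smooth_functions.

(** * Bump and step functions *)

Section bump.
Context {R : realType}.
Implicit Types (x y : R) (p : {poly R}).

(* Closed under derivation, which makes all its members smooth at 0. *)
Definition flat_exp p x : R := if 0 < x then p.[x^-1] * expR (- x^-1) else 0.

Lemma horner_le_pow p : exists2 C, 0 <= C &
  forall y, 1 <= y -> `|p.[y]| <= C * y ^+ size p.
Proof.
exists (\sum_(i < size p) `|p`_i|); first by rewrite sumr_ge0.
move=> y y1; have y0 : 0 <= y by rewrite (le_trans _ y1).
rewrite horner_coef (le_trans (ler_norm_sum _ _ _))// mulr_suml ler_sum// => i _.
rewrite normrM normrX (ger0_norm y0) ler_wpM2l//.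
by rewrite ler_weXn2l// ltnW.
Qed.

(** The exponential beats every power: with y = 1/x, exp(y) is at least y^n / n! for any n. Order
    two at 0 makes the difference quotient there tend to 0. *)
Lemma flat_exp_le p : exists2 C, 0 <= C &
  forall x, 0 < x -> x <= 1 -> `|flat_exp p x| <= C * x ^+ 2.
Proof.
have [C C0 hC] := horner_le_pow p.
(* Two more than [size p], so that y^n exceeds y^(size p) by the factor y^2 = x^-2. *)
set n := (size p).+2.
exists (C * n`!%:R); first by rewrite mulr_ge0.
move=> x x0 x1; rewrite /flat_exp x0; set y := x^-1.
have y1 : 1 <= y by rewrite /y invf_ge1.
have y0 : 0 < y by rewrite (lt_le_trans _ y1).
rewrite normrM (ger0_norm (expR_ge0 _)).
apply: (le_trans (ler_wpM2r (expR_ge0 _) (hC _ y1))).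
rewrite -!mulrA ler_wpM2l// expRN ler_pdivrMr ?expR_gt0//.
have xE : x = y^-1 by rewrite /y invrK.
have := expR_ge1Dxn (size p).+1 (ltW y0).
rewrite -/n => h; have {}h : y ^+ n / n`!%:R <= expR y by rewrite (le_trans _ h)// lerDr.
have nf : n`!%:R != 0 :> R by rewrite pnatr_eq0 -lt0n fact_gt0.
have -> : y ^+ size p = n`!%:R * x ^+ 2 * (y ^+ n / n`!%:R).
  by rewrite xE /n !exprS; field; rewrite nf gt_eqF.
by rewrite ler_wpM2l// mulr_ge0// exprn_ge0// ltW.
Qed.

(** Chain rule with y = 1/x: the derivative of p(y) exp(-y) is y^2 (p(y) - p'(y)) exp(-y), again a
    polynomial in y times exp(-y). At 0 the quadratic bound of [flat_exp_le] applies. *)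
Lemma is_derive_flat_exp p x :
  is_derive x 1 (flat_exp p) (flat_exp ('X^2 * (p - p^`())) x).
Proof.
have [x0|x0|<-] := ltgtP 0 x.
- apply: (@near_eq_is_derive _ _ _ (fun y => p.[y^-1] * expR (- y^-1))).
  + by near=> y; rewrite /flat_exp ifT//; near: y; exact: lt_nbhsr.
  + have xn0 : x != 0 by rewrite gt_eqF.
    have dV : is_derive x 1 (fun y : R => y^-1) (- x ^- 2).
      apply: DeriveDef; first by apply: derivableV.
      by rewrite deriveV// derive_id [_ *: _]mulr1.
    have d1 := is_derive1_comp (is_derive_poly p x^-1) dV.
    have d2 := @is_derive1_comp _ expR (fun y => - y^-1) x _ _
      (is_derive_expR (- x^-1)) (is_deriveN dV).
    apply: (is_derive_eq (is_deriveM d1 d2)).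
    rewrite /flat_exp x0 /= !hornerE /GRing.scale/= exprVn; ring.
- apply: (@near_eq_is_derive _ _ _ (cst 0)).
    near=> y; rewrite /flat_exp/= ifF//; apply/negbTE; rewrite -leNgt ltW//.
    by near: y; exact: lt_nbhsl.
  by rewrite /flat_exp ltNge (ltW x0)/=; exact: is_derive_cst.
- have [C C0 hC] := flat_exp_le p.
  have f0 : flat_exp p 0 = 0 by rewrite /flat_exp ltxx.
  have -> : flat_exp ('X^2 * (p - p^`())) 0 = 0 by rewrite /flat_exp ltxx.
  suff h : h^-1 *: (flat_exp p (h *: 1 + 0) - flat_exp p 0) @[h --> (0:R)^'] --> (0 : R).
    apply: DeriveDef; first by apply/cvg_ex; exists 0.
    by apply/cvg_lim => //.
  apply/cvgrPdist_le => e e0; near=> h.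
  rewrite f0 subr0 sub0r normrN /GRing.scale/= mulr1 addr0 normrM normfV.
  have h0 : h != 0 by near: h; exact: nbhs_dnbhs_neq.
  have h1 : `|h| <= 1.
    by near: h; exact: dnbhs0_le.
  have h2 : `|h| <= e / (C + 1).
    by near: h; apply: dnbhs0_le; rewrite divr_gt0// ltr_wpDl.
  have nh0 : 0 < `|h| by rewrite normr_gt0.
  rewrite mulrC ler_pdivrMr//.
  have [hp|hn] := ltP 0 h; last first.
    by rewrite /flat_exp ltNge hn /= normr0 mulr_ge0// ltW.
  rewrite (gtr0_norm hp) in h1 h2 nh0 *.
  apply: (le_trans (hC h hp h1)); rewrite expr2 mulrA ler_wpM2r ?(ltW nh0)//.
  apply: (@le_trans _ _ (h * (C + 1))).
    by rewrite mulrC ler_wpM2l ?lerDl// ltW.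
  by rewrite -ler_pdivlMr// ltr_wpDl.
Unshelve. all: by end_near. Qed.

Lemma smooth_flat_exp p : smooth (flat_exp p).
Proof.
apply: (@smooth_closure _ (fun f => exists q, f = flat_exp q)); last by exists p.
move=> _ [q ->]; exists (flat_exp ('X^2 * (q - q^`()))).
  by eexists.
exact: is_derive_flat_exp.
Qed.

(** The argument [-1 * x + 1] is 1 - x in the affine form of [smooth_affine]; the product is
    positive exactly on ]0, 1[. *)
Definition bump x : R := flat_exp 1 x * flat_exp 1 (-1 * x + 1).

Lemma smooth_bump : smooth bump.
Proof.
have s1 := @smooth_flat_exp 1.
exact: (smoothM s1 (@smooth_affine _ _ (-1) 1 s1)).
Qed.

Lemma bump_ge0 x : 0 <= bump x.
Proof.
by apply: mulr_ge0; rewrite /flat_exp; case: ifP => // _;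
  rewrite hornerE mul1r expR_ge0.
Qed.

Lemma bump_gt0 x : 0 < x -> x < 1 -> 0 < bump x.
Proof.
have h y : 0 < y -> 0 < flat_exp 1 y.
  by move=> y0; rewrite /flat_exp y0 hornerC mul1r expR_gt0.
by move=> x0 x1; rewrite mulr_gt0 ?h// mulN1r addrC subr_gt0.
Qed.

Lemma bump_out x : ~~ (0 < x < 1) -> bump x = 0.
Proof.
rewrite negb_and -!leNgt => /orP[x0|x1]; rewrite /bump /flat_exp.
  by rewrite ltNge x0 mul0r.
by rewrite [in X in _ * X]ifF ?mulr0// mulN1r addrC subr_gt0; apply/negbTE; rewrite -leNgt.
Qed.

Lemma bump_le1 x : bump x <= 1.
Proof.
have h y : 0 <= flat_exp 1 y <= 1.
  rewrite /flat_exp; case: ifPn => [y0|_]; last by rewrite lexx ler01.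
  by rewrite hornerE mul1r expR_ge0/= expR_le1 lerNl oppr0 invr_ge0 ltW.
by rewrite /bump mulr_ile1//; have /andP[] := h x; have /andP[] := h (-1 * x + 1).
Qed.

Lemma bump_integrable : (@lebesgue_measure R).-integrable setT (EFin \o bump).
Proof.
have -> : EFin \o bump = (EFin \o bump) \_ `[0, 1].
  apply/funext => x; rewrite patchE; case: ifPn => // /negP xn /=.
  rewrite bump_out//; apply/negP => /andP[x0 x1]; apply: xn.
  by rewrite inE/= in_itv/= !ltW.
apply: (integrable_mkcond _ _).1 => //; apply: continuous_compact_integrable.
  exact: segment_compact.
by apply: continuous_subspaceT; exact: smooth_continuous smooth_bump.
Qed.

Lemma mvt_le (f f' : R -> R) (a b : R) : (forall x, is_derive x 1 f (f' x)) ->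
  a <= b -> exists2 c, a <= c <= b & f b - f a = f' c * (b - a).
Proof.
move=> df ab.
have cf : {within `[a, b], continuous f}.
  apply: continuous_subspaceT => x.
  by apply/differentiable_continuous/derivable1_diffP; case: (df x).
have [c + ->] := MVT_segment ab (fun x _ => df x) cf.
by rewrite in_itv/= => cab; exists c.
Qed.

(** The step is the primitive of [bump], shifted to start at 0 and divided by its total growth F 1 -
    F 0. The bound on its derivative comes from [bump] <= 1 and serves later to estimate approximate
    identities. *)
Lemma smooth_step_exists : exists2 S : R -> R, smooth S &
  [/\ forall x, x <= 0 -> S x = 0, forall x, 1 <= x -> S x = 1,
      forall x, 0 <= S x <= 1 & exists K, forall x, `|derive1 S x| <= K].
Proof.
pose F x : R := \int[lebesgue_measure]_(t in `]-oo, x]) bump t.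
have dF x : is_derive x 1 F (bump x).
  have cb : continuous bump := smooth_continuous smooth_bump.
  have x1 : x < x + 1 by rewrite ltrDl.
  have ib : (@lebesgue_measure R).-integrable `]-oo, x + 1] (EFin \o bump).
    by apply: integrableS bump_integrable.
  have [] := continuous_FTC1 x1 ib (ltNyr x) (cb x); rewrite -/F => dF <-.
  by rewrite derive1E; exact: derivableP.
have F0 x : x <= 0 -> F x = F 0.
  move=> x0; have [c /andP[_ c0]] := mvt_le dF x0.
  rewrite bump_out ?mul0r; first by move=> /eqP; rewrite subr_eq0 => /eqP.
  by rewrite ltNge c0.
have F1 x : 1 <= x -> F x = F 1.
  move=> x1; have [c /andP[c1 _]] := mvt_le dF x1.
  rewrite bump_out ?mul0r; first by move=> /eqP; rewrite subr_eq0 => /eqP.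
  by rewrite (ltNge c) c1 andbF.
have Fnd x y : x <= y -> F x <= F y.
  move=> xy; have [c _ h] := mvt_le dF xy.
  by rewrite -subr_ge0 h mulr_ge0 ?bump_ge0// subr_ge0.
(* Strict growth is read off on [1/4, 3/4], where the mean value point lies in the open set on which
   [bump] is positive. *)
have k0 : 0 < F 1 - F 0.
  have h14 : (4^-1 : R) <= 3 / 4 by lra.
  have [c /andP[c0 c1] h] := mvt_le dF h14.
  have : F (4^-1) < F (3 / 4).
    by rewrite -subr_gt0 h mulr_gt0 ?bump_gt0//; lra.
  have := Fnd 0 4^-1; have := Fnd (3 / 4) 1; lra.
pose S x := (F x - F 0) / (F 1 - F 0).
have dS x : is_derive x 1 S (bump x / (F 1 - F 0)).
  have := is_deriveZ (F 1 - F 0)^-1 (is_deriveB (dF x) (is_derive_cst (F 0) x 1)).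
  rewrite subr0 /GRing.scale/= mulrC; apply: near_eq_is_derive.
  by near=> y; rewrite /S mulrC.
exists S.
  apply: smooth_prim dS.
  have := @smoothM R bump (cst (F 1 - F 0)^-1) smooth_bump; apply.
  apply: (@smooth_closure R (fun f => exists c, f = cst c)); last by eexists.
  move=> _ [c ->]; exists (cst 0); first by eexists.
  by move=> x; exact: is_derive_cst.
split=> [x x0|x x1|x|].
- by rewrite /S F0// subrr mul0r.
- by rewrite /S F1// divff// gt_eqF.
- have [x0|x0] := leP x 0; first by rewrite /S F0// subrr mul0r lexx ler01.
  have [x1|x1] := leP 1 x; first by rewrite /S F1// divff ?gt_eqF// lexx ler01.
  have h0 := Fnd _ _ (ltW x0); have h1 := Fnd _ _ (ltW x1).
  rewrite /S ler_pdivlMr// ler_pdivrMr// mul0r mul1r subr_ge0 h0/=.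
  by rewrite lerB.
- exists (F 1 - F 0)^-1 => x; rewrite derive1E (derive_val (is_derive := dS x)).
  rewrite normrM ger0_norm ?bump_ge0// gtr0_norm ?invr_gt0//.
  by rewrite ler_piMl ?bump_le1// invr_ge0 ltW.
Unshelve. all: by end_near. Qed.

End bump.

(** * Absolutely continuous functions and weak derivatives *)

Section primitive.
Context {R : realType}.
Local Notation leb := (@lebesgue_measure R).
Local Notation locint := (locally_integrable [set: R]).
Implicit Types (f g F G : R -> R) (a b x : R).

Lemma compact_sub_itv (K : set R) : compact K ->
  exists2 r, 0 < r & K `<=` `[- r, r]%classic.
Proof.
move=> /compact_bounded[M [_ hM]]; exists (`|M| + 1); first by rewrite ltr_wpDl.
move=> x Kx; rewrite /= in_itv/= -ler_norml; apply: hM => //.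
by rewrite (le_lt_trans (ler_norm M))// ltrDl.
Qed.

Lemma locint_compact f (K : set R) : locint f -> compact K ->
  leb.-integrable K (EFin \o f).
Proof.
move=> [mf _ fK] cK; apply/integrableP; split.
  by apply/measurable_EFinP; exact: measurable_funS mf.
exact: fK.
Qed.

Lemma locint_itv f a b : locint f -> leb.-integrable `[a, b] (EFin \o f).
Proof. by move=> lf; apply: locint_compact => //; exact: segment_compact. Qed.

Lemma locintM f g : locint f -> continuous g -> locint (fun x => f x * g x).
Proof.
move=> lf cg; have [mf _ _] := lf; split; [|exact: openT|move=> K _ cK].
  by apply: measurable_funM => //; exact: continuous_measurable_fun.
have /integrableP[_ h] : leb.-integrable K (EFin \o (fun x => f x * g x)).
  apply: (@integrableMl _ _ _ leb K _ (EFin \o f) g) => //.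
  - exact: compact_measurable.
  - exact: locint_compact.
  - by apply: measurable_funS (continuous_measurable_fun cg).
  - have /compact_bounded[M [_ mrt]] := continuous_compact (continuous_subspaceT cg) cK.
    by exists M; split; rewrite ?num_real // => ? ? ? ?; exact: mrt.
exact: h.
Qed.

Lemma continuous_locint f : continuous f -> locint f.
Proof.
move=> cf; split; [exact: continuous_measurable_fun|exact: openT|move=> K _ cK].
have /integrableP[_ h] : leb.-integrable K (EFin \o f).
  by apply: continuous_compact_integrable => //; exact: continuous_subspaceT.
exact: h.
Qed.

(** Local absolute continuity in integral form, with [f] fixed only up to null sets: this is the
    regularity that a weak derivative provides. *)
Definition primitive F f := locint f /\
  forall a b, a <= b -> F b - F a = \int[leb]_(x in `[a, b]) f x.

Lemma primitive_continuous F f : primitive F f -> continuous F.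
Proof.
move=> [lf Ff] x.
have ab : x - 1 < x + 1 by lra.
have := parameterized_integral_continuous (ltW ab) (locint_itv (x - 1) (x + 1) lf).
move=> /(continuous_within_itvP _ ab)[] /(_ x) + _ _.
have xab : x \in `]x - 1, x + 1[%R by rewrite in_itv/=; lra.
move=> /(_ xab) h.
have : {for x, continuous (fun y => F (x - 1) + parameterized_integral leb (x - 1) y f)}.
  by apply: cvgD => //; exact: cvg_cst.
have E y : x - 1 <= y -> F (x - 1) + parameterized_integral leb (x - 1) y f = F y.
  by move=> xy; rewrite /parameterized_integral -Ff//; ring.
rewrite /prop_for /continuous_at E; last lra.
apply: cvg_trans; apply: near_eq_cvg; near=> y.
rewrite E//; apply: ltW; near: y; apply: lt_nbhsr; lra.
Unshelve. all: by end_near. Qed.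

Lemma primitive_C1 F f : (forall x, is_derive x 1 F (f x)) -> continuous f ->
  primitive F f.
Proof.
move=> dF cf; split; first exact: continuous_locint.
have cF : continuous F.
  by move=> x; apply/differentiable_continuous/derivable1_diffP; case: (dF x).
move=> a b; rewrite le_eqVlt => /predU1P[<-|ab].
  by rewrite subrr set_itv1 Rintegral_set1.
rewrite /Rintegral (@continuous_FTC2 R f F a b)//.
- exact: continuous_subspaceT.
- split; first by move=> x _; case: (dF x).
  + by apply: cvg_at_right_filter; exact: cF.
  + by apply: cvg_at_left_filter; exact: cF.
- by move=> x _; rewrite derive1E; exact: (derive_val (is_derive := dF x)).
Qed.

Lemma primitiveD F f G g : primitive F f -> primitive G g ->
  primitive (fun x => F x + G x) (fun x => f x + g x).
Proof.
move=> [lf Ff] [lg Gg]; split; first exact: locally_integrableD.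
move=> a b ab; rewrite RintegralD//; [|exact: locint_itv..].
by rewrite -Ff// -Gg//; ring.
Qed.

Lemma primitiveZ F f c : primitive F f ->
  primitive (fun x => c * F x) (fun x => c * f x).
Proof.
move=> [lf Ff]; split.
  have := locintM lf (@cst_continuous R R c).
  by congr locally_integrable; apply/funext => x; rewrite mulrC.
move=> a b ab; rewrite RintegralZl//; [|exact: locint_itv..].
by rewrite -Ff//; ring.
Qed.

Lemma primitiveB F f G g : primitive F f -> primitive G g ->
  primitive (fun x => F x - G x) (fun x => f x - g x).
Proof.
move=> pF /(primitiveZ (-1)) pG; have := primitiveD pF pG.
by congr primitive; apply/funext => x; rewrite mulN1r.
Qed.

Lemma primitive_shift F f c : primitive F f -> primitive (fun x => F x + c) f.
Proof. by move=> [lf Ff]; split => // a b ab; rewrite -Ff//; ring. Qed.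

(** Moving the endpoint [x] into a factor 0 or 1 makes the domains of integration independent of
    [x], as Fubini's theorem needs. *)
Let trunc_l f a b x : a <= x <= b -> leb.-integrable `[a, b] (EFin \o f) ->
  (\int[leb]_y ((f \_ `[a, b]) y * (y <= x)%R%:R)%:E)%E =
  (\int[leb]_(y in `[a, x]) f y)%:E.
Proof.
move=> /andP[ax xb] fi; rewrite /Rintegral fineK; last first.
  apply: integrable_fin_num => //; apply: integrableS fi => //.
  by apply: subset_itvl; rewrite bnd_simp.
rewrite [RHS]integral_mkcond; apply: eq_integral => y _.
rewrite !patchE !mem_setE !in_itv/=.
have [yx|xy] := leP y x; last by rewrite mulr0 andbF.
by rewrite (le_trans yx xb) !andbT mulr1; case: ifP.
Qed.

Let trunc_r f a b x : a <= x <= b -> leb.-integrable `[a, b] (EFin \o f) ->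
  (\int[leb]_y ((f \_ `[a, b]) y * (x <= y)%R%:R)%:E)%E =
  (\int[leb]_(y in `[x, b]) f y)%:E.
Proof.
move=> /andP[ax xb] fi; rewrite /Rintegral fineK; last first.
  apply: integrable_fin_num => //; apply: integrableS fi => //.
  by apply: subset_itvr; rewrite bnd_simp.
rewrite [RHS]integral_mkcond; apply: eq_integral => y _.
rewrite !patchE !mem_setE !in_itv/=.
have [yx|xy] := leP x y; last by rewrite mulr0.
by rewrite (le_trans ax yx) /= mulr1; case: ifP.
Qed.

Let integrable_cut (P : R -> bool) f a b :
  measurable_fun setT P ->
  leb.-integrable `[a, b] (EFin \o f) ->
  leb.-integrable setT (fun y => ((f \_ `[a, b]) y * (P y)%:R)%:E).
Proof.
move=> mP fi.
have fi' : leb.-integrable setT (EFin \o (f \_ `[a, b])).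
  by rewrite -restrict_EFin; apply: (integrable_mkcond _ _).1.
have mf' : measurable_fun setT (f \_ `[a, b]).
  by move/measurable_int: fi' => /measurable_EFinP.
apply: le_integrable fi' => //=.
  apply/measurable_EFinP; apply: measurable_funM => //.
  rewrite (_ : (fun _ => _) = (fun y => if P y then 1 else 0)); last first.
    by apply/funext => y; case: (P y).
  exact: measurable_fun_ifT.
by move=> y _; rewrite lee_fin normrM; case: (P y); rewrite ?normr1 ?normr0 ?mulr1 ?mulr0.
Qed.

(* Fubini on the triangle [y <= x]. *)
Lemma triangle_fubini f g a b F G : primitive F f -> primitive G g -> a <= b ->
  \int[leb]_(x in `[a, b]) (f x * (G x - G a)) =
  \int[leb]_(y in `[a, b]) (g y * (F b - F y)).
Proof.
move=> [lf Ff] [lg Gg] ab.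
have fi := locint_itv a b lf; have gi := locint_itv a b lg.
pose f0 := f \_ `[a, b]; pose g0 := g \_ `[a, b].
have fi0 : leb.-integrable setT (EFin \o f0).
  by rewrite -restrict_EFin; apply: (integrable_mkcond _ _).1.
have gi0 : leb.-integrable setT (EFin \o g0).
  by rewrite -restrict_EFin; apply: (integrable_mkcond _ _).1.
have mf0 : measurable_fun setT f0 by move/measurable_int: fi0 => /measurable_EFinP.
have mg0 : measurable_fun setT g0 by move/measurable_int: gi0 => /measurable_EFinP.
pose h (z : R * R) : \bar R := (f0 z.1 * (g0 z.2 * (z.2 <= z.1)%R%:R))%:E.
have mh : measurable_fun setT h.
  apply/measurable_EFinP; apply: measurable_funM; first exact: measurableT_comp.
  apply: measurable_funM; first exact: measurableT_comp.
  rewrite (_ : (fun _ => _) = (fun z : R * R => if z.2 <= z.1 then 1 else 0)); last first.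
    by apply/funext => z; case: (z.2 <= z.1).
  apply: measurable_fun_ifT => //; exact: measurable_fun_ler.
(* Tonelli: |h(x, y)| <= |f0 x| |g0 y|, and the right side integrates to a product of two finite
   numbers. *)
have hi : (leb \x leb)%E.-integrable setT h.
  apply/integrable12ltyP => //.
  have /integrableP[_ g0oo] := gi0; have /integrableP[_ f0oo] := fi0.
  pose C := fine (\int[leb]_y `|(g0 y)%:E|)%E.
  have CE : (\int[leb]_y `|(g0 y)%:E|)%E = C%:E.
    by rewrite fineK// ge0_fin_numE//; exact: integral_ge0.
  have C0 : 0 <= C by rewrite -lee_fin -CE; exact: integral_ge0.
  have mgn : measurable_fun setT (fun y => `|(g0 y)%:E|%E).
    by do 2 apply: measurableT_comp => //.
  have mfn : measurable_fun setT (fun y => `|(f0 y)%:E|%E).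
    by do 2 apply: measurableT_comp => //.
  apply: (@le_lt_trans _ _ (\int[leb]_x (C%:E * `|(f0 x)%:E|))%E); last first.
    by rewrite ge0_integralZl// lte_mul_pinfty.
  apply: ge0_le_integral => //=.
  - by move=> x _; exact: integral_ge0.
  - apply: (@measurable_fun_fubini_tonelli_F _ _ _ _ R leb (abse \o h)).
      exact: measurableT_comp.
    by move=> z /=; exact: normr_ge0.
  - by apply/measurable_EFinP; apply: measurable_funM => //; exact: measurableT_comp.
  - move=> x _; rewrite -CE muleC -ge0_integralZl//.
    apply: ge0_le_integral => //=.
    + have /measurable_EFinP mhx := measurableT_comp mh (pair1_measurable x).
      by apply/measurable_EFinP; exact: (measurableT_comp (@normr_measurable R setT) mhx).
    + by apply/measurable_EFinP; apply: measurable_funM => //; exact: measurableT_comp.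
    + move=> y _; rewrite lee_fin 2!normrM ler_wpM2l//.
      by case: (y <= x); rewrite ?mulr1 ?mulr0 ?normr0 ?normr1 ?mulr1 ?mulr0.
have := Fubini hi.
have -> : (\int[leb]_x \int[leb]_y h (x, y) =
           \int[leb]_(x in `[a, b]) (f x * (G x - G a))%:E)%E.
  rewrite [RHS]integral_mkcond; apply: eq_integral => x _.
  rewrite patchE mem_setE in_itv/=; case: ifPn => [xab|xab]; last first.
    rewrite integral0_eq// => y _; rewrite /h /f0/= patchE mem_setE in_itv/=.
    by rewrite (negbTE xab) mul0r.
  have /andP[ax _] := xab.
  rewrite Gg// EFinM -(trunc_l xab gi) -integralZl//; last first.
    by apply: (@integrable_cut (fun y => y <= x)) => //; exact: measurable_fun_ler.
  apply: eq_integral => y _; rewrite /h /f0/= patchE mem_setE in_itv/= xab.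
  by rewrite EFinM.
have -> : (\int[leb]_y \int[leb]_x h (x, y) =
           \int[leb]_(y in `[a, b]) (g y * (F b - F y))%:E)%E.
  rewrite [RHS]integral_mkcond; apply: eq_integral => y _.
  rewrite patchE mem_setE in_itv/=; case: ifPn => [yab|yab]; last first.
    rewrite integral0_eq// => x _; rewrite /h /g0/= [X in _ * (X * _)]patchE mem_setE in_itv/=.
    by rewrite (negbTE yab) mul0r mulr0.
  have /andP[_ yb] := yab.
  rewrite Ff// EFinM -(trunc_r yab fi) -integralZl//; last first.
    by apply: (@integrable_cut (fun x => y <= x)) => //; exact: measurable_fun_ler.
  apply: eq_integral => x _; rewrite /h /g0/= [X in _ * (X * _)]patchE mem_setE in_itv/= yab.
  by rewrite -EFinM mulrCA.
by rewrite /Rintegral => ->.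
Qed.

(** Expanding [G x - G a] and [F b - F y] in [triangle_fubini] leaves the two integrals of the
    Leibniz formula and boundary products, which add up to the increment of F G. *)
Lemma primitiveM F f G g : primitive F f -> primitive G g ->
  primitive (fun x => F x * G x) (fun x => f x * G x + F x * g x).
Proof.
move=> pF pG; have cF := primitive_continuous pF; have cG := primitive_continuous pG.
have [lf Ff] := pF; have [lg Gg] := pG.
have lfG : locint (fun x => f x * G x) by exact: locintM.
have lFg : locint (fun x => F x * g x).
  by have := locintM lg cF; congr locally_integrable; apply/funext => x; rewrite mulrC.
split; first exact: locally_integrableD.
move=> a b ab; have := triangle_fubini pF pG ab.
have fi := locint_itv a b lf; have gi := locint_itv a b lg.
have fGi := locint_itv a b lfG; have Fgi := locint_itv a b lFg.
have E y : g y * (F b - F y) = g y * F b - F y * g y by ring.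
under eq_Rintegral do rewrite mulrBr.
under [in RHS]eq_Rintegral do rewrite E.
have ci (u : R -> R) c : locint u -> leb.-integrable `[a, b] (EFin \o (fun x => u x * c)).
  by move=> lu; apply: locint_itv; apply: locintM => //; exact: cst_continuous.
rewrite !RintegralB//; [|exact: ci..].
rewrite !RintegralZr// -Ff// -Gg// RintegralD//.
set I := Rintegral _ _ _; set J := Rintegral _ _ _ => h.
rewrite (_ : I = (F b - F a) * G a + ((G b - G a) * F b - J)); first by ring.
by rewrite -h; ring.
Qed.

End primitive.

Section almost_everywhere.
Context d (T : measurableType d) (R : realType) (m : {measure set T -> \bar R}).

Lemma ae_imp (P Q : T -> Prop) : (forall x, P x -> Q x) ->
  {ae m, forall x, P x} -> {ae m, forall x, Q x}.
Proof. by move=> PQ; apply: filterS. Qed.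

Lemma ae_imp2 (P Q S : T -> Prop) : (forall x, P x -> Q x -> S x) ->
  {ae m, forall x, P x} -> {ae m, forall x, Q x} -> {ae m, forall x, S x}.
Proof. by move=> PQS; apply: filterS2. Qed.

End almost_everywhere.

(** * Weak derivatives of real functions *)

Section real_weak_derivative.
Context {R : realType}.
Local Notation leb := (@lebesgue_measure R).
Local Notation locint := (locally_integrable [set: R]).
Implicit Types (f g F G phi : R -> R) (a b x : R).

Definition rweak f g := [/\ locint f, locint g &
  forall phi, test_function phi ->
    \int[leb]_x (f x * derive1 phi x) = - \int[leb]_x (g x * phi x)].

(** The complement of [-r, r] is open and [phi] is zero on it, so its derivative is zero there as
    well. *)
Lemma test_function_support phi : test_function phi ->
  exists2 r, 0 < r & forall x, ~ (- r <= x <= r) ->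
    phi x = 0 /\ derive1 phi x = 0.
Proof.
move=> [sphi [K cK phi0]].
have [r r0 Kr] := compact_sub_itv cK.
have out x : ~ (- r <= x <= r) -> ~ K x by move=> xr /Kr; rewrite /= in_itv.
exists r => // x xr; split; first exact/phi0/out.
suff : is_derive x 1 phi 0 by move=> h; rewrite derive1E; exact: derive_val.
apply: near_eq_is_derive (is_derive_cst (0 : R) x (1 : R)).
move/negP : xr; rewrite negb_and -!ltNge => /orP[xr|xr]; near=> y.
  rewrite phi0//; apply: out => /andP[yr _].
  have : y < - r by near: y; exact: lt_nbhsl.
  by rewrite ltNge yr.
rewrite phi0//; apply: out => /andP[_ yr].
have : r < y by near: y; exact: lt_nbhsr.
by rewrite ltNge yr.
Unshelve. all: by end_near. Qed.

Lemma Rintegral_support (h : R -> R) (D : set R) :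
  (forall x, ~ D x -> h x = 0) -> \int[leb]_x h x = \int[leb]_(x in D) h x.
Proof.
move=> hD; rewrite [RHS]Rintegral_mkcond; apply: eq_Rintegral => x _.
by rewrite patchE; case: ifPn => // /negP xD; rewrite hD//; rewrite inE in xD.
Qed.

Lemma test_function_smooth phi : test_function phi -> smooth phi.
Proof. by case. Qed.

Lemma primitive_rweak F f : primitive F f -> rweak F f.
Proof.
move=> pF; have cF := primitive_continuous pF; have [lf _] := pF.
split => //; first exact: continuous_locint.
move=> phi tphi; have sphi := test_function_smooth tphi.
have [r r0 phi0] := test_function_support tphi.
have cphi := smooth_continuous sphi.
have cdphi := smooth_continuous (smooth_derive1 sphi).
have pphi := primitive_C1 (smooth_is_derive sphi) cdphi.
(* The product F phi is integrated over [-(r + 1), r + 1], whose endpoints lie outside [-r, r], so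
   the boundary terms vanish. *)
have [_ /(_ (- (r + 1)) (r + 1))] := primitiveM pF pphi.
have [-> _] : phi (r + 1) = 0 /\ derive1 phi (r + 1) = 0 by apply: phi0; lra.
have [-> _] : phi (- (r + 1)) = 0 /\ derive1 phi (- (r + 1)) = 0 by apply: phi0; lra.
rewrite !mulr0 subr0 RintegralD//; last 2 first.
- by apply: locint_itv; exact: locintM.
- apply: locint_itv; apply: continuous_locint => x; apply: cvgM; [exact: cF|exact: cdphi].
have rr : - (r + 1) <= r + 1 by lra.
move=> /(_ rr) /eqP; rewrite eq_sym addr_eq0 => /eqP h.
have sup x : ~ `[- (r + 1), r + 1]%classic x -> phi x = 0 /\ derive1 phi x = 0.
  by rewrite /= in_itv/= => hx; apply: phi0 => h'; apply: hx; lra.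
rewrite (Rintegral_support (D := `[- (r + 1), r + 1])); last first.
  by move=> x /sup[_ ->]; rewrite mulr0.
rewrite [in RHS](Rintegral_support (D := `[- (r + 1), r + 1])); last first.
  by move=> x /sup[-> _]; rewrite mulr0.
by rewrite h opprK.
Qed.

Lemma eq_ae_Rintegral f g (D : set R) : measurable D -> measurable_fun setT f ->
  measurable_fun setT g -> {ae leb, forall x, f x = g x} ->
  \int[leb]_(x in D) f x = \int[leb]_(x in D) g x.
Proof.
move=> mD mf mg fg; congr fine; apply: ae_eq_integral => //.
- by apply/measurable_EFinP; exact: measurable_funS mf.
- by apply/measurable_EFinP; exact: measurable_funS mg.
- by apply: ae_imp fg => x -> _.
Qed.

Lemma locint_ae f g : measurable_fun setT g -> {ae leb, forall x, f x = g x} ->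
  locint f -> locint g.
Proof.
move=> mg fg [mf oT fK]; split => // K _ cK; have := fK K (@subsetT _ _) cK.
congr (_ < _)%E; apply: ae_eq_integral => //.
- exact: compact_measurable.
- apply/measurable_EFinP; apply: measurableT_comp => //.
  by apply: measurable_funS mf.
- apply/measurable_EFinP; apply: measurableT_comp => //.
  by apply: measurable_funS mg.
- by apply: ae_imp fg => x -> _.
Qed.

Lemma locint_measurable f : locint f -> measurable_fun setT f.
Proof. by case. Qed.

Lemma rweak_ael f1 f2 g : measurable_fun setT f2 -> {ae leb, forall x, f1 x = f2 x} ->
  rweak f1 g -> rweak f2 g.
Proof.
move=> mf2 f12 [lf1 lg h]; split => //; first exact: locint_ae lf1.
move=> phi tphi; rewrite -h//.
have cd := smooth_continuous (smooth_derive1 (test_function_smooth tphi)).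
have md : measurable_fun setT (derive1 phi) by exact: continuous_measurable_fun.
apply: eq_ae_Rintegral => //.
- exact: measurable_funM.
- by apply: measurable_funM => //; exact: locint_measurable.
- by apply: ae_imp f12 => x ->.
Qed.

Lemma locint_test f phi : locint f -> test_function phi ->
  leb.-integrable setT (EFin \o (fun x => f x * phi x)) /\
  leb.-integrable setT (EFin \o (fun x => f x * derive1 phi x)).
Proof.
move=> lf tphi; have [r r0 phi0] := test_function_support tphi.
have sphi := test_function_smooth tphi.
have cphi := smooth_continuous sphi.
have cdphi := smooth_continuous (smooth_derive1 sphi).
have key h : continuous h -> (forall x, ~ (- r <= x <= r) -> h x = 0) ->
  leb.-integrable setT (EFin \o (fun x => f x * h x)).
  move=> ch h0.
  have -> : EFin \o (fun x => f x * h x) = (EFin \o (fun x => f x * h x)) \_ `[- r, r].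
    apply/funext => x; rewrite patchE mem_setE in_itv/=; case: ifPn => // /negP/h0 ->.
    by rewrite mulr0.
  apply: (integrable_mkcond _ _).1 => //; apply: locint_itv; exact: locintM.
by split; apply: key => // x /phi0[].
Qed.

Lemma rweakB f1 g1 f2 g2 : rweak f1 g1 -> rweak f2 g2 ->
  rweak (fun x => f1 x - f2 x) (fun x => g1 x - g2 x).
Proof.
move=> [lf1 lg1 h1] [lf2 lg2 h2]; split; [exact: locally_integrableB..|].
move=> phi tphi.
under eq_Rintegral do rewrite mulrBl.
under [in RHS]eq_Rintegral do rewrite mulrBl.
have [? ?] := locint_test lf1 tphi; have [? ?] := locint_test lg1 tphi.
have [? ?] := locint_test lf2 tphi; have [? ?] := locint_test lg2 tphi.
by rewrite !RintegralB// h1// h2//; ring.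
Qed.

Lemma primitive_exists g : locint g -> exists F, primitive F g.
Proof.
move=> lg.
have gi u v : leb.-integrable `[u, v] (EFin \o g) by exact: locint_itv.
have add a b c : a <= b -> b <= c ->
  \int[leb]_(x in `[a, c]) g x = \int[leb]_(x in `[a, b]) g x + \int[leb]_(x in `[b, c]) g x.
  move=> ab bc; rewrite [RHS]addrC; apply/eqP; rewrite -subr_eq; apply/eqP.
  rewrite Rintegral_itvB ?bnd_simp// Rintegral_itv_obnd_cbnd//.
  by apply: integrableS (gi b c) => //; apply: subset_itvr; rewrite bnd_simp.
exists (fun x => if 0 <= x then \int[leb]_(t in `[0, x]) g t
                 else - \int[leb]_(t in `[x, 0]) g t).
split => // a b ab.
case: (leP 0 b) => b0; case: (leP 0 a) => a0.
- by rewrite (add 0 a b)//; ring.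
- by rewrite (add a 0 b) ?(ltW a0)//; ring.
- by have := le_lt_trans (le_trans a0 ab) b0; rewrite ltxx.
- by rewrite (add a b 0) ?(ltW b0)//; ring.
Qed.

End real_weak_derivative.

(** * Weakly differentiable functions are indefinite integrals *)

Section weak_derivative_primitive.
Context {R : realType}.
Local Notation leb := (@lebesgue_measure R).
Local Notation locint := (locally_integrable [set: R]).
Implicit Types (f g F G phi : R -> R) (a b x : R).

(** A ball of radius r has length 2 r, so a mean oscillation below e / 2 is an integral of at most e
    r. The integral form is the one that [step_kernel_bound] produces. *)
Lemma lebesgue_pt_small f a e : lebesgue_pt f a -> 0 < e ->
  exists2 d, 0 < d & forall r, 0 < r -> r < d ->
    (\int[leb]_(y in ball a r) `|(f y - f a)%:E| <= (e * r)%:E)%E.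
Proof.
move=> fa e0; have e20 : 0 < e / 2 by rewrite divr_gt0.
have : \forall r \near (0:R)^'+, (davg f a r < (e / 2)%:E)%E.
  apply: (fa [set y | (y < (e / 2)%:E)%E]).
  rewrite /nbhs/= /ereal_nbhs/=; near=> z; rewrite lte_fin; near: z.
  exact: lt_nbhsl.
move=> [d /= d0 hd]; exists d => // r r0 rd.
have : (davg f a r < (e / 2)%:E)%E.
  by apply: hd => //=; rewrite sub0r normrN gtr0_norm.
rewrite /davg /iavg (lebesgue_measure_ball _ (ltW r0)) inver.
rewrite mulrn_eq0/= gt_eqF// => /ltW.
rewrite lee_pdivrMl ?mulrn_wgt0// -EFinM => /le_trans; apply.
by rewrite lee_fin -mulr_natr; lra.
Unshelve. all: by end_near. Qed.

(* The kernel [x |-> n S'(n (x - a))] has mass one and lives on [a, a + 1/n]. *)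
Lemma step_kernel_bound (S : R -> R) K f a u v (n : R) : smooth S ->
  (forall x, x <= 0 -> S x = 0) -> (forall x, 1 <= x -> S x = 1) ->
  (forall x, `|derive1 S x| <= K) -> locint f ->
  1 <= n -> u <= a -> a + 1 <= v ->
  (`|\int[leb]_(x in `[u, v]) (f x * (n * derive1 S (n * x + - (n * a)))) - f a|%:E <=
   (K * n)%:E * \int[leb]_(y in ball a (2 / n)) `|(f y - f a)%:E|)%E.
Proof.
move=> sS S0 S1 SK lf n1 ua av.
have n0 : 0 < n by rewrite (lt_le_trans _ n1).
have uv : u <= v by rewrite (le_trans ua)// (le_trans _ av)// lerDl.
pose k x := n * derive1 S (n * x + - (n * a)).
have dS x : is_derive x 1 (fun y => S (n * y + - (n * a))) (k x).
  exact: is_derive_comp_affine.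
have ck : continuous k.
  have h := @smooth_affine _ _ n (- (n * a)) (smooth_derive1 sS).
  move=> x; apply: cvgM; first exact: cvg_cst.
  exact: (smooth_continuous h).
have [_ kint] := primitive_C1 dS ck.
(* The kernel is the derivative of S(n (x - a)), which climbs from 0 at [u] to 1 at [v]. The value
   [f a] can therefore be written as the integral of [k x * f a]. *)
have mass : \int[leb]_(x in `[u, v]) k x = 1.
  rewrite -kint// S1 ?S0 ?subr0//.
    by rewrite -mulrN -mulrDr mulr_ge0_le0 ?(ltW n0)// subr_le0.
  have : n * 1 <= n * (v - a) by rewrite ler_wpM2l ?(ltW n0)//; lra.
  by rewrite mulrBr mulr1 => /(le_trans n1).
have d0 x : derive1 S x = 0 \/ 0 <= x <= 1.
  have [x0|x0] := ltP x 0.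
    left; suff h : is_derive x 1 S 0 by rewrite derive1E; exact: derive_val.
    apply: near_eq_is_derive (is_derive_cst (0 : R) x (1 : R)).
    near=> y; rewrite S0//; apply: ltW; near: y; exact: lt_nbhsl.
  have [x1|x1] := ltP 1 x; last first.
    by right.
  left; suff h : is_derive x 1 S 0 by rewrite derive1E; exact: derive_val.
  apply: near_eq_is_derive (is_derive_cst (1 : R) x (1 : R)).
  near=> y; rewrite S1//; apply: ltW; near: y; exact: lt_nbhsr.
(* The radius 2 / n makes the open ball contain the closed interval [a, a + 1 / n]. *)
have kb x : ~ ball a (2 / n) x -> k x = 0.
  move=> xa; rewrite /k; case: (d0 (n * x + - (n * a))) => [->|/andP[h0 h1]].
    by rewrite mulr0.
  exfalso; apply: xa; rewrite /ball/= ltr_norml.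
  have e : n * (2 / n) = 2 by field; rewrite gt_eqF.
  by apply/andP; split; rewrite -(ltr_pM2l n0) ?mulrN ?e mulrBr; lra.
have kK x : `|k x| <= n * K by rewrite normrM gtr0_norm// ler_wpM2l// (ltW n0).
have lfk : locint (fun x => f x * k x) by exact: locintM.
have lck : locint (fun x => k x * f a).
  by apply: continuous_locint => x; apply: cvgM; [exact: ck|exact: cvg_cst].
have -> : \int[leb]_(x in `[u, v]) (f x * k x) - f a =
    \int[leb]_(x in `[u, v]) (f x * k x - k x * f a).
  rewrite RintegralB//; [|exact: locint_itv..].
  by rewrite RintegralZr ?mass ?mul1r//; apply: locint_itv; exact: continuous_locint.
have lfkB := locally_integrableB lfk lck.
rewrite EFin_normr_Rintegral//; last exact: (locint_itv u v lfkB).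
apply: (le_trans (le_abse_integral _ _ _)) => //.
  apply/measurable_EFinP.
  by apply: measurable_funS (locint_measurable lfkB).
have mf := locint_measurable lf.
have mg : measurable_fun setT (fun y => `|(f y - f a)%:E|%E).
  do 2 apply: measurableT_comp => //; exact: measurable_funB.
have KL : (0 <= (K * n)%:E :> \bar R)%E.
  by rewrite lee_fin mulr_ge0// ?(ltW n0)// (le_trans _ (SK 0)).
have mba : measurable (ball a (2 / n)) by exact: measurable_ball.
have mgb : measurable_fun (ball a (2 / n)) (fun y => `|(f y - f a)%:E|%E).
  by apply: measurable_funS mg.
apply: (@le_trans _ _ (\int[leb]_(y in ball a (2 / n))
    ((K * n)%:E * `|(f y - f a)%:E|))%E); last by rewrite ge0_integralZl.
rewrite [leLHS]integral_mkcond [leRHS]integral_mkcond.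
apply: ge0_le_integral => //.
- by move=> x _; rewrite erestrict_ge0.
- apply/(measurable_restrictT _ _).1 => //.
  do 2 apply: measurableT_comp => //.
  by apply: measurable_funS (locint_measurable lfkB).
- apply/(measurable_restrictT _ _).1; first exact: measurable_ball.
  by apply: measurable_funeM; apply: measurable_funS mg.
move=> x _; rewrite !patchE; have [xb|xb] := pselect (ball a (2 / n) x).
  rewrite (mem_set xb); case: ifPn => _; last by rewrite mule_ge0.
  rewrite /= lee_fin (_ : _ - _ = k x * (f x - f a)); last by ring.
  by rewrite normrM ler_wpM2r// mulrC.
rewrite (memNset xb); case: ifPn => // _.
by rewrite /= kb// mulr0 mul0r subrr normr0.
Unshelve. all: by end_near. Qed.

(* Tested against [S(n (x - a)) - S(n (x - b))], whose derivative approximates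
   delta_a - delta_b. *)
Lemma rweak0_eq f a b : rweak f (cst 0) -> lebesgue_pt f a -> lebesgue_pt f b ->
  a < b -> f a = f b.
Proof.
move=> [lf _ wf] fa fb ab.
have [S sS [S0 S1 _ [K SK]]] := @smooth_step_exists R.
have K0 : 0 <= K by rewrite (le_trans _ (SK 0)).
suff h e : 0 < e -> `|f a - f b| <= e.
  apply/eqP; rewrite -subr_eq0 -normr_le0; apply/ler_addgt0Pr => e /h.
  by rewrite add0r.
(* The bound of [step_kernel_bound] is K n times an integral over a ball of radius 2 / n, hence at
   most 2 K e' <= e / 2 with this [e']. *)
move=> e0; pose e' := e / (4 * (K + 1)).
have e'0 : 0 < e' by rewrite divr_gt0// mulr_gt0// ltr_wpDl.
have [d1 d10 h1] := lebesgue_pt_small fa e'0.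
have [d2 d20 h2] := lebesgue_pt_small fb e'0.
pose n := 1 + 2 / d1 + 2 / d2 + 1.
have t1 : 0 < 2 / d1 by rewrite divr_gt0.
have t2 : 0 < 2 / d2 by rewrite divr_gt0.
have n1 : 1 <= n by rewrite /n; lra.
have n0 : 0 < n by rewrite (lt_le_trans _ n1).
have nd1 : 2 / n < d1.
  by rewrite ltr_pdivrMr// mulrC -ltr_pdivrMr// /n; lra.
have nd2 : 2 / n < d2.
  by rewrite ltr_pdivrMr// mulrC -ltr_pdivrMr// /n; lra.
have n20 : 0 < 2 / n by rewrite divr_gt0.
have bnd (I J : R) c : (`|I - J|%:E <= (K * n)%:E * c)%E -> (c <= (e' * (2 / n))%:E)%E ->
    `|I - J| <= e / 2.
  move=> IJ ce; rewrite -lee_fin (le_trans IJ)//.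
  apply: (@le_trans _ _ ((K * n)%:E * (e' * (2 / n))%:E)%E).
    by rewrite lee_wpmul2l// lee_fin mulr_ge0// ltW.
  rewrite -EFinM lee_fin.
  have -> : K * n * (e' * (2 / n)) = (K / (K + 1)) * (e / 2).
    by rewrite /e'; field; rewrite !gt_eqF//= ltr_wpDl.
  by rewrite ler_piMl ?divr_ge0 ?(ltW e0)// ler_pdivrMr ?ltr_wpDl// mul1r lerDl.
pose k c x := n * derive1 S (n * x + - (n * c)).
pose phi x := S (n * x + - (n * a)) - S (n * x + - (n * b)).
have dS c x : is_derive x 1 (fun y => S (n * y + - (n * c))) (k c x).
  exact: is_derive_comp_affine.
have dphi x : derive1 phi x = k a x - k b x.
  rewrite derive1E; apply: (derive_val (is_derive := is_deriveB (dS a x) (dS b x))).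
have tphi : test_function phi.
  split; first exact: smoothB (@smooth_affine _ _ n (- (n * a)) sS)
    (@smooth_affine _ _ n (- (n * b)) sS).
  exists `[a, b + 1]%classic; first exact: segment_compact.
  move=> x; rewrite /= in_itv/= => /negP; rewrite negb_and -!ltNge => /orP[xa|xb].
    by rewrite /phi !S0 ?subrr// -mulrN -mulrDr mulr_ge0_le0 ?(ltW n0)//; lra.
  rewrite /phi !S1 ?subrr//.
    have : n * 1 <= n * (x - b) by rewrite ler_wpM2l ?(ltW n0)//; lra.
    by rewrite mulrBr mulr1 => /(le_trans n1).
  have : n * 1 <= n * (x - a) by rewrite ler_wpM2l ?(ltW n0)//; lra.
  by rewrite mulrBr mulr1 => /(le_trans n1).
have ck c : continuous (k c).
  have h := @smooth_affine _ _ n (- (n * c)) (smooth_derive1 sS).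
  by move=> x; apply: cvgM; [exact: cvg_cst|exact: (smooth_continuous h)].
have [r r0 phi0] := test_function_support tphi.
(* [u, v] contains [a, a + 1], [b, b + 1] and [-r, r], so it serves both kernels and the support of
   [phi]. *)
pose u := Num.min a (- r); pose v := Num.max (b + 1) r.
have ua : u <= a by rewrite ge_min lexx.
have ub : u <= b by rewrite (le_trans ua)// ltW.
have av : a + 1 <= v by rewrite le_max lerD2r (ltW ab).
have bv : b + 1 <= v by rewrite le_max lexx.
have ka := step_kernel_bound sS S0 S1 SK lf n1 ua av.
have kb := step_kernel_bound sS S0 S1 SK lf n1 ub bv.
have lfk c : leb.-integrable `[u, v] (EFin \o (fun x => f x * k c x)).
  by apply: locint_itv; exact: locintM.
have := wf phi tphi.
under [in RHS]eq_Rintegral do rewrite mul0r.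
rewrite Rintegral_cst// mul0r oppr0.
rewrite (Rintegral_support (D := `[u, v])); last first.
  move=> x xuv; have [|_ ->] := phi0 x; last by rewrite mulr0.
  move=> /andP[xr rx]; apply: xuv; rewrite /= in_itv/=; apply/andP; split.
    by rewrite ge_min xr orbT.
  by rewrite le_max rx orbT.
under eq_Rintegral do rewrite dphi mulrBr.
rewrite RintegralB// => /eqP; rewrite subr_eq0 => /eqP ab_eq.
have {}ka := bnd _ _ _ ka (h1 _ n20 nd1).
have {}kb := bnd _ _ _ kb (h2 _ n20 nd2).
rewrite -/(k a) in ka; rewrite -/(k b) in kb.
have -> : f a - f b = (\int[leb]_(x in `[u, v]) (f x * k b x) - f b) -
                      (\int[leb]_(x in `[u, v]) (f x * k a x) - f a).
  by rewrite ab_eq; ring.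
by rewrite (splitr e); exact: le_trans (ler_normB _ _) (lerD kb ka).
Qed.

(** A null set contains no interval of positive length. *)
Lemma lebesgue_ae_nonempty (P : R -> Prop) : {ae leb, forall x, P x} ->
  forall u v, u < v -> exists2 x, P x & u < x < v.
Proof.
move=> [N [mN N0 PN]] u v uv; apply: contrapT => h.
have : (leb `]u, v[ <= leb N)%E.
  apply: le_measure; rewrite ?inE//.
  move=> x /=; rewrite in_itv/= => xuv; apply: PN => /= Px; apply: h.
  by exists x.
rewrite N0 lebesgue_measure_itv/= lte_fin uv -EFinD lee_fin.
by rewrite subr_le0 leNgt uv.
Qed.

(** Du Bois-Reymond's lemma. Almost every point is a Lebesgue point of [f], and [rweak0_eq] makes
    the values at all such points equal. *)
Lemma rweak0_cst f : rweak f (cst 0) -> exists c, {ae leb, forall x, f x = c}.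
Proof.
move=> wf; have [lf _ _] := wf.
have hL := lebesgue_differentiation lf.
have [a fa _] := lebesgue_ae_nonempty hL ltr01.
exists (f a); apply: ae_imp hL => x fx.
by have [xa|xa|->//] := ltgtP x a; [|apply/esym]; exact: rweak0_eq wf _ _ xa.
Qed.

(** Subtracting an indefinite integral of [g] leaves a function whose weak derivative is zero, hence
    a constant, which is absorbed into the representative. *)
Lemma rweak_primitive f g : rweak f g ->
  exists2 F, primitive F g & {ae leb, forall x, f x = F x}.
Proof.
move=> wf; have [_ lg _] := wf.
have [G pG] := primitive_exists lg.
have : rweak (fun x => f x - G x) (cst 0).
  have := rweakB wf (primitive_rweak pG).
  by congr rweak; apply/funext => x; rewrite subrr.
move=> /rweak0_cst[c hc]; exists (fun x => G x + c); first exact: primitive_shift.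
by apply: ae_imp hc => x /eqP; rewrite subr_eq addrC => /eqP.
Qed.

Lemma ae_eq_continuous f g : continuous f -> continuous g ->
  {ae leb, forall x, f x = g x} -> f = g.
Proof.
move=> cf cg fg; apply/funext => x; apply/eqP; rewrite -subr_eq0 -normr_le0.
apply/ler_addgt0Pr => e e0; rewrite add0r.
have : \forall y \near x, `|(f x - g x) - (f y - g y)| < e.
  have h : (fun y => f y - g y) @ x --> f x - g x by apply: cvgB; [exact: cf|exact: cg].
  by move/cvgrPdist_lt: h; exact.
move=> [d /= d0 hd].
have [|y fgy /andP[y1 y2]] := lebesgue_ae_nonempty fg (u := x - d) (v := x + d).
  by lra.
have := hd y; rewrite /ball/= fgy subrr subr0 => /(_ _)/ltW; apply.
by rewrite ltr_norml; lra.
Qed.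

Lemma primitive_unique F f g : primitive F f -> primitive F g ->
  {ae leb, forall x, f x = g x}.
Proof.
move=> [lf Ff] [lg Fg]; have lfg := locally_integrableB lf lg.
(* Lebesgue differentiation from a fixed left endpoint -n reaches only the points x > -n, so it is
   applied for every n and the countably many null sets are united. *)
have : {ae leb, forall x, forall n : nat, - n%:R < x -> f x - g x = 0}.
  apply/ae_foralln => n.
  have ii y : leb.-integrable `[- n%:R, y] (EFin \o (f \- g)) by exact: locint_itv.
  have := @FTC1 R (f \- g) (BLeft (- n%:R)) ii lfg.
  apply: ae_imp => x h nx; have [|_ hE] := h; first by rewrite lte_fin.
  have h0 : is_derive x 1 (fun y : R => \int[leb]_(t in `[- n%:R, y]) (f t - g t)) 0.
    apply: near_eq_is_derive (is_derive_cst (0 : R) x (1 : R)).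
    near=> y; have ny : - n%:R <= y by apply: ltW; near: y; exact: lt_nbhsr.
    by rewrite RintegralB//; [rewrite -Ff// -Fg// subrr|exact: locint_itv..].
  by rewrite -[LHS]/((f \- g) x) -hE derive1E; exact: derive_val.
apply: ae_imp => x h; apply/eqP; rewrite -subr_eq0; apply/eqP.
apply: (h (Num.truncn `|x|).+1); rewrite ltrNl.
by rewrite (le_lt_trans _ (truncnS_gt _))// -normrN ler_norm.
Unshelve. all: by end_near. Qed.

End weak_derivative_primitive.

(** * Weighted inequalities *)

Lemma ge0_integral_scale d (T : measurableType d) (R : realType)
    (m : {measure set T -> \bar R}) (C : R) (f : T -> R) :
  0 <= C -> measurable_fun setT f -> (forall x, 0 <= f x) ->
  (C%:E * \int[m]_x (f x)%:E = \int[m]_x (C * f x)%:E)%E.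
Proof.
move=> C0 mf f0; under [RHS]eq_integral do rewrite EFinM.
rewrite ge0_integralZl_EFin//; first by move=> x _; rewrite lee_fin.
exact/measurable_EFinP.
Qed.

Section cutoff.
Context {R : realType}.
Local Notation leb := (@lebesgue_measure R).
Local Notation box n := ([set` Interval (BLeft (- n)%R) (BRight n%R)]).
Implicit Types (f g F G l r t : R -> R) (a b x : R).

Lemma ge0_integral_exhaust f (C : \bar R) : measurable_fun setT f ->
  (forall x, 0 <= f x) ->
  (forall n : nat, (\int[leb]_(x in box n%:R) (f x)%:E <= C)%E) ->
  (\int[leb]_x (f x)%:E <= C)%E.
Proof.
move=> mf f0 fC.
have mD (n : nat) : measurable `[- (n%:R : R), n%:R] by [].
have nd : nondecreasing_seq (fun n : nat => `[- (n%:R : R), n%:R]%classic).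
  move=> m n mn; apply/subsetPset => x /=; rewrite !in_itv/= => /andP[h1 h2].
  have mnR : m%:R <= n%:R :> R by rewrite ler_nat.
  by rewrite (le_trans h2)// (le_trans _ h1)// lerN2.
have U : \bigcup_n `[- (n%:R : R), n%:R]%classic = setT.
  apply/seteqP; split => // x _; exists (Num.truncn `|x|).+1 => //=.
  by rewrite in_itv/= -ler_norml ltW// truncnS_gt.
have h : (\int[leb]_(x in box n%:R) (f x)%:E @[n --> \oo] --> \int[leb]_x (f x)%:E)%E.
  rewrite -[X in _ --> integral _ X _]U; apply: ge0_nondecreasing_set_cvg_integral => //=.
    by move=> n; apply/measurable_EFinP; exact: measurable_funS mf.
  by move=> n x _; rewrite lee_fin.
rewrite -(cvg_lim _ h)//; apply: lime_le; first by apply/cvg_ex; eexists; exact: h.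
by apply: nearW => n.
Qed.

(** The integral of [f] over [a, b] is F b - F a = 0, so [f] disappears after integration. If the
    integral of [r] is infinite the bound is trivial; if it is finite, [l] is integrable by
    comparison with f + r. *)
Lemma itv_primitive_le F f l r a b : primitive F f -> F b = F a -> a <= b ->
  measurable_fun setT l -> measurable_fun setT r ->
  (forall x, 0 <= l x) -> (forall x, 0 <= r x) ->
  (forall x, a <= x <= b -> l x <= f x + r x) ->
  (\int[leb]_(x in `[a, b]) (l x)%:E <= \int[leb]_(x in `[a, b]) (r x)%:E)%E.
Proof.
move=> [lf Ff] Fab ab ml mr l0 r0 lfr.
have := leey (\int[leb]_(x in `[a, b]) (r x)%:E)%E.
rewrite le_eqVlt => /predU1P[->|roo]; first by rewrite leey.
have mlD : measurable_fun `[a, b] (EFin \o l).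
  by apply/measurable_EFinP; exact: measurable_funS ml.
have mrD : measurable_fun `[a, b] (EFin \o r).
  by apply/measurable_EFinP; exact: measurable_funS mr.
have ir : leb.-integrable `[a, b] (EFin \o r).
  apply/integrableP; split => //; rewrite (le_lt_trans _ roo)//.
  by under eq_integral do rewrite /= ger0_norm//.
have fi := locint_itv a b lf.
have ifr : leb.-integrable `[a, b] (fun x => (f x)%:E + (r x)%:E)%E.
  exact: integrableD.
have il : leb.-integrable `[a, b] (EFin \o l).
  apply: le_integrable ifr => //= x; rewrite in_itv/= => xab.
  rewrite lee_fin ger0_norm// ger0_norm ?lfr//.
  by rewrite (le_trans (l0 x))// lfr.
apply: (@le_trans _ _ (\int[leb]_(x in `[a, b]) ((f x)%:E + (r x)%:E))%E).
  apply: le_integral => // x; rewrite inE/= in_itv/= => xab.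
  by rewrite -EFinD lee_fin lfr.
rewrite integralD//.
have -> : (\int[leb]_(x in `[a, b]) (f x)%:E = 0)%E.
  rewrite -[LHS]fineK; last exact: integrable_fin_num.
  by congr EFin; rewrite -[LHS]/(Rintegral leb `[a, b] f) -Ff// Fab subrr.
by rewrite add0e.
Qed.

(** A parabola is enough, as it is used on [-n, n] only: it vanishes at both ends and its derivative
    is of order 1 / n there. *)
Definition cutoff (n x : R) : R := 1 - (n ^+ 2)^-1 * (x * x).

Lemma primitive_id : primitive (@id R) (fun _ => 1).
Proof.
exact: (primitive_C1 (fun x => is_derive_id x 1) (@cst_continuous R R 1)).
Qed.

Lemma primitive_cst c : primitive (fun _ : R => c) (fun _ => 0).
Proof.
exact: (primitive_C1 (fun x => is_derive_cst c x 1) (@cst_continuous R R 0)).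
Qed.

Lemma primitive_cutoff n :
  primitive (cutoff n) (fun x => - (2 * x / n ^+ 2)).
Proof.
have := primitiveB (primitive_cst 1)
  (primitiveZ (n ^+ 2)^-1 (primitiveM primitive_id primitive_id)).
by congr primitive; apply/funext => x; ring.
Qed.

Lemma cutoff_itv n x : 0 < n -> - n <= x <= n -> 0 <= cutoff n x <= 1.
Proof.
move=> n0 /andP[nx xn]; rewrite /cutoff.
have n20 : 0 < n ^+ 2 by rewrite exprn_gt0.
rewrite subr_ge0 gerBl mulr_ge0 ?invr_ge0 ?(ltW n20) ?andbT//; last by rewrite -expr2 sqr_ge0.
by rewrite ler_pdivrMl// mulr1; nra.
Qed.

Lemma cutoff_end n : 0 < n -> cutoff n n = 0 /\ cutoff n (- n) = 0.
Proof. by move=> n0; split; rewrite /cutoff; field; rewrite gt_eqF. Qed.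

(** For |x| <= n / 2 the cutoff is at least 3/4, and 2 (3/4)^2 > 1. This is the origin of the factor
    2 in [cutoff_bound]. *)
Lemma cutoff_half m n x : 0 < n -> 2 * m <= n -> - m <= x <= m ->
  1 <= 2 * cutoff n x ^+ 2.
Proof.
move=> n0 mn xm.
have h : 3 / 4 <= cutoff n x.
  rewrite /cutoff lerBrDl addrC -lerBrDl.
  rewrite (_ : 1 - 3 / 4 = 4^-1); last by field.
  by rewrite ler_pdivrMl ?exprn_gt0//; nra.
nra.
Qed.

(** The first bound serves where the derivative of the cutoff is absorbed into a constant, the
    second where its contribution must vanish as n grows. *)
Lemma cutoff_derive_le n x : 2 <= n -> - n <= x <= n ->
  (2 * x / n ^+ 2) ^+ 2 <= 1 /\ `|2 * x / n ^+ 2| <= 2 / n.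
Proof.
move=> n2 xn; have n0 : 0 < n by rewrite (lt_le_trans _ n2).
have h : `|2 * x / n ^+ 2| <= 2 / n.
  rewrite normrM normfV (ger0_norm (sqr_ge0 n)) ler_pdivrMr ?exprn_gt0//.
  rewrite (_ : 2 / n * n ^+ 2 = 2 * n); last by field; rewrite gt_eqF.
  by rewrite normrM ger0_norm// ler_wpM2l// ler_norml.
split => //; rewrite -real_normK ?num_real//; apply: exprn_ile1 => //.
by rewrite (le_trans h)// ler_pdivrMr// mul1r.
Qed.

(** On [-m, m] the factor 2 cutoff^2 dominates 1, the derivative [f] integrates to zero over
    [-n, n], and the error n^-1 int t tends to 0 while m stays fixed. Letting [-m, m] exhaust the
    line gives the bound in [0, +oo]. *)
Lemma cutoff_bound l r t :
  measurable_fun setT l -> measurable_fun setT r -> measurable_fun setT t ->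
  (forall x, 0 <= l x) -> (forall x, 0 <= r x) -> (forall x, 0 <= t x) ->
  (\int[leb]_x (t x)%:E < +oo)%E ->
  (forall n, 2 <= n -> exists F f, [/\ primitive F f, F n = F (- n) &
    forall x, - n <= x <= n ->
      cutoff n x ^+ 2 * l x <= f x + (r x + n^-1 * t x)]) ->
  (\int[leb]_x (l x)%:E <= 2%:E * \int[leb]_x (r x)%:E)%E.
Proof.
move=> ml mr mt l0 r0 t0 too H.
apply: ge0_integral_exhaust => // m.
have ti0 : (0 <= \int[leb]_x (t x)%:E)%E by apply: integral_ge0 => x _; rewrite lee_fin.
pose T := fine (\int[leb]_x (t x)%:E)%E.
have TE : (\int[leb]_x (t x)%:E = T%:E)%E by rewrite fineK// ge0_fin_numE.
have T0 : 0 <= T by rewrite -lee_fin -TE.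
apply/lee_addgt0Pr => e e0.
(* The three terms secure n >= 2 and n >= 2 m for the cutoff lemmas, and 2 T / n <= e for the
   error. *)
pose n := 2 + 2 * m%:R + 2 * T / e.
have Te0 : 0 <= 2 * T / e by rewrite divr_ge0 ?mulr_ge0// ltW.
have m0 : 0 <= (m%:R : R) by [].
have n2 : 2 <= n by rewrite /n; lra.
have mn : 2 * m%:R <= n by rewrite /n; lra.
have n0 : 0 < n by rewrite (lt_le_trans _ n2).
have nn : - n <= n by rewrite ge0_cp// ltW.
have [F [f [pF Fn h]]] := H n n2.
have mc : measurable_fun setT (cutoff n).
  by apply: continuous_measurable_fun; exact: primitive_continuous (primitive_cutoff n).
have ml' : measurable_fun setT (fun x => cutoff n x ^+ 2 * l x).
  by apply: measurable_funM => //; exact: measurable_funX.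
have mt' : measurable_fun setT (fun x => n^-1 * t x) by exact: measurable_funM.
have mr' : measurable_fun setT (fun x => r x + n^-1 * t x) by exact: measurable_funD.
have l'0 x : 0 <= cutoff n x ^+ 2 * l x by rewrite mulr_ge0// sqr_ge0.
have t'0 x : 0 <= n^-1 * t x by rewrite mulr_ge0// invr_ge0 ltW.
have r'0 x : 0 <= r x + n^-1 * t x by rewrite addr_ge0.
have key := itv_primitive_le pF Fn nn ml' mr' l'0 r'0 h.
have mE (g : R -> R) D : measurable_fun setT g -> measurable_fun D (fun x => (g x)%:E).
  by move=> mg; apply/measurable_EFinP; exact: measurable_funS mg.
apply: (@le_trans _ _ (2%:E * \int[leb]_(x in box n) (cutoff n x ^+ 2 * l x)%:E)%E).
  rewrite -ge0_integralZl//; last 2 first.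
  - exact: mE.
  - by move=> x _; rewrite lee_fin.
  apply: (@le_trans _ _ (\int[leb]_(x in box m%:R)
     (2%:E * (cutoff n x ^+ 2 * l x)%:E))%E).
    apply: ge0_le_integral => //.
    - by move=> x _; rewrite lee_fin.
    - exact: mE.
    - by apply: measurable_funeM; exact: mE.
    - move=> x; rewrite /= in_itv/= => xm; rewrite -EFinM lee_fin mulrA.
      by rewrite ler_peMl// (cutoff_half n0 mn).
  apply: ge0_subset_integral => //.
  - by apply: measurable_funeM; exact: mE.
  - by move=> x _; rewrite -EFinM lee_fin mulr_ge0.
  - move=> x /=; rewrite !in_itv/=; lra.
have le1 : (\int[leb]_(x in box n) (r x + n^-1 * t x)%:E <=
            \int[leb]_x (r x)%:E + (n^-1 * T)%:E)%E.
  apply: (@le_trans _ _ (\int[leb]_x ((r x)%:E + (n^-1 * t x)%:E))%E).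
    by apply: ge0_subset_integral => //; [exact: mE|move=> x _; rewrite lee_fin].
  rewrite ge0_integralD//; last 4 first.
  - by move=> x _; rewrite lee_fin.
  - exact: mE.
  - by move=> x _; rewrite lee_fin.
  - exact: mE.
  rewrite leeD2l// EFinM -TE -ge0_integralZl//; last 3 first.
  - exact: mE.
  - by move=> x _; rewrite lee_fin.
  - by rewrite lee_fin invr_ge0 ltW.
apply: (@le_trans _ _ (2%:E * (\int[leb]_x (r x)%:E + (n^-1 * T)%:E))%E).
  by rewrite lee_wpmul2l// (le_trans key).
rewrite muleDr//; last by rewrite ge0_adde_def// inE ?lee_fin ?mulr_ge0 ?invr_ge0 ?(ltW n0)//; apply: integral_ge0 => x _; rewrite lee_fin.
rewrite leeD2l// -EFinM lee_fin mulrCA ler_pdivrMl//.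
rewrite -ler_pdivrMr// /n; lra.
Qed.

End cutoff.

(** * Inequalities with the weight exp(-U) *)

Section weighted_inequalities.
Context {R : realType}.
Local Notation leb := (@lebesgue_measure R).
Variable U : R -> R.
Hypothesis hU : C2 U.
Implicit Types (f g F G : R -> R) (a b x : R).
Local Notation V := (derive1 U).
Local Notation V' := (derive1n 2 U).
Local Notation w := (fun x => expR (- U x)).

Lemma potential_is_derive x : is_derive x 1 U (V x).
Proof. by rewrite derive1E; apply: derivableP; case: hU. Qed.

Lemma potential_derive_is_derive x : is_derive x 1 V (V' x).
Proof. by rewrite derive1nS derive1E; apply: derivableP; case: hU. Qed.

Lemma potential_derive_continuous : continuous V.
Proof.
move=> x; apply/differentiable_continuous/derivable1_diffP.
by case: (potential_derive_is_derive x).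
Qed.

Lemma primitive_potential_derive : primitive V V'.
Proof.
by apply: primitive_C1; [exact: potential_derive_is_derive|case: hU].
Qed.

(** The value c = -1 gives the weight [w]; c = 1 gives its inverse, by which a function is divided
    by [w]. *)
Lemma weight_continuous c : continuous (fun x => expR (c * U x)).
Proof.
move=> x; apply: (@continuous_comp _ _ _ (fun y => c * U y) expR); last exact: continuous_expR.
by apply: cvgM; [exact: cvg_cst|exact: C2_continuous].
Qed.

Lemma primitive_weight c : primitive (fun x => expR (c * U x))
  (fun x => c * V x * expR (c * U x)).
Proof.
apply: primitive_C1 => x.
  rewrite mulrC; apply: (@is_derive1_comp _ expR (fun y => c * U y)).
  exact: (is_deriveZ c (potential_is_derive x)).
apply: cvgM; last exact: weight_continuous.
by apply: cvgM; [exact: cvg_cst|exact: potential_derive_continuous].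
Qed.

Lemma primitive_w : primitive w (fun x => - V x * w x).
Proof.
have := primitive_weight (-1).
by congr primitive; apply/funext => x; rewrite mulN1r// mulN1r.
Qed.

Lemma w_gt0 x : 0 < w x. Proof. exact: expR_gt0. Qed.
Lemma w_ge0 x : 0 <= w x. Proof. exact: expR_ge0. Qed.

Lemma measurable_w : measurable_fun setT w.
Proof. exact: C2_measurable_expR. Qed.

Lemma measurable_V : measurable_fun setT V.
Proof. exact: continuous_measurable_fun potential_derive_continuous. Qed.

Let msq f : measurable_fun setT f -> measurable_fun setT (fun x => f x ^+ 2 * w x).
Proof. by move=> mf; apply: measurable_funM; [exact: measurable_funX|exact: measurable_w]. Qed.

Lemma young (e p q : R) : 0 < e -> 2 * p * q <= e * p ^+ 2 + e^-1 * q ^+ 2.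
Proof.
move=> e0; rewrite -subr_ge0.
have -> : e * p ^+ 2 + e^-1 * q ^+ 2 - 2 * p * q = e^-1 * (e * p - q) ^+ 2.
  by field; rewrite gt_eqF.
by rewrite mulr_ge0 ?sqr_ge0// invr_ge0 ltW.
Qed.

(** The first four terms on the right are minus the derivative of c^2 V F^2 w, divided by w. Of the
    square c^2 (V F)^2 among them, the bound on V' uses up the share d, and the two mixed products
    use up e each by Young's inequality. *)
Let Vsq_pointwise (e d A c c' v v' F f : R) : 0 < e -> 0 <= A ->
  0 <= c <= 1 -> c' ^+ 2 <= 1 -> v' <= d * v ^+ 2 + A ->
  (1 - d - 2 * e) * (c ^+ 2 * (v * F) ^+ 2) <=
    c ^+ 2 * (v * F) ^+ 2 - c ^+ 2 * v' * F ^+ 2 - 2 * c ^+ 2 * v * F * f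
    - 2 * c * c' * v * F ^+ 2 + ((A + e^-1) * F ^+ 2 + e^-1 * f ^+ 2).
Proof.
move=> e0 A0 /andP[c0 c1] c'1 hv.
have ei : 0 < e^-1 by rewrite invr_gt0.
have c2 : c ^+ 2 <= 1 by rewrite exprn_ile1.
have y1 := young (c * v * F) (c * f) e0.
have y2 := young (c * v * F) (c' * F) e0.
have h1 : c ^+ 2 * F ^+ 2 * v' <= c ^+ 2 * F ^+ 2 * (d * v ^+ 2 + A).
  by rewrite ler_wpM2l// mulr_ge0// sqr_ge0.
have h2 : e^-1 * (c * f) ^+ 2 <= e^-1 * f ^+ 2.
  by rewrite ler_wpM2l ?(ltW ei)// exprMn ler_piMl ?sqr_ge0.
have h3 : e^-1 * (c' * F) ^+ 2 <= e^-1 * F ^+ 2.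
  by rewrite ler_wpM2l ?(ltW ei)// exprMn ler_piMl ?sqr_ge0.
have h4 : A * (c ^+ 2 * F ^+ 2) <= A * F ^+ 2.
  by rewrite ler_wpM2l// ler_piMl ?sqr_ge0.
move: y1 y2 h1 h2 h3 h4; rewrite !exprMn; lra.
Qed.

(* Integrate the derivative of [cutoff^2 V F^2 w] over [-n, n]. *)
Lemma potential_sq_bound (delta A : R) : delta < 1 -> 0 < A ->
  (forall x, V' x <= delta * `|V x| ^+ 2 + A) ->
  exists2 C, 0 < C & forall F f, primitive F f ->
  (\int[leb]_x ((V x * F x) ^+ 2 * w x)%:E <=
   C%:E * \int[leb]_x ((F x ^+ 2 + f x ^+ 2) * w x)%:E)%E.
Proof.
move=> d1 A0 hV'.
(* With this choice the coefficient 1 - delta - 2 e left in front of the square equals 2 e > 0. *)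
have [e eE e0] : exists2 e, e = (1 - delta) / 4 & 0 < e.
  by eexists; [reflexivity|rewrite divr_gt0// subr_gt0].
have ei : 0 < e^-1 by rewrite invr_gt0.
pose C := (A + e^-1) / (2 * e).
have C0 : 0 < C by apply: divr_gt0; [exact: addr_gt0|exact: mulr_gt0].
exists (2 * C); first by rewrite mulr_gt0.
move=> F f pF; have cF := primitive_continuous pF; have [lf _] := pF.
have mF := continuous_measurable_fun cF; have mf := locint_measurable lf.
have m0 : measurable_fun setT (fun x => (F x ^+ 2 + f x ^+ 2) * w x).
  by apply: measurable_funM measurable_w; apply: measurable_funD; exact: measurable_funX.
have r0 x : 0 <= (F x ^+ 2 + f x ^+ 2) * w x.
  by rewrite mulr_ge0 ?w_ge0// addr_ge0// sqr_ge0.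
rewrite EFinM -muleA (ge0_integral_scale leb (ltW C0) m0 r0).
apply: (@cutoff_bound _ _ _ (fun _ => 0)) => //.
- apply: msq; exact: measurable_funM measurable_V mF.
- exact: measurable_funM.
- by move=> x; rewrite mulr_ge0 ?w_ge0// sqr_ge0.
- by move=> x; rewrite mulr_ge0// ltW.
- by rewrite integral0.
move=> n n2; have n0 : 0 < n by rewrite (lt_le_trans _ n2).
have pc := primitive_cutoff n.
(* The sign produces the four derivative terms of [Vsq_pointwise], and 1 / (2 e) normalizes the
   coefficient of the square to one. *)
have p := primitiveZ (- (2 * e)^-1) (primitiveM (primitiveM (primitiveM pc pc)
  (primitiveM primitive_potential_derive (primitiveM pF pF))) primitive_w).
eexists _, _; split; first exact: p.
  by have [-> ->] := cutoff_end n0; rewrite !(mul0r, mulr0).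
move=> x xn /=; rewrite mulr0 addr0 -[derive1 V x]/(V' x).
have [c1 _] := cutoff_derive_le n2 xn.
have c01 := cutoff_itv n0 xn.
have hv : V' x <= delta * V x ^+ 2 + A by rewrite -[V x ^+ 2]real_normK ?num_real.
have := Vsq_pointwise (F x) (f x) e0 (ltW A0) c01 (c' := - (2 * x / n ^+ 2)).
rewrite sqrrN => /(_ _ _ _ c1 hv).
have -> : 1 - delta - 2 * e = 2 * e by rewrite eE; field.
move=> h.
have h' : (A + e^-1) * F x ^+ 2 + e^-1 * f x ^+ 2 <= (A + e^-1) * (F x ^+ 2 + f x ^+ 2).
  by rewrite mulrDr lerD2l ler_wpM2r ?sqr_ge0// lerDr ltW.
have {h h'} := le_trans h (lerD (lexx _) h').
rewrite -(ler_pM2r (w_gt0 x)) -(@ler_pM2l _ (2 * e)^-1) ?invr_gt0 ?mulr_gt0//.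
move=> h; apply: le_trans (le_trans _ h) _; rewrite le_eqVlt; apply/orP; left; apply/eqP.
  by field; rewrite gt_eqF.
by rewrite /C; field; rewrite !gt_eqF.
Qed.

(** The first line on the right together with - c^2 (v u)^2 is the derivative of c^2 V u^2 w,
    divided by w. Apart from the term with c', it rests on c^2 u'^2 = c^2 (u' - v u)^2 + c^2 (v' u^2
    + 2 v u u' - v^2 u^2) - c^2 v' u^2, where v' >= a. *)
Let derive_pointwise (a c c' v v' u u' : R) :
  0 <= c <= 1 -> c' ^+ 2 <= 1 -> a <= v' ->
  2^-1 * (c ^+ 2 * u' ^+ 2) <=
   2 * c * c' * v * u ^+ 2 + c ^+ 2 * v' * u ^+ 2 + 2 * c ^+ 2 * v * u * u'
   - c ^+ 2 * (v * u) ^+ 2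
   + (2 * (u' - v * u) ^+ 2 + (`|a| + 4) * u ^+ 2).
Proof.
move=> /andP[c0 c1] c'1 hv.
have c2 : c ^+ 2 <= 1 by rewrite exprn_ile1.
have e0 : (0 : R) < 4^-1 by rewrite invr_gt0.
have := young (c * v * u) (- (c' * u)) e0; rewrite invrK => y1.
have h1 : c ^+ 2 * u ^+ 2 * (- v') <= c ^+ 2 * u ^+ 2 * `|a|.
  have na : - a <= `|a| by rewrite -normrN ler_norm.
  apply: ler_wpM2l; first by rewrite mulr_ge0 ?sqr_ge0.
  by rewrite (le_trans _ na)// lerN2.
have h2 : `|a| * (c ^+ 2 * u ^+ 2) <= `|a| * u ^+ 2.
  by rewrite ler_wpM2l// ler_piMl ?sqr_ge0.
have h3 : 4 * (c' * u) ^+ 2 <= 4 * u ^+ 2.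
  by rewrite ler_wpM2l// exprMn ler_piMl ?sqr_ge0.
have h4 : c ^+ 2 * (u' - v * u) ^+ 2 <= (u' - v * u) ^+ 2.
  by rewrite ler_piMl ?sqr_ge0.
(* This square encodes (v u)^2 <= 2 u'^2 + 2 (u' - v u)^2. The quarter of (v u)^2 spent on the
   cutoff thus costs half of u'^2, which explains the 1/2 on the left. *)
have h5 : 0 <= c ^+ 2 * (2 * u' - v * u) ^+ 2 by rewrite mulr_ge0 ?sqr_ge0.
have h6 : 0 <= (u' - v * u) ^+ 2 by exact: sqr_ge0.
move: y1 h1 h2 h3 h4 h5 h6; rewrite !sqrrN !exprMn; lra.
Qed.

(* The derivative of [cutoff^2 V u^2 w] again, now used with the lower bound on V'. *)
Lemma derive_bound (a : R) : (forall x, a <= V' x) ->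
  exists2 C, 0 < C & forall u u', primitive u u' ->
  (\int[leb]_x (u' x ^+ 2 * w x)%:E <=
   C%:E * \int[leb]_x (((u' x - V x * u x) ^+ 2 + u x ^+ 2) * w x)%:E)%E.
Proof.
move=> hV'.
pose C := 2 * (`|a| + 4).
have C0 : 0 < C by rewrite mulr_gt0// ltr_wpDl.
exists (2 * C); first by rewrite mulr_gt0.
move=> u u' pu; have cu := primitive_continuous pu; have [lu _] := pu.
have mu := continuous_measurable_fun cu; have mu' := locint_measurable lu.
have m0 : measurable_fun setT (fun x => ((u' x - V x * u x) ^+ 2 + u x ^+ 2) * w x).
  apply: measurable_funM measurable_w; apply: measurable_funD.
    apply: measurable_funX; apply: measurable_funB => //.
    exact: measurable_funM measurable_V mu.
  exact: measurable_funX.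
have r0 x : 0 <= ((u' x - V x * u x) ^+ 2 + u x ^+ 2) * w x.
  by rewrite mulr_ge0 ?w_ge0// addr_ge0// sqr_ge0.
rewrite EFinM -muleA (ge0_integral_scale leb (ltW C0) m0 r0).
apply: (@cutoff_bound _ _ _ (fun _ => 0)) => //.
- exact: msq.
- exact: measurable_funM.
- by move=> x; rewrite mulr_ge0 ?w_ge0// sqr_ge0.
- by move=> x; rewrite mulr_ge0// ltW.
- by rewrite integral0.
move=> n n2; have n0 : 0 < n by rewrite (lt_le_trans _ n2).
have pc := primitive_cutoff n.
have p := primitiveZ 2 (primitiveM (primitiveM (primitiveM pc pc)
  (primitiveM primitive_potential_derive (primitiveM pu pu))) primitive_w).
eexists _, _; split; first exact: p.
  by have [-> ->] := cutoff_end n0; rewrite !(mul0r, mulr0).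
move=> x xn /=; rewrite mulr0 addr0 -[derive1 V x]/(V' x).
have [c1 _] := cutoff_derive_le n2 xn.
have c01 := cutoff_itv n0 xn.
have := derive_pointwise (V x) (u x) (u' x) c01 (c' := - (2 * x / n ^+ 2)).
rewrite sqrrN => /(_ _ _ c1 (hV' x)) h.
have h' : 2 * (u' x - V x * u x) ^+ 2 + (`|a| + 4) * u x ^+ 2 <=
   (`|a| + 4) * ((u' x - V x * u x) ^+ 2 + u x ^+ 2).
  rewrite mulrDr lerD2r ler_wpM2r ?sqr_ge0//.
  by rewrite (@le_trans _ _ 4)// ?ler_nat// lerDr.
have {h h'} := le_trans h (lerD (lexx _) h').
rewrite -(ler_pM2r (w_gt0 x)) -(@ler_pM2l _ 2)//.
move=> h; apply: le_trans (le_trans _ h) _; rewrite le_eqVlt; apply/orP; left; apply/eqP.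
  by field; rewrite ?gt_eqF.
by rewrite /C; ring.
Qed.

(** With p and q the two equations, s p + u q = g (s^2 + u^2) + lam u^2 - (u' s + u s' - v u s), and
    Young's inequality with weight g bounds the left side. The term with c' has only one factor c,
    too few to be absorbed by the c^2 on the left; it becomes the error of order 1 / n, which is why
    [dissipation_bound] asks for a finite integral of s^2 + u^2. *)
Let dissipation_pointwise (n g lam c c' v s s' u u' : R) : 0 < g -> 0 <= lam ->
  0 < n -> 0 <= c <= 1 -> `|c'| <= 2 / n ->
  g / 2 * (c ^+ 2 * (s ^+ 2 + u ^+ 2)) <=
   2 * c * c' * u * s + c ^+ 2 * (u' * s + u * s' - v * u * s)
   + ((2 * g)^-1 * ((g * s - u' + v * u) ^+ 2 + (g * u + lam * u - s') ^+ 2)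
      + n^-1 * (2 * (s ^+ 2 + u ^+ 2))).
Proof.
move=> g0 lam0 n0 /andP[c0 c1] c'n.
have c2 : c ^+ 2 <= 1 by rewrite exprn_ile1.
have gi : 0 < g^-1 by rewrite invr_gt0.
set p := g * s - u' + v * u; set q := g * u + lam * u - s'.
have y1 := young s p g0; have y2 := young u q g0.
have h1 : c ^+ 2 * (2 * s * p + 2 * u * q) <=
   c ^+ 2 * (g * (s ^+ 2 + u ^+ 2) + g^-1 * (p ^+ 2 + q ^+ 2)).
  by rewrite ler_wpM2l ?sqr_ge0//; lra.
have h2 : c ^+ 2 * (g^-1 * (p ^+ 2 + q ^+ 2)) <= g^-1 * (p ^+ 2 + q ^+ 2).
  by rewrite ler_piMl// mulr_ge0 ?addr_ge0 ?sqr_ge0// ltW.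
have h3 : 0 <= c ^+ 2 * (lam * u ^+ 2) by apply: mulr_ge0 (sqr_ge0 _) (mulr_ge0 lam0 (sqr_ge0 _)).
have h4 : - (2 * c * c' * u * s) <= n^-1 * (2 * (s ^+ 2 + u ^+ 2)).
  apply: (@le_trans _ _ `|2 * c * c' * u * s|); first by rewrite -normrN ler_norm.
  have -> : 2 * c * c' * u * s = c * c' * (2 * (u * s)) by ring.
  rewrite normrM normrM (ger0_norm c0).
  have hus : `|2 * (u * s)| <= s ^+ 2 + u ^+ 2.
    rewrite ler_norml; have := sqr_ge0 (s + u); have := sqr_ge0 (s - u).
    by rewrite !expr2; lra.
  have -> : n^-1 * (2 * (s ^+ 2 + u ^+ 2)) = 2 / n * (s ^+ 2 + u ^+ 2) by ring.
  apply: ler_pM => //; first exact: mulr_ge0.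
  by apply: le_trans c'n; rewrite ler_piMl.
have e : (2 * g)^-1 = g^-1 / 2 by field; rewrite gt_eqF.
rewrite e; move: h1 h2 h3 h4; rewrite /p /q.
have -> : 2 * s * (g * s - u' + v * u) + 2 * u * (g * u + lam * u - s') =
  2 * g * (s ^+ 2 + u ^+ 2) + 2 * (lam * u ^+ 2) - 2 * (u' * s + u * s' - v * u * s) by ring.
lra.
Qed.

(* With s = f^+ + f^- and u = f^+ - f^-, the equation (gamma - L) f = g reads
   gamma s - u' + U' u = g^+ + g^- and gamma u + (|U'| + 2 lambda_refr) u - s' = g^+ - g^-;
   [u s w] has derivative (u' s + u s' - U' u s) w, and integrates to zero. *)
Lemma dissipation_bound (gamma : R) (lam : R -> R) : 0 < gamma ->
  (forall x, 0 <= lam x) -> measurable_fun setT lam ->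
  exists2 C, 0 < C & forall s s' u u', primitive s s' -> primitive u u' ->
  (\int[leb]_x ((s x ^+ 2 + u x ^+ 2) * w x)%:E < +oo)%E ->
  (\int[leb]_x ((s x ^+ 2 + u x ^+ 2) * w x)%:E <= C%:E *
   \int[leb]_x (((gamma * s x - u' x + V x * u x) ^+ 2 +
     (gamma * u x + lam x * u x - s' x) ^+ 2) * w x)%:E)%E.
Proof.
move=> g0 lam0 mlam.
pose C := (gamma ^+ 2)^-1.
have C0 : 0 < C by rewrite invr_gt0 exprn_gt0.
exists (2 * C); first by rewrite mulr_gt0.
move=> s s' u u' ps pu fin.
have cu := primitive_continuous pu; have [lu _] := pu.
have mu := continuous_measurable_fun cu; have mu' := locint_measurable lu.
have cs := primitive_continuous ps; have [ls _] := ps.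
have ms := continuous_measurable_fun cs; have ms' := locint_measurable ls.
have m0 : measurable_fun setT (fun x => ((gamma * s x - u' x + V x * u x) ^+ 2 +
     (gamma * u x + lam x * u x - s' x) ^+ 2) * w x).
  apply: measurable_funM measurable_w; apply: measurable_funD; apply: measurable_funX.
    apply: measurable_funD.
      by apply: measurable_funB => //; exact: measurable_funM.
    exact: measurable_funM measurable_V mu.
  by apply: measurable_funB => //; apply: measurable_funD; exact: measurable_funM.
have r0 x : 0 <= ((gamma * s x - u' x + V x * u x) ^+ 2 +
     (gamma * u x + lam x * u x - s' x) ^+ 2) * w x.
  by rewrite mulr_ge0 ?w_ge0// addr_ge0// sqr_ge0.
have m1 : measurable_fun setT (fun x => (s x ^+ 2 + u x ^+ 2) * w x).
  by apply: measurable_funM measurable_w; apply: measurable_funD; exact: measurable_funX.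
have l0 x : 0 <= (s x ^+ 2 + u x ^+ 2) * w x.
  by rewrite mulr_ge0 ?w_ge0// addr_ge0// sqr_ge0.
have k0 : 0 < 4 / gamma by rewrite divr_gt0.
rewrite EFinM -muleA (ge0_integral_scale leb (ltW C0) m0 r0).
apply: (@cutoff_bound _ _ _ (fun x => 4 / gamma * ((s x ^+ 2 + u x ^+ 2) * w x))) => //.
- exact: measurable_funM.
- exact: measurable_funM.
- by move=> x; rewrite mulr_ge0// ltW.
- by move=> x; rewrite mulr_ge0// ltW.
- by rewrite -(ge0_integral_scale leb (ltW k0) m1 l0) lte_mul_pinfty// lee_fin ltW.
move=> n n2; have n0 : 0 < n by rewrite (lt_le_trans _ n2).
have pc := primitive_cutoff n.
have p := primitiveZ (2 / gamma) (primitiveM (primitiveM (primitiveM pc pc)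
  (primitiveM pu ps)) primitive_w).
eexists _, _; split; first exact: p.
  by have [-> ->] := cutoff_end n0; rewrite !(mul0r, mulr0).
move=> x xn /=.
have [_ c1] := cutoff_derive_le n2 xn.
have c01 := cutoff_itv n0 xn.
have c1' : `|- (2 * x / n ^+ 2)| <= 2 / n by rewrite normrN.
have := dissipation_pointwise (V x) (s x) (s' x) (u x) (u' x) g0 (lam0 x) n0 c01 c1'.
rewrite -(ler_pM2r (w_gt0 x)) -(@ler_pM2l _ (2 / gamma)) ?divr_gt0//.
move=> h; apply: le_trans (le_trans _ h) _; rewrite le_eqVlt; apply/orP; left; apply/eqP.
  by field; rewrite gt_eqF.
by rewrite /C; field; rewrite !gt_eqF.
Qed.

End weighted_inequalities.

(** * Square integrable functions *)

Section square_integrable.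
Context d (T : measurableType d) (R : realType).
Variable m : {measure set T -> \bar R}.
Implicit Types (f g h : T -> R).

(** Fatou's lemma in the form used for limits of norms: the limit exists almost everywhere only, and
    the bound holds from the index [N] on. *)
Lemma fatou_le (f_ : nat -> T -> R) f (C : \bar R) N :
  (forall n, measurable_fun setT (f_ n)) -> measurable_fun setT f ->
  (forall n x, 0 <= f_ n x) -> (forall x, 0 <= f x) ->
  {ae m, forall x, f_ n x @[n --> \oo] --> f x} ->
  (forall n, (N <= n)%N -> (\int[m]_x (f_ n x)%:E <= C)%E) ->
  (\int[m]_x (f x)%:E <= C)%E.
Proof.
move=> mf_ mf f_0 f0 f_f fC.
have mE n : measurable_fun setT (fun x => (f_ n x)%:E) by exact/measurable_EFinP.
apply: (@le_trans _ _ (\int[m]_x limn_einf (fun n => (f_ n x)%:E))%E).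
  apply: ae_ge0_le_integral => //.
  - by move=> x _; rewrite lee_fin.
  - exact/measurable_EFinP.
  - move=> x _; rewrite limn_einf_lim; apply: lime_ge; first exact: is_cvg_einfs.
    by apply: nearW => n; apply: le_ereal_inf_tmp => _ [k /= _ <-]; rewrite lee_fin.
  - rewrite /limn_einf; apply: measurableT_comp => //.
    by apply: measurable_fun_limn_esup => n; apply: measurableT_comp.
  - apply: ae_imp f_f => x fx _.
    have /cvg_limn_einf_sup[-> _] : (f_ n x)%:E @[n --> \oo] --> (f x)%:E.
      by apply: cvg_EFin => //; exact: nearW.
    by [].
apply: le_trans (fatou _ _ _ _) _ => //; first by move=> n x _; rewrite lee_fin.
rewrite limn_einf_lim; apply: lime_le; first exact: is_cvg_einfs.
(* The infimum over the indices from n on is at most its term at max(n, N), to which the bound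
   applies. *)
apply: nearW => n; apply: (@le_trans _ _ (\int[m]_x (f_ (maxn n N) x)%:E)%E).
  by apply: ereal_inf_lbound => /=; exists (maxn n N) => //=; rewrite leq_maxl.
by apply: fC; rewrite leq_maxr.
Qed.

Definition sq_integrable f :=
  measurable_fun setT f /\ (\int[m]_x (f x ^+ 2)%:E < +oo)%E.

Local Notation sq f := (\int[m]_x (f x ^+ 2)%:E)%E.

Definition dot f g : R := \int[m]_x (f x * g x).

Lemma sq_ge0 f : (0 <= sq f)%E.
Proof. by apply: integral_ge0 => x _; rewrite lee_fin sqr_ge0. Qed.

Lemma measurable_sq f : measurable_fun setT f ->
  measurable_fun setT (fun x => (f x ^+ 2)%:E).
Proof. by move=> mf; apply/measurable_EFinP; exact: measurable_funX. Qed.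

Lemma integral_sqD f g : measurable_fun setT f -> measurable_fun setT g ->
  (\int[m]_x (f x ^+ 2 + g x ^+ 2)%:E = sq f + sq g)%E.
Proof.
move=> mf mg; rewrite -ge0_integralD//.
- by move=> x _; rewrite lee_fin sqr_ge0.
- exact: measurable_sq.
- by move=> x _; rewrite lee_fin sqr_ge0.
- exact: measurable_sq.
Qed.

Lemma sq_integrableM f g : sq_integrable f -> sq_integrable g ->
  m.-integrable setT (EFin \o (fun x => f x * g x)).
Proof.
move=> [mf fi] [mg gi].
have fi' : m.-integrable setT (fun x => (f x ^+ 2)%:E).
  apply/integrableP; split; first exact: measurable_sq.
  by under eq_integral do rewrite /= ger0_norm ?sqr_ge0//.
have gi' : m.-integrable setT (fun x => (g x ^+ 2)%:E).
  apply/integrableP; split; first exact: measurable_sq.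
  by under eq_integral do rewrite /= ger0_norm ?sqr_ge0//.
apply: le_integrable (integrableD measurableT fi' gi') => //=.
  by apply/measurable_EFinP; exact: measurable_funM.
move=> x _; rewrite lee_fin [leRHS]ger0_norm ?addr_ge0 ?sqr_ge0// ler_norml.
have := sqr_ge0 (f x + g x); have := sqr_ge0 (f x - g x); rewrite !expr2; nra.
Qed.

Lemma dotE f : sq_integrable f -> sq f = (dot f f)%:E.
Proof.
move=> [mf fi]; rewrite /dot /Rintegral fineK; first by under eq_integral do rewrite expr2.
by under eq_integral do rewrite -expr2; rewrite ge0_fin_numE// sq_ge0.
Qed.

Lemma sq_integrableD f g a : sq_integrable f -> sq_integrable g ->
  sq_integrable (fun x => f x + a * g x).
Proof.
move=> fi gi; have [mf _] := fi; have [mg _] := gi.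
have mh : measurable_fun setT (fun x => f x + a * g x).
  by apply: measurable_funD => //; exact: measurable_funM.
split => //.
have h1 := sq_integrableM fi fi; have h2 := sq_integrableM gi gi.
have h : m.-integrable setT (fun x => (2%:E * (f x * f x)%:E + (2 * a ^+ 2)%:E * (g x * g x)%:E)%E).
  by apply: integrableD => //; exact: integrableZl.
apply: le_lt_trans (integrable_lty measurableT h).
apply: ge0_le_integral => //.
- by move=> x _; rewrite lee_fin sqr_ge0.
- exact: measurable_sq.
- exact: measurable_int h.
- move=> x _; rewrite -!EFinM -EFinD lee_fin.
  by have := sqr_ge0 (f x - a * g x); rewrite !expr2; lra.
Qed.

Lemma sq_integrable0 : sq_integrable (fun _ => 0).
Proof. by split => //; under eq_integral do rewrite expr0n; rewrite integral0. Qed.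

Lemma sq_integrableB f g : sq_integrable f -> sq_integrable g ->
  sq_integrable (fun x => f x - g x).
Proof.
move=> fi gi; have := sq_integrableD (-1) fi gi.
by congr sq_integrable; apply/funext => x; rewrite mulN1r.
Qed.

Lemma dotC f g : dot f g = dot g f.
Proof. by apply: eq_Rintegral => x _; rewrite mulrC. Qed.

Lemma dotDr f g h a : sq_integrable f -> sq_integrable g -> sq_integrable h ->
  dot f (fun x => g x + a * h x) = dot f g + a * dot f h.
Proof.
move=> fi gi hi; rewrite /dot -RintegralZl//; last exact: sq_integrableM.
rewrite -RintegralD//; first by apply: eq_Rintegral => x _; ring.
  exact: sq_integrableM.
apply: eq_integrable (integrableZl measurableT a (sq_integrableM fi hi)) => // x _.
Qed.

Lemma dotDl f g h a : sq_integrable f -> sq_integrable g -> sq_integrable h ->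
  dot (fun x => g x + a * h x) f = dot g f + a * dot h f.
Proof. by move=> fi gi hi; rewrite dotC dotDr// (dotC f g) (dotC f h). Qed.

Lemma dotZl f g a : sq_integrable f -> sq_integrable g ->
  dot (fun x => a * f x) g = a * dot f g.
Proof.
move=> fi gi; rewrite /dot -RintegralZl//; last exact: sq_integrableM.
by apply: eq_Rintegral => x _; rewrite mulrA.
Qed.

Lemma sq_integrableZ f a : sq_integrable f -> sq_integrable (fun x => a * f x).
Proof.
move=> fi; have := sq_integrableD a sq_integrable0 fi.
by congr sq_integrable; apply/funext => x; rewrite add0r.
Qed.

Lemma dot_comb f g a b : sq_integrable f -> sq_integrable g ->
  dot (fun x => a * f x + b * g x) (fun x => a * f x + b * g x) =
  a ^+ 2 * dot f f + 2 * a * b * dot f g + b ^+ 2 * dot g g.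
Proof.
move=> fi gi; have afi := sq_integrableZ a fi.
have hi := sq_integrableD b afi gi.
have E h : sq_integrable h -> dot (fun x => a * f x + b * g x) h = a * dot f h + b * dot g h.
  by move=> h_i; rewrite dotDl// dotZl.
rewrite (E _ hi) (dotC f) (dotC g) !E// (dotC g f); ring.
Qed.

Lemma dot_ge0 f : 0 <= dot f f.
Proof. by apply: Rintegral_ge0 => x _; rewrite -expr2 sqr_ge0. Qed.

(** Positivity of the square of f - (c / e) g with c = 1 or c = -1 according to the sign of the
    product. The free weight [e] lets it stand in for the Cauchy-Schwarz inequality without square
    roots. *)
Lemma dot_young f g (e : R) : 0 < e -> sq_integrable f -> sq_integrable g ->
  2 * `|dot f g| <= e * dot f f + e^-1 * dot g g.
Proof.
move=> e0 fi gi.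
have key c : c ^+ 2 = 1 -> 2 * (c * dot f g) <= e * dot f f + e^-1 * dot g g.
  move=> c2; have hi := sq_integrableD (- (c * e^-1)) fi gi.
  have := dot_ge0 (fun x => f x + - (c * e^-1) * g x).
  rewrite dotDr// !dotDl// (dotC g f) => h.
  have : 0 <= e * (dot f f + - (c / e) * dot f g + - (c / e) * (dot f g + - (c / e) * dot g g)).
    by rewrite mulr_ge0// ltW.
  have -> : e * (dot f f + - (c / e) * dot f g + - (c / e) * (dot f g + - (c / e) * dot g g))
    = e * dot f f - 2 * (c * dot f g) + c ^+ 2 * (e^-1 * dot g g).
    by field; rewrite gt_eqF.
  by rewrite c2; lra.
have [h|h] := leP 0 (dot f g).
  by rewrite ger0_norm// -[dot f g]mul1r; apply: key; rewrite expr1n.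
by rewrite ltr0_norm// -[- _]mulN1r; apply: key; rewrite sqrrN expr1n.
Qed.

Definition sq_cvg (u : nat -> T -> R) f := forall e : R, 0 < e ->
  exists N, forall n, (N <= n)%N -> (sq (fun x => u n x - f x)%R <= e%:E)%E.

Let weighted_sum_cvg (a : nat -> R) :
  (\sum_(0 <= n <oo) ((2 ^+ n) * a n ^+ 2)%:E < +oo)%E -> cvgn (series a).
Proof.
move=> fin; apply: normed_cvg.
have c1 : cvgn (series (fun n => 2 ^+ n * a n ^+ 2)).
  apply: nondecreasing_is_cvgn.
    by apply: nondecreasing_series => n _ _; rewrite mulr_ge0 ?sqr_ge0 ?exprn_ge0.
  have s0 : (0 <= \sum_(0 <= n <oo) ((2 ^+ n) * a n ^+ 2)%:E)%E.
    by apply: nneseries_ge0 => n _ _; rewrite lee_fin mulr_ge0 ?sqr_ge0 ?exprn_ge0.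
  exists (fine (\sum_(0 <= n <oo) ((2 ^+ n) * a n ^+ 2)%:E)%E).
  move=> _ [n _ <-]; rewrite -lee_fin fineK ?ge0_fin_numE// /series/= -sumEFin.
  by apply: nneseries_lim_ge => i _ _; rewrite lee_fin mulr_ge0 ?sqr_ge0 ?exprn_ge0.
have c2 : cvgn (series (geometric 1 (2^-1 : R))).
  by apply: is_cvg_geometric_series; rewrite ger0_norm ?invr_ge0// invf_lt1// ltr1n.
apply: series_le_cvg (is_cvg_seriesD c1 c2) => [n|n|n] /=.
- by [].
- by apply: addr_ge0; apply: mulr_ge0; rewrite ?sqr_ge0 ?exprn_ge0// ?invr_ge0.
- set p : R := 2 ^+ n.
  have p0 : 0 < p by rewrite exprn_gt0.
  rewrite [leRHS](_ : _ = p * a n ^+ 2 + p^-1); last first.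
    by rewrite /p -exprVn -[in RHS](mul1r (2^-1 ^+ n)).
  have [h0 h1] : 0 <= p * (`|a n| - p^-1) ^+ 2 /\ 0 < p^-1.
    by rewrite mulr_ge0 ?sqr_ge0 ?(ltW p0) ?invr_gt0.
  have : p * (`|a n| - p^-1) ^+ 2 = p * a n ^+ 2 - 2 * `|a n| + p^-1.
    rewrite -[a n ^+ 2]real_normK ?num_real//; field; by rewrite gt_eqF.
  by have := normr_ge0 (a n); lra.
Qed.

(* [2|t| <= 2^n t^2 + 2^-n] turns the bound into almost everywhere absolute
   convergence of the telescoping series. *)
Lemma sq_fast_cvg (v : nat -> T -> R) : (forall n, measurable_fun setT (v n)) ->
  (forall n, (sq (fun x => v n.+1 x - v n x)%R <= ((2 ^+ n)^-1 / 2 ^+ n.+1)%R%:E)%E) ->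
  exists2 f : T -> R, measurable_fun setT f &
    {ae m, forall x, v n x @[n --> \oo] --> f x}.
Proof.
move=> mv hv.
pose b n x : R := 2 ^+ n * (v n.+1 x - v n x) ^+ 2.
have b0 n x : 0 <= b n x by rewrite mulr_ge0 ?sqr_ge0 ?exprn_ge0.
have mb n : measurable_fun setT (fun x => (b n x)%:E).
  apply/measurable_EFinP; apply: measurable_funM => //; apply: measurable_funX.
  exact: measurable_funB.
have mS : measurable_fun setT (fun x => \sum_(0 <= n <oo) (b n x)%:E)%E.
  by apply: ge0_emeasurable_sum => // n x _ _; rewrite lee_fin.
have Si : m.-integrable setT (fun x => \sum_(0 <= n <oo) (b n x)%:E)%E.
  apply/integrableP; split => //.
  have hS x : (0 <= \sum_(0 <= n <oo) (b n x)%:E)%E.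
    by apply: nneseries_ge0 => n _ _; rewrite lee_fin.
  under eq_integral do rewrite (gee0_abs (hS _)).
  rewrite integral_nneseries//; last by move=> n x _; rewrite lee_fin.
  apply: (@le_lt_trans _ _ (\sum_(0 <= n <oo) (1 / (2 ^ n.+1)%:R)%:E)%E); last first.
    by rewrite (le_lt_trans (epsilon_trick0 _ (ler01)))// ltry.
  apply: lee_nneseries => [n _ _|n _].
    by apply: integral_ge0 => x _; rewrite lee_fin.
  (* The weight 2^n cancels the first factor of the hypothesis and leaves 2^-(n + 1), which is
     summable. *)
  rewrite /b -ge0_integral_scale ?exprn_ge0//; last 2 first.
  - by apply: measurable_funX; exact: measurable_funB.
  - by move=> x; rewrite sqr_ge0.
  apply: (@le_trans _ _ ((2 ^+ n)%R%:E * ((2 ^+ n)^-1 / 2 ^+ n.+1)%R%:E)%E).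
    by apply: lee_wpmul2l => //; rewrite lee_fin exprn_ge0.
  by rewrite -EFinM lee_fin mulrA divff ?expf_neq0// natrX.
(* The upper limit is measurable whether or not the sequence converges; its value on the exceptional
   null set does not matter. *)
pose F x := limn_esup (fun n => (v n x)%:E).
have mF : measurable_fun setT F.
  by apply: measurable_fun_limn_esup => n; exact/measurable_EFinP.
exists (fun x => fine (F x)).
  by apply: measurableT_comp mF; exact: fine_measurable.
apply: ae_imp (integrable_ae measurableT Si) => x /(_ Logic.I) fx.
have : cvgn (series (fun n => v n.+1 x - v n x)).
  apply: weighted_sum_cvg; move: fx; rewrite ge0_fin_numE//.
  by apply: nneseries_ge0 => n _ _; rewrite lee_fin.
move=> /cvg_ex[/= l hl].
have hv0 : v n x @[n --> \oo] --> l + v 0%N x.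
  have -> : v^~ x = (fun n => series (fun n => v n.+1 x - v n x) n + v 0%N x).
    apply/funext => n; rewrite /series/= telescope_sumr//; ring.
  by apply: cvgD => //; exact: cvg_cst.
have /cvg_limn_einf_sup[_ FE] : (v n x)%:E @[n --> \oo] --> (l + v 0%N x)%:E.
  by apply: cvg_EFin => //; exact: nearW.
by rewrite /F FE.
Qed.

(** Riesz-Fischer: a subsequence with geometrically small increments converges almost everywhere,
    and Fatou's lemma in the second index of the Cauchy condition yields convergence of the whole
    sequence. *)
Lemma sq_complete (u : nat -> T -> R) : (forall n, sq_integrable (u n)) ->
  (forall e : R, 0 < e -> exists N, forall p q, (N <= p)%N -> (N <= q)%N ->
     (sq (fun x => u p x - u q x)%R <= e%:E)%E) ->
  exists2 f, sq_integrable f & sq_cvg u f.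
Proof.
move=> ui uc.
pose e n : R := (2 ^+ n)^-1 / 2 ^+ n.+1.
have e0 n : 0 < e n by rewrite divr_gt0 ?invr_gt0 ?exprn_gt0.
have [N HN] := choice (fun n => uc (e n) (e0 n)).
(* Taking the maximum and a successor keeps k n above [N n] and makes [k] strictly increasing. *)
pose k := fix k n := if n is n'.+1 then (maxn (N n) (k n')).+1 else N 0%N.
have kN n : (N n <= k n)%N by case: n => //= n; rewrite leqW// leq_maxl.
have kS n : (k n < k n.+1)%N by rewrite /= ltnS leq_maxr.
have kn n : (n <= k n)%N.
  by elim: n => // n IH; rewrite (leq_ltn_trans IH)// kS.
have mu n : measurable_fun setT (u n) by case: (ui n).
have [|f mf f_f] := @sq_fast_cvg (fun n => u (k n)) (fun n => mu (k n)).
  move=> n; apply: HN; last exact: kN.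
  by rewrite (leq_trans (kN n))// ltnW.
have cv : sq_cvg u f.
  move=> r r0; have [M HM] := uc r r0; exists M => n Mn.
  apply: (@fatou_le (fun j x => (u n x - u (k j) x) ^+ 2) _ _ M).
  - by move=> j; apply: measurable_funX; exact: measurable_funB.
  - by apply: measurable_funX; exact: measurable_funB.
  - by move=> j x; exact: sqr_ge0.
  - by move=> x; exact: sqr_ge0.
  - apply: ae_imp f_f => x fx.
    rewrite expr2; under eq_fun do rewrite expr2.
    by apply: cvgM; apply: cvgB => //; exact: cvg_cst.
  - by move=> j Mj; apply: HM => //; rewrite (leq_trans Mj).
exists f => //.
have [M HM] := cv 1 ltr01.
have hi : sq_integrable (fun x => u M x - f x).
  split; first exact: measurable_funB.
  by rewrite (le_lt_trans (HM M (leqnn M)))// ltry.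
have := sq_integrableB (ui M) hi.
by congr sq_integrable; apply/funext => x; ring.
Qed.

Lemma sq_cvg_dot u f g : (forall n, sq_integrable (u n)) -> sq_integrable f ->
  sq_integrable g -> sq_cvg u f -> dot (u n) g @[n --> \oo] --> dot f g.
Proof.
move=> ui fi gi uf; apply/cvgrPdist_le => e e0.
pose G := dot g g + 1.
have G0 : 0 < G by rewrite ltr_wpDl// dot_ge0.
(* With weight G / e in [dot_young], a squared distance of e^2 / G makes each of the two terms at
   most e. The 1 added in [G] keeps it positive. *)
have [|N HN] := uf (e ^+ 2 / G); first by rewrite divr_gt0// exprn_gt0.
exists N => // n /= Nn.
have di := sq_integrableB (ui n) fi.
have := HN n Nn; rewrite dotE// lee_fin => hn.
have -> : dot f g - dot (u n) g = - dot (fun x => u n x - f x) g.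
  have -> : (fun x => u n x - f x) = (fun x => u n x + -1 * f x).
    by apply/funext => x; rewrite mulN1r.
  by rewrite dotDl//; ring.
rewrite normrN.
have Ge0 : 0 < G / e by rewrite divr_gt0.
have h := dot_young Ge0 di gi.
have h1 : G / e * dot (fun x => u n x - f x) (fun x => u n x - f x) <= e.
  rewrite (_ : e = G / e * (e ^+ 2 / G)); last by field; rewrite !gt_eqF.
  by rewrite (_ : G / (G / e * (e ^+ 2 / G)) = G / e)// ?ler_wpM2l// ?(ltW Ge0)//; field; rewrite !gt_eqF.
have h2 : (G / e)^-1 * dot g g <= e.
  rewrite invf_div mulrAC ler_pdivrMr// ler_wpM2l ?(ltW e0)// /G lerDl//.
by lra.
Qed.

(** [W] need not be closed, so the projection on its closure comes with a sequence of [W] that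
    converges to it; relations that are continuous for the scalar product can then be carried over
    from [W] to [z]. *)
Lemma orthogonal_projection (W : set (T -> R)) g :
  W !=set0 -> (forall f, W f -> sq_integrable f) ->
  (forall f h a, W f -> W h -> W (fun x => f x + a * h x)) ->
  sq_integrable g ->
  exists z w_, [/\ sq_integrable z, forall n : nat, W (w_ n), sq_cvg w_ z &
    forall v, W v -> dot (fun x => g x - z x) v = 0].
Proof.
move=> [f0 Wf0] Wi WD gi.
pose J w := dot (fun x => g x - w x) (fun x => g x - w x).
pose S := [set J w | w in W].
have S0 : has_inf S.
  split; first by exists (J f0), f0.
  by exists 0 => _ [w _ <-]; exact: dot_ge0.
pose dd := inf S.
have ddJ w : W w -> dd <= J w by move=> Ww; apply: ge_inf; [case: S0|exists w].
have ex n : exists w, W w /\ J w < dd + n.+1%:R^-1.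
  have [_ [w Ww <-] h] := @inf_adherent _ S n.+1%:R^-1 ltac:(by rewrite invr_gt0) S0.
  by exists w.
have [w hw] := choice ex.
have Ww n : W (w n) by case: (hw n).
have wi n : sq_integrable (w n) by exact: Wi.
(* Parallelogram identity. The midpoint is written w_p + (w_q - w_p) / 2 so that the stability of
   [W] applies to it; its value of [J] is at least the infimum, which makes a minimizing sequence
   Cauchy. *)
have JE p q : dot (fun x => w p x - w q x) (fun x => w p x - w q x) =
    2 * J (w p) + 2 * J (w q) - 4 * J (fun x => w p x + 2^-1 * (w q x + -1 * w p x)).
  pose P x := g x - w p x; pose Q x := g x - w q x.
  have Pi : sq_integrable P by exact: sq_integrableB.
  have Qi : sq_integrable Q by exact: sq_integrableB.
  have -> : (fun x => w p x - w q x) = (fun x => -1 * P x + 1 * Q x).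
    by apply/funext => x; rewrite /P /Q; ring.
  rewrite {3}/J.
  have -> : (fun x => g x - (w p x + 2^-1 * (w q x + -1 * w p x))) =
            (fun x => 2^-1 * P x + 2^-1 * Q x).
    by apply/funext => x; rewrite /P /Q; field.
  by rewrite !dot_comb// /J -/P -/Q; field.
have aux (a b c D x y : R) : a < D + x -> b < D + y -> D <= c ->
    2 * a + 2 * b - 4 * c <= 2 * x + 2 * y by lra.
have cau p q : dot (fun x => w p x - w q x) (fun x => w p x - w q x) <=
    2 * p.+1%:R^-1 + 2 * q.+1%:R^-1.
  rewrite JE; have [_ hp] := hw p; have [_ hq] := hw q.
  have := ddJ (fun x => w p x + 2^-1 * (w q x + -1 * w p x)) _.
  move=> /(_ (WD _ _ _ (Ww p) (WD _ _ _ (Ww q) (Ww p)))).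
  exact: aux hp hq.
have small (e : R) : 0 < e -> exists N : nat, forall n, (N <= n)%N -> n.+1%:R^-1 <= e.
  move=> e0; exists (Num.truncn e^-1) => n Nn.
  rewrite invf_ple ?posrE//; apply/ltW/(lt_le_trans (truncnS_gt _)).
  by rewrite ler_nat.
have [|z zi wz] := @sq_complete w wi.
  move=> e e0; have [|N HN] := small (e / 4); first by rewrite divr_gt0.
  exists N => p q Np Nq; rewrite dotE; last exact: sq_integrableB.
  rewrite lee_fin (le_trans (cau p q))//.
  have aux2 (x y : R) : x <= e / 4 -> y <= e / 4 -> 2 * x + 2 * y <= e by lra.
  exact: aux2 (HN p Np) (HN q Nq).
exists z, w; split => // v Wv.
have vi := Wi _ Wv.
have gzi := sq_integrableB gi zi.
pose I := dot (fun x => g x - z x) v; pose VV := dot v v.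
have VV0 : 0 <= VV by exact: dot_ge0.
have lim1 : dot (fun x => g x - w n x) v @[n --> \oo] --> I.
  have E f : sq_integrable f -> dot (fun x => g x - f x) v = dot g v - dot f v.
    move=> fi; have -> : (fun x => g x - f x) = (fun x => g x + -1 * f x).
      by apply/funext => x; rewrite mulN1r.
    by rewrite dotDl//; ring.
  rewrite /I E//; under eq_fun do rewrite E//.
  by apply: cvgB; [exact: cvg_cst|exact: sq_cvg_dot].
(* Near-minimality of w_n against the competitor w_n + t v gives this up to 1 / (n + 1), and the
   product of g - w_n with v tends to [I]. *)
have key t : 2 * t * I <= t ^+ 2 * VV.
  apply/ler_addgt0Pr => e e0.
  have [|N1 HN1] := small (e / 2); first by rewrite divr_gt0.
  have d0 : 0 < e / (4 * (`|t| + 1)) by rewrite divr_gt0// mulr_gt0// ltr_wpDl.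
  have /cvgrPdist_le/(_ _ d0)[N2 _ HN2] := lim1.
  pose n := maxn N1 N2.
  have h1 := HN1 n (leq_maxl _ _); have /= h2 := HN2 n (leq_maxr _ _).
  have [_ hn] := hw n.
  have := ddJ _ (WD _ _ t (Ww n) Wv).
  rewrite /J.
  pose P x := g x - w n x.
  have Pi : sq_integrable P by exact: sq_integrableB.
  have -> : (fun x => g x - (w n x + t * v x)) = (fun x => P x + (- t) * v x).
    by apply/funext => x; rewrite /P; ring.
  rewrite (dotDr _ (sq_integrableD _ Pi vi) Pi vi) !dotDl// (dotC v P) -/VV.
  move: hn h2; rewrite /J -/P => hn h2 h3.
  have h4 : 2 * t * (I - dot P v) <= e / 2.
    apply: (le_trans (ler_norm _)); rewrite normrM normrM (ger0_norm (ler0n _ 2)).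
    apply: (@le_trans _ _ (2 * `|t| * (e / (4 * (`|t| + 1))))).
      by rewrite ler_wpM2l// mulr_ge0.
    have tp : 0 < `|t| + 1 by rewrite ltr_wpDl.
    rewrite (_ : _ * _ = `|t| / (`|t| + 1) * (e / 2)); last by field; rewrite gt_eqF.
    by rewrite ler_piMl ?divr_ge0 ?(ltW e0)// ler_pdivrMr// mul1r lerDl.
  move: (n.+1%:R^-1) hn h1 h3 h4 => y.
  by rewrite -/(J _); move: (dot P v) (dot P P) (J _) => *; lra.
have hI : 0 <= I ^+ 2 <= 0.
  rewrite sqr_ge0/=.
  have V1 : 0 < VV + 1 by rewrite ltr_wpDl.
  (* At this t both sides carry the factor I^2 / (VV + 1)^2, next to 2 (VV + 1) on the left and VV
     on the right, so the factor must be zero. The 1 covers the case VV = 0. *)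
  have := key (I / (VV + 1)).
  have -> : 2 * (I / (VV + 1)) * I = (I ^+ 2 / (VV + 1) ^+ 2) * (2 * (VV + 1)).
    by field; rewrite gt_eqF.
  have -> : (I / (VV + 1)) ^+ 2 * VV = (I ^+ 2 / (VV + 1) ^+ 2) * VV.
    by field; rewrite gt_eqF.
  have q0 : 0 < ((VV + 1) ^+ 2)^-1 by rewrite invr_gt0 exprn_gt0.
  move=> h; rewrite leNgt; apply/negP => I0.
  have c0 : 0 < I ^+ 2 / (VV + 1) ^+ 2 by rewrite mulr_gt0.
  by move: h; rewrite ler_pM2l//; lra.
by move: hI; rewrite -eq_le eq_sym sqrf_eq0 => /eqP.
Qed.

End square_integrable.

(** * Weighted compactness *)

Section compactness.
Context {R : realType}.
Local Notation leb := (@lebesgue_measure R).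

(** Ascoli's theorem gives a cluster point for uniform convergence on compact sets; a diagonal
    choice over the intervals [-j, j] turns it into a subsequence. *)
Lemma ascoli_subsequence (F : nat -> R -> R) :
  (forall x, exists B, forall n, `|F n x| <= B) ->
  (forall x (e : R), 0 < e -> exists2 d : R, 0 < d &
     forall y n, `|x - y| < d -> `|F n x - F n y| < e) ->
  exists (k : nat -> nat) (G : R -> R), (forall n, (k n < k n.+1)%N) /\
    forall r e : R, 0 < e -> exists N : nat, forall n x, (N <= n)%N ->
      - r <= x <= r -> `|F (k n) x - G x| <= e.
Proof.
move=> bF eF.
pose W : set {family compact, R -> R} := range F.
have pW : precompact W.
  apply: (@pointwise_precompact_equicontinuous R R (@Rhausdorff R)).
    move=> x; have [B hB] := bF x.
    apply: (@precompact_subset _ _ `[- B, B]%classic).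
      by move=> _ [_ [n _ <-] <-] /=; rewrite in_itv/= -ler_norml.
    by rewrite precompact_closed; [exact: segment_compact|exact: itv_closed].
  move=> x E; rewrite -entourage_ballE => -[e /= e0 hE]; have [d d0 hd] := eF x e e0.
  exists d => //= y xy _ [n _ <-]; apply: hE; exact: hd.
rewrite precompactE in pW.
pose FF : set_system {family compact, R -> R} := fmap F \oo.
have FFcl : FF (closure W).
  by exists 0%N => // n _; apply: subset_closure; exists n.
have PFF : ProperFilter FF by exact: fmap_proper_filter.
have [G [_ clG]] := pW FF PFF FFcl.
(* As [G] is a cluster point, beyond any index nj.1 some term is within 1 / (j + 1) of it on
   [-j, j], where j = nj.2. *)
have step (nj : nat * nat) : exists n : nat, (nj.1 <= n)%N /\
    forall x, - (nj.2%:R) <= x <= nj.2%:R -> `|G x - F n x| < nj.2.+1%:R^-1.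
  case: nj => n0 j /=.
  have entE : entourage [set xy : R * R | ball xy.1 (j.+1%:R^-1 : R) xy.2].
    by rewrite -entourage_ballE; exists (j.+1%:R^-1) => //=; rewrite invr_gt0.
  have cK : compact `[- (j%:R : R), j%:R]%classic by exact: segment_compact.
  have nG := @fam_nbhs R R compact `[- (j%:R : R), j%:R]%classic _ G entE cK.
  have Fn : FF (F @` [set n | (n0 <= n)%N]) by exists n0 => // n /= n0n; exists n.
  have [_ [[n /= n0n <-] hn]] := clG _ _ Fn nG.
  exists n; split; first exact: n0n.
  by move=> x xj; apply: (hn x); rewrite /= in_itv.
have [s hs] := choice step.
pose k := fix k n := if n is n'.+1 then s ((k n').+1, n) else s (0%N, 0%N).
have kS n : (k n < k n.+1)%N by rewrite /=; have [] := hs ((k n).+1, n.+1).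
have kn n x : - (n%:R) <= x <= n%:R -> `|G x - F (k n) x| < n.+1%:R^-1.
  by case: n => [|n]; [have [_] := hs (0%N, 0%N)|have [_] := hs ((k n).+1, n.+1)]; exact.
exists k, G; split => // r e e0.
exists (maxn (Num.truncn `|r|).+1 (Num.truncn e^-1)) => n x.
rewrite geq_max => /andP[rn en] /andP[xr1 xr2].
have rn' : r <= n%:R.
  rewrite (le_trans (ler_norm _))// (le_trans (ltW (truncnS_gt _)))// ler_nat//.
rewrite distrC ltW// (lt_le_trans (kn n x _))//.
  by rewrite (le_trans xr2 rn') (le_trans _ xr1)// lerN2.
rewrite invf_ple ?posrE//; apply/ltW/(lt_le_trans (truncnS_gt _)).
by rewrite ler_nat.
Qed.

(** Integrate |f| <= t + f^2 / t. A large [t] makes K / t small, after which a small b - a makes the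
    other term small: this is the equicontinuity needed for Ascoli's theorem. *)
Lemma primitive_osc (F f : R -> R) (K a b t : R) : primitive F f -> a <= b -> 0 < t ->
  (\int[leb]_(x in `[a, b]) (F x ^+ 2 + f x ^+ 2)%:E <= K%:E)%E ->
  `|F b - F a| <= t * (b - a) + K / t.
Proof.
move=> [lf Ff] ab t0 hK; rewrite Ff//.
have mf := locint_measurable lf.
have mF : measurable_fun setT F.
  by apply: continuous_measurable_fun; exact: (primitive_continuous (conj lf Ff)).
have fi := locint_itv a b lf.
have mh : measurable_fun setT (fun x => F x ^+ 2 + f x ^+ 2).
  by apply: measurable_funD; exact: measurable_funX.
rewrite -lee_fin EFin_normr_Rintegral//.
apply: (le_trans (le_abse_integral _ _ _)) => //; first exact: measurable_int fi.
have t10 : 0 <= t^-1 by rewrite invr_ge0 ltW.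
have mE (g : R -> R) D : measurable_fun setT g -> measurable_fun D (fun x => (g x)%:E).
  by move=> mg; apply/measurable_EFinP; exact: measurable_funS mg.
apply: (@le_trans _ _ (\int[leb]_(x in `[a, b])
    (t%:E + t^-1%:E * (F x ^+ 2 + f x ^+ 2)%:E))%E).
  apply: ge0_le_integral => //.
  - by apply: mE; exact: measurableT_comp.
  by apply: emeasurable_funD => //; apply: measurable_funeM; exact: mE.
  - move=> x _; rewrite -EFinM -EFinD lee_fin.
    have h : 0 <= t^-1 * (`|f x| - t) ^+ 2 by rewrite mulr_ge0// sqr_ge0.
    have : t^-1 * (`|f x| - t) ^+ 2 = t^-1 * f x ^+ 2 - 2 * `|f x| + t.
      rewrite -[f x ^+ 2]real_normK ?num_real//; field; by rewrite gt_eqF.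
    have : 0 <= t^-1 * F x ^+ 2 by rewrite mulr_ge0// sqr_ge0.
    have : 0 <= t^-1 * f x ^+ 2 by rewrite mulr_ge0// sqr_ge0.
    by rewrite mulrDr; lra.
rewrite ge0_integralD//; first last.
- by apply: measurable_funeM; exact: mE.
- by move=> x _; rewrite -EFinM lee_fin mulr_ge0// addr_ge0// sqr_ge0.
- by move=> x _; rewrite lee_fin ltW.
rewrite integral_cst//= lebesgue_measure_itv/= lte_fin.
rewrite ge0_integralZl//; first last.
- by move=> x _; rewrite lee_fin addr_ge0// sqr_ge0.
- exact: mE.
rewrite EFinD leeD//.
  case: ltP => _; first by rewrite -EFinB -EFinM.
  by rewrite mule0 lee_fin mulr_ge0 ?subr_ge0// ltW.
by rewrite mulrC EFinM lee_wpmul2l.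
Qed.

(** For y in [x, x + 1] the oscillation bound with t = 1 gives |F y - F x| <= 1 + K, so F(x)^2 <= 2
    F(y)^2 + 2 (1 + K)^2; averaging over y in this interval of length one bounds F(x). *)
Lemma primitive_pointwise_bound (F f : R -> R) (K x : R) : primitive F f ->
  (\int[leb]_(y in `[x, (x + 1)%R]) (F y ^+ 2 + f y ^+ 2)%:E <= K%:E)%E ->
  `|F x| ^+ 2 <= 2 * K + 2 * (1 + K) ^+ 2.
Proof.
move=> pF hK; have [lf _] := pF.
have mf := locint_measurable lf.
have mF : measurable_fun setT F.
  by apply: continuous_measurable_fun; exact: (primitive_continuous pF).
have mE (g : R -> R) D : measurable_fun setT g -> measurable_fun D (fun x => (g x)%:E).
  by move=> mg; apply/measurable_EFinP; exact: measurable_funS mg.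
have mh : measurable_fun setT (fun x => F x ^+ 2 + f x ^+ 2).
  by apply: measurable_funD; exact: measurable_funX.
have h0 y : 0 <= F y ^+ 2 + f y ^+ 2 by rewrite addr_ge0// sqr_ge0.
have K0 : 0 <= K.
  by rewrite -lee_fin (le_trans _ hK)// integral_ge0// => y _; rewrite lee_fin.
have hxy y : x <= y <= x + 1 -> `|F x| ^+ 2 <= 2 * (F y ^+ 2 + f y ^+ 2) + 2 * (1 + K) ^+ 2.
  move=> /andP[xy yx].
  have hd : `|F y - F x| <= 1 + K.
    have := @primitive_osc F f K x y 1 pF xy ltr01; rewrite divr1 mul1r => h.
    apply: (le_trans (h _)); last by rewrite lerD2r lerBlDl.
    apply: le_trans hK; apply: ge0_subset_integral => //; first exact: mE.
      by move=> z _; rewrite lee_fin.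
    by move=> z /=; rewrite !in_itv/= => /andP[-> zy]; rewrite (le_trans zy).
  have h2 : (F y - F x) ^+ 2 <= (1 + K) ^+ 2.
    by rewrite -real_normK ?num_real// lerXn2r// nnegrE addr_ge0.
  rewrite real_normK ?num_real//.
  have := sqr_ge0 (F x - 2 * F y); have := sqr_ge0 (f y).
  by move: h2; rewrite !expr2; lra.
have x1 : x < x + 1 by rewrite ltrDl.
have mu1 (c : R) : (\int[leb]_(y in `[x, (x + 1)%R]) c%:E = c%:E)%E.
  rewrite integral_cst//= lebesgue_measure_itv/= lte_fin x1 -EFinB -EFinM.
  by congr EFin; ring.
rewrite -lee_fin -[leLHS]mu1.
apply: (@le_trans _ _ (\int[leb]_(y in `[x, (x + 1)%R])
   (2%:E * (F y ^+ 2 + f y ^+ 2)%:E + (2 * (1 + K) ^+ 2)%:E))%E).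
  apply: ge0_le_integral => //.
  by apply: emeasurable_funD => //; apply: measurable_funeM; exact: mE.
rewrite ge0_integralD//; first last.
- by move=> y _; rewrite lee_fin mulr_ge0// sqr_ge0.
- by apply: measurable_funeM; exact: mE.
- by move=> y _; rewrite -EFinM lee_fin mulr_ge0.
rewrite mu1 ge0_integralZl//; first last.
- by move=> y _; rewrite lee_fin.
- exact: mE.
by rewrite [leRHS]EFinD leeD2r// [leRHS]EFinM lee_wpmul2l.
Qed.

End compactness.

(** * Compactness with a weight on the whole line *)

Section weighted_compactness.
Context {R : realType}.
Local Notation leb := (@lebesgue_measure R).
Local Notation box n := ([set` Interval (BLeft (- n)%R) (BRight n%R)]).
Variable U : R -> R.
Hypothesis hU : C2 U.
Local Notation V := (derive1 U).
Local Notation w := (fun x => expR (- U x)).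

Lemma weight_lower_bound (r : R) : exists2 c : R, 0 < c &
  forall x, - r <= x <= r -> c <= w x.
Proof.
have cK : compact `[- r, r]%classic by exact: segment_compact.
have cU : {within `[- r, r]%classic, continuous U}.
  by apply: continuous_subspaceT; exact: C2_continuous.
have /compact_bounded[M [_ hM]] := continuous_compact cU cK.
exists (expR (- (`|M| + 1))); first exact: expR_gt0.
move=> x xr; rewrite ler_expR lerN2 (le_trans (ler_norm _))//.
apply: (hM (`|M| + 1)); last by exists x => //=; rewrite in_itv.
by rewrite (le_lt_trans (ler_norm M))// ltrDl.
Qed.

Lemma weighted_local_bound (h : R -> R) (M : R) (r : R) :
  measurable_fun setT h -> (forall x, 0 <= h x) ->
  (\int[leb]_x (h x * w x)%:E <= M%:E)%E ->
  forall c : R, 0 < c -> (forall x, - r <= x <= r -> c <= w x) ->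
  forall a b : R, - r <= a -> b <= r ->
  (\int[leb]_(x in `[a, b]) (h x)%:E <= (c^-1 * M)%:E)%E.
Proof.
move=> mh h0 hM c c0 hc a b ra br.
have ci : 0 <= c^-1 by rewrite invr_ge0 ltW.
have mw : measurable_fun setT w by exact: measurable_w.
have mhw : measurable_fun setT (fun x => c^-1 * (h x * w x)).
  by apply: measurable_funM => //; exact: measurable_funM.
have mhw0 : measurable_fun setT (fun x => h x * w x) by exact: measurable_funM.
have hw0 x : 0 <= h x * w x by rewrite mulr_ge0 ?expR_ge0.
apply: (@le_trans _ _ (\int[leb]_x (c^-1 * (h x * w x))%:E)%E); last first.
  by rewrite -(ge0_integral_scale leb ci mhw0 hw0) EFinM lee_wpmul2l.
apply: (@le_trans _ _ (\int[leb]_(x in `[a, b]) (c^-1 * (h x * w x))%:E)%E).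
  apply: ge0_le_integral => //.
  - by move=> x _; rewrite lee_fin.
  - by apply/measurable_EFinP; exact: measurable_funS mh.
  - by apply/measurable_EFinP; exact: measurable_funS mhw.
  - move=> x; rewrite /= in_itv/= => /andP[ax xb]; rewrite lee_fin ler_pdivlMl//.
    by rewrite mulrC ler_wpM2l// hc// (le_trans ra ax) (le_trans xb br).
apply: ge0_subset_integral => //.
- exact/measurable_EFinP.
- by move=> x _; rewrite lee_fin mulr_ge0.
Qed.

Lemma cvg_weighted_sq (F_ : nat -> R -> R) G x :
  F_ n x @[n --> \oo] --> G x ->
  forall c : R, (c * F_ n x) ^+ 2 * w x @[n --> \oo] --> (c * G x) ^+ 2 * w x.
Proof.
move=> h c; apply: cvgM; last exact: cvg_cst.
by rewrite expr2; under eq_fun do rewrite expr2; apply: cvgM; apply: cvgM => //; exact: cvg_cst.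
Qed.

(* Local uniform convergence by Ascoli; the tails are uniformly small because
   |V| is large there and [int (V F)^2 w] is bounded. *)
Lemma weighted_rellich (C M : R) (F_ f_ : nat -> R -> R) :
  leb.-integrable setT (fun x => (w x)%:E) -> 0 < C ->
  (forall F f, primitive F f ->
    (\int[leb]_x ((V x * F x) ^+ 2 * w x)%:E <=
      C%:E * \int[leb]_x ((F x ^+ 2 + f x ^+ 2) * w x)%:E)%E) ->
  (forall L : R, exists r, forall x, ~ (- r <= x <= r) -> L <= `|V x|) ->
  (forall n, primitive (F_ n) (f_ n)) ->
  (forall n, (\int[leb]_x ((F_ n x ^+ 2 + f_ n x ^+ 2) * w x)%:E <= M%:E)%E) ->
  exists (k : nat -> nat) (G : R -> R),
    [/\ forall n, (k n < k n.+1)%N, measurable_fun setT G,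
      (\int[leb]_x (G x ^+ 2 * w x)%:E <= M%:E)%E &
      forall e : R, 0 < e -> exists N, forall n, (N <= n)%N ->
        (\int[leb]_x ((F_ (k n) x - G x) ^+ 2 * w x)%:E <= e%:E)%E].
Proof.
move=> wi C0 hC tail pF hM.
have cF n : continuous (F_ n) by exact: primitive_continuous (pF n).
have mF n : measurable_fun setT (F_ n) by exact: continuous_measurable_fun.
have mf n : measurable_fun setT (f_ n) by have [/locint_measurable] := pF n.
have mw : measurable_fun setT w by exact: measurable_w.
have mV : measurable_fun setT V by exact: measurable_V.
have w0 x : 0 <= w x by exact: expR_ge0.
have sqw (g : R -> R) : measurable_fun setT g -> measurable_fun setT (fun x => g x ^+ 2 * w x).
  by move=> mg; exact: measurable_funM (measurable_funX 2 mg) mw.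
have mcM (c : R) (g : R -> R) : measurable_fun setT g -> measurable_fun setT (fun x => c * g x).
  by move=> mg; exact: measurable_funM.
pose h n x := F_ n x ^+ 2 + f_ n x ^+ 2.
have h0 n x : 0 <= h n x by rewrite addr_ge0// sqr_ge0.
have mh n : measurable_fun setT (h n) by apply: measurable_funD; exact: measurable_funX.
have loc r : exists2 K : R, 0 <= K & forall n a b, - r <= a -> b <= r ->
    (\int[leb]_(x in `[a, b]) (h n x)%:E <= K%:E)%E.
  have [c c0 hc] := weight_lower_bound r.
  exists `|c^-1 * M| => // n a b ra br.
  apply: le_trans (weighted_local_bound (mh n) (h0 n) (hM n) c0 hc ra br) _.
  by rewrite lee_fin ler_norm.
have bF x : exists B, forall n, `|F_ n x| <= B.
  have [K K0 hK] := loc (`|x| + 1).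
  pose B := 2 * K + 2 * (1 + K) ^+ 2.
  have B0 : 0 <= B by rewrite addr_ge0// mulr_ge0// sqr_ge0.
  exists (B + 1) => n.
  have : `|F_ n x| ^+ 2 <= B.
    apply: (primitive_pointwise_bound (pF n)); apply: hK; last first.
      by rewrite lerD2r ler_norm.
    by rewrite lerNl (le_trans (ler_norm _))// normrN lerDl.
  by have := normr_ge0 (F_ n x); nra.
have eF x (e : R) : 0 < e -> exists2 d : R, 0 < d &
     forall y n, `|x - y| < d -> `|F_ n x - F_ n y| < e.
  move=> e0; have [K K0 hK] := loc (`|x| + 1).
  (* In [primitive_osc] this makes K / t at most e / 4, and points closer than e / (4 t) keep the
     other term below e / 4. *)
  pose t := 4 * (K + 1) / e.
  have K1 : 0 < K + 1 by rewrite ltr_wpDl.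
  have t0 : 0 < t by rewrite divr_gt0// mulr_gt0.
  exists (Num.min 1 (e / (4 * t))).
    by rewrite lt_min ltr01 divr_gt0// mulr_gt0.
  move=> y n; rewrite lt_min => /andP[xy1 xyt].
  have key u v : `|x - u| <= 1 -> `|x - v| <= 1 -> u <= v -> v - u < e / (4 * t) ->
      `|F_ n v - F_ n u| < e.
    move=> hu hv uv vu.
    have H : (\int[leb]_(x in `[u, v]) (h n x)%:E <= K%:E)%E.
      apply: hK; move: hu hv; rewrite !ler_norml => /andP[u1 u2] /andP[v1 v2].
        by have := ler_norm (- x); rewrite normrN; lra.
      by have := ler_norm x; lra.
    apply: le_lt_trans (primitive_osc (pF n) uv t0 H) _.
    have h1 : t * (v - u) < e / 4.
      rewrite mulrC -ltr_pdivlMr//; apply: lt_le_trans vu _.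
      by rewrite le_eqVlt; apply/orP; left; apply/eqP; field; rewrite gt_eqF.
    have h2 : K / t <= e / 4.
      rewrite /t invf_div mulrA ler_pdivrMr ?mulr_gt0//.
      rewrite (_ : e / 4 * (4 * (K + 1)) = (K + 1) * e); last by field.
      by rewrite ler_wpM2r ?(ltW e0)// lerDl.
    by lra.
  have [yx|xy] := leP y x.
    apply: key => //; [by rewrite ltW|by rewrite subrr normr0|].
    by rewrite (le_lt_trans (ler_norm _)).
  rewrite distrC; apply: key; [by rewrite subrr normr0|by rewrite ltW|by rewrite ltW|].
  by rewrite (le_lt_trans (ler_norm _))// distrC.
have [k [G [kS hG]]] := ascoli_subsequence bF eF.
have FG x : F_ (k n) x @[n --> \oo] --> G x.
  apply/cvgrPdist_le => e e0; have [N HN] := hG `|x| e e0.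
  exists N => // n /= Nn; rewrite distrC; apply: HN => //.
  by rewrite -ler_norml.
have mG : measurable_fun setT G.
  have := @measurable_fun_cvg _ _ R setT (fun n => F_ (k n)) G.
  by apply => // x _; exact: FG.
exists k, G; split => //.
  apply: (@fatou_le _ _ _ leb (fun n x => F_ (k n) x ^+ 2 * w x) _ _ 0%N).
  - by move=> n; exact: sqw.
  - exact: sqw.
  - by move=> n x; rewrite mulr_ge0// sqr_ge0.
  - by move=> x; rewrite mulr_ge0// sqr_ge0.
  - apply: aeW => x; have := @cvg_weighted_sq (fun n => F_ (k n)) G x (FG x) 1.
    by rewrite mul1r; under eq_fun do rewrite mul1r.
  - move=> n _; apply: le_trans (hM (k n)); apply: ge0_le_integral => //.
    + by move=> x _; rewrite lee_fin mulr_ge0// sqr_ge0.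
    + by apply/measurable_EFinP; exact: sqw.
    + by apply/measurable_EFinP; exact: (measurable_funM (mh (k n)) mw).
    + by move=> x _; rewrite lee_fin ler_wpM2r// lerDl sqr_ge0.
move=> e e0.
have M0 : 0 <= M.
  rewrite -lee_fin (le_trans _ (hM 0%N))// integral_ge0// => x _.
  by rewrite lee_fin; exact: mulr_ge0 (h0 _ _) (w0 _).
(* The limit [G] has no known derivative, so the bound on V F is applied to the differences F_n -
   F_j and carried to F_n - G by Fatou's lemma. The factor 4 comes from (p - q)^2 <= 2 p^2 + 2 q^2
   applied to two functions of energy at most M. *)
have diff n j : (\int[leb]_x ((V x * (F_ n x - F_ j x)) ^+ 2 * w x)%:E <= (C * (4 * M))%:E)%E.
  apply: le_trans (hC _ _ (primitiveB (pF n) (pF j))) _.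
  rewrite EFinM lee_wpmul2l ?lee_fin ?(ltW C0)//.
  have mhw i : measurable_fun setT (fun x => h i x * w x) by exact: measurable_funM.
  have hw0 i x : 0 <= h i x * w x by rewrite mulr_ge0.
  apply: (@le_trans _ _ (\int[leb]_x ((2 * (h n x * w x))%:E + (2 * (h j x * w x))%:E))%E).
    apply: ge0_le_integral => //.
    + by move=> x _; rewrite lee_fin mulr_ge0// addr_ge0// sqr_ge0.
    + apply/measurable_EFinP.
      exact: (measurable_funM (measurable_funD
        (measurable_funX 2 (measurable_funB (mF n) (mF j)))
        (measurable_funX 2 (measurable_funB (mf n) (mf j)))) mw).
    + by apply: emeasurable_funD; apply/measurable_EFinP; exact: mcM (mhw _).
    + move=> x _; rewrite -EFinD lee_fin !mulrA -mulrDl ler_wpM2r// /h.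
      have := sqr_ge0 (F_ n x + F_ j x); have := sqr_ge0 (f_ n x + f_ j x).
      by rewrite !expr2; lra.
  rewrite ge0_integralD//; first last.
  + by apply/measurable_EFinP; exact: mcM (mhw _).
  + by move=> x _; rewrite lee_fin; exact: mulr_ge0 (ler0n _ _) (hw0 _ _).
  + by apply/measurable_EFinP; exact: mcM (mhw _).
  + by move=> x _; rewrite lee_fin; exact: mulr_ge0 (ler0n _ _) (hw0 _ _).
  rewrite -!(ge0_integral_scale leb (ler0n R 2) (mhw _) (hw0 _)).
  apply: (@le_trans _ _ (2%:E * M%:E + 2%:E * M%:E)%E).
    by apply: leeD; apply: lee_wpmul2l => //; exact: hM.
  by rewrite -!EFinM -EFinD lee_fin; lra.
have D n : (\int[leb]_x ((V x * (F_ n x - G x)) ^+ 2 * w x)%:E <= (C * (4 * M))%:E)%E.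
  apply: (@fatou_le _ _ _ leb (fun j x => (V x * (F_ n x - F_ (k j) x)) ^+ 2 * w x) _ _ 0%N).
  - by move=> j; apply: sqw; apply: measurable_funM => //; exact: measurable_funB.
  - by apply: sqw; apply: measurable_funM => //; exact: measurable_funB.
  - by move=> j x; rewrite mulr_ge0// sqr_ge0.
  - by move=> x; rewrite mulr_ge0// sqr_ge0.
  - apply: aeW => x.
    apply: (@cvg_weighted_sq (fun j x => F_ n x - F_ (k j) x) (fun x => F_ n x - G x)).
    by apply: cvgB; [exact: cvg_cst|exact: FG].
  - by move=> j _; exact: diff.
(* Where |V| >= L the square of F - G is at most L^-2 (V (F - G))^2, whose integral is at most e /
   2: L >= 1 gives L^2 >= L >= 2 C (4 M) / e. *)
pose L := 1 + 2 * (C * (4 * M)) / e.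
have CM0 : 0 <= C * (4 * M) by rewrite mulr_ge0 ?(ltW C0)// mulr_ge0.
have L1 : 1 <= L by rewrite lerDl; apply: divr_ge0; [exact: mulr_ge0|exact: ltW].
have L0 : 0 < L by rewrite (lt_le_trans _ L1).
have LD : (L ^+ 2)^-1 * (C * (4 * M)) <= e / 2.
  rewrite ler_pdivrMl ?exprn_gt0//.
  apply: (@le_trans _ _ (L * (e / 2))).
    rewrite -ler_pdivrMr ?divr_gt0// /L.
    rewrite (_ : C * (4 * M) / (e / 2) = 2 * (C * (4 * M)) / e); first by lra.
    by field; rewrite gt_eqF.
  by rewrite ler_wpM2r ?divr_ge0 ?(ltW e0)// expr2 ler_peMl// ltW.
have [r hr] := tail L.
pose Z := fine (\int[leb]_x (w x)%:E)%E.
have ZE : (\int[leb]_x (w x)%:E = Z%:E)%E by rewrite fineK//; exact: integrable_fin_num.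
have Z0 : 0 <= Z by rewrite -lee_fin -ZE; apply: integral_ge0 => x _; rewrite lee_fin.
pose e1 := e / (2 * (Z + 1)).
have e10 : 0 < e1 by rewrite divr_gt0// mulr_gt0// ltr_wpDl.
(* A uniform distance below both 1 and e1 has its square below e1. The choice of e1 makes e1 times
   the total mass Z at most e / 2. *)
have e11 : 0 < Num.min 1 e1 by rewrite lt_min ltr01.
have [N HN] := hG r _ e11.
exists N => n Nn.
pose q x := (V x * (F_ (k n) x - G x)) ^+ 2 * w x.
have mq : measurable_fun setT q.
  by apply: sqw; apply: measurable_funM => //; exact: measurable_funB.
have q0 x : 0 <= q x by rewrite mulr_ge0// sqr_ge0.
have Li : 0 <= (L ^+ 2)^-1 by rewrite invr_ge0 exprn_ge0// ltW.
apply: (@le_trans _ _ (\int[leb]_x ((e1 * w x)%:E + ((L ^+ 2)^-1 * q x)%:E))%E).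
  apply: ge0_le_integral => //.
  - by move=> x _; rewrite lee_fin mulr_ge0// sqr_ge0.
  - by apply/measurable_EFinP; apply: sqw; exact: measurable_funB.
  - by apply: emeasurable_funD; apply/measurable_EFinP; exact: mcM.
  - move=> x _; rewrite -EFinD lee_fin /q.
    have [xr|xr] := pselect (- r <= x <= r).
      apply: (@le_trans _ _ (e1 * w x)); last by rewrite lerDl mulr_ge0// mulr_ge0// sqr_ge0.
      rewrite ler_wpM2r//; have := HN n x Nn xr.
      rewrite le_min => /andP[a1 ae]; rewrite -real_normK ?num_real//.
      apply: le_trans ae; rewrite expr2 ler_piMl//.
    apply: (@le_trans _ _ ((L ^+ 2)^-1 * ((V x * (F_ (k n) x - G x)) ^+ 2 * w x))); last first.
      by rewrite lerDr mulr_ge0// ltW.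
    rewrite ler_pdivlMl ?exprn_gt0//.
    rewrite (_ : (V x * _) ^+ 2 * _ = V x ^+ 2 * ((F_ (k n) x - G x) ^+ 2 * w x)); last by ring.
    apply: ler_wpM2r; first exact: mulr_ge0 (sqr_ge0 _) (w0 _).
    by rewrite -[V x ^+ 2]real_normK ?num_real// lerXn2r ?nnegrE ?(ltW L0)// hr.
rewrite ge0_integralD//; first last.
- by apply/measurable_EFinP; exact: mcM.
- by move=> x _; rewrite lee_fin mulr_ge0.
- by apply/measurable_EFinP; exact: mcM.
- by move=> x _; rewrite lee_fin mulr_ge0// ltW.
rewrite -(ge0_integral_scale leb (ltW e10) mw w0) -(ge0_integral_scale leb Li mq q0) ZE.
apply: (@le_trans _ _ ((e1 * Z)%:E + ((L ^+ 2)^-1 * (C * (4 * M)))%:E)%E).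
  apply: leeD => //; rewrite EFinM; apply: lee_wpmul2l => //; exact: D.
rewrite -EFinD lee_fin (splitr e) lerD//.
rewrite /e1 mulrAC ler_pdivrMr ?mulr_gt0 ?ltr_wpDl//.
rewrite (_ : e / 2 * (2 * (Z + 1)) = e * (Z + 1)); last by field.
by rewrite ler_wpM2l ?(ltW e0)// lerDl.
Qed.

End weighted_compactness.

(** * The Gibbs measure and the phase space *)

Section gibbs_measure.
Context {R : realType}.
Local Notation leb := (@lebesgue_measure R).
Variable U : R -> R.
Hypothesis hU : C2 U.
Local Notation w := (fun x => expR (- U x)).

Let mw : measurable_fun setT w. Proof. exact: measurable_w. Qed.

(** The weight is continuous, hence integrable on each [-n, n]. The exchange of integrals in
    [ge0_integral_nu] rests on this instance. *)
Let nu_sigma_finite : sigma_finite setT (nu hU).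
Proof.
exists (fun n : nat => `[- (n%:R : R), n%:R]%classic).
  apply/esym/seteqP; split => // x _; exists (Num.truncn `|x|).+1 => //=.
  by rewrite in_itv/= -ler_norml ltW// truncnS_gt.
move=> n; split => //.
have /integrableP[_] := locint_itv (- (n%:R : R)) n%:R (continuous_locint (@weight_continuous _ _ hU (-1))).
congr (_ < _)%E; apply: eq_integral => x _.
by rewrite /= mulN1r ger0_norm ?expR_ge0.
Qed.

HB.instance Definition _ := Measure_isSigmaFinite.Build _ _ _ (nu hU) nu_sigma_finite.

(* Layer cake: f(x) is the length of [0, f(x)], and both iterated integrals of
   the region under the graph of f can be swapped. *)
Lemma ge0_integral_nu (f : R -> R) : measurable_fun setT f -> (forall x, 0 <= f x) ->
  (\int[nu hU]_x (f x)%:E = \int[leb]_x (f x * w x)%:E)%E.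
Proof.
move=> mf f0.
have w0 x : 0 <= w x by exact: expR_ge0.
pose D (z : R * R) := (0 <= z.2) && (z.2 <= f z.1).
have mD : measurable_fun setT D.
  apply: measurable_and; first exact: measurable_fun_ler.
  by apply: measurable_fun_ler => //; exact: measurableT_comp.
have mh c (g : R -> R) : measurable_fun setT g ->
    measurable_fun setT (fun z : R * R => (if D z then g z.1 else c)%:E).
  move=> mg; apply/measurable_EFinP; apply: measurable_fun_ifT => //.
  exact: measurableT_comp.
have len (a : R) x : 0 <= a -> (\int[leb]_t (if D (x, t) then a else 0)%:E = (f x * a)%:E)%E.
  move=> a0.
  have -> : (fun t => (if D (x, t) then a else 0)%:E) = (cst a%:E) \_ `[0, f x].
    by apply/funext => t; rewrite patchE mem_setE in_itv/= /D/=; case: ifP.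
  rewrite -integral_mkcond integral_cst//= lebesgue_measure_itv/= lte_fin.
  have := f0 x; rewrite le_eqVlt => /predU1P[<-|->]; first by rewrite ltxx mule0 mul0r.
  by rewrite -EFinB subr0 -EFinM mulrC.
have mh1 := mh 0 (fun=> 1) (measurable_cst _); have mh2 := mh 0 w mw.
have h1 z : (0 <= (if D z then 1 else 0 : R)%:E)%E by rewrite lee_fin; case: ifP.
have h2 z : (0 <= (if D z then w z.1 else 0 : R)%:E)%E by rewrite lee_fin; case: ifP.
transitivity (\int[nu hU]_x \int[leb]_t (if D (x, t) then 1 else 0 : R)%:E)%E.
  by apply: eq_integral => x _; rewrite len// mulr1.
transitivity (\int[leb]_x \int[leb]_t (if D (x, t) then w x else 0 : R)%:E)%E; last first.
  by apply: eq_integral => x _; rewrite len.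
rewrite (@fubini_tonelli _ _ _ _ _ (nu hU) leb _ mh1 h1).
rewrite (@fubini_tonelli _ _ _ _ _ leb leb _ mh2 h2).
(* For fixed t the left side is the mass of a level set under [nu], which is by definition an
   integral of the weight. *)
apply: eq_integral => t _.
have mA : measurable [set x | D (x, t)].
  by rewrite -[X in measurable X]setTI; exact: (measurableT_comp mD (pair2_measurable t)).
have inA x : (x \in [set x | D (x, t)]) = D (x, t) by apply/idP/idP; rewrite inE.
rewrite (_ : (fun x => _) = (fun x => (\1_[set x | D (x, t)] x)%:E)); last first.
  by apply/funext => x; rewrite indicE inA; case: (D _).
rewrite integral_indic// setIT /= /nu [LHS]integral_mkcond; apply: eq_integral => x _.
by rewrite patchE inA; case: (D _).
Qed.

Lemma Rintegral_nu (f : R -> R) : measurable_fun setT f ->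
  \int[nu hU]_x f x = \int[leb]_x (f x * w x).
Proof.
move=> mf; rewrite /Rintegral [in LHS]integralE [in RHS]integralE.
have pos x : ((fun x => (f x)%:E)^\+ x = (Num.max (f x) 0)%:E)%E.
  by rewrite funeposE EFin_max.
have neg x : ((fun x => (f x)%:E)^\- x = (Num.max (- f x) 0)%:E)%E.
  by rewrite funenegE EFin_max.
have posw x : ((fun x => (f x * w x)%:E)^\+ x = (Num.max (f x) 0 * w x)%:E)%E.
  by rewrite funeposE -EFin_max maxr_pMl ?expR_ge0// mul0r.
have negw x : ((fun x => (f x * w x)%:E)^\- x = (Num.max (- f x) 0 * w x)%:E)%E.
  by rewrite funenegE -EFinN -EFin_max maxr_pMl ?expR_ge0// mul0r mulNr.
under [in LHS]eq_integral do rewrite pos.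
under [X in fine (_ - X) = _]eq_integral do rewrite neg.
under [in RHS]eq_integral do rewrite posw.
under [X in _ = fine (_ - X)]eq_integral do rewrite negw.
rewrite !ge0_integral_nu//.
- by apply: measurable_maxr => //; exact: measurableT_comp.
- by move=> x; rewrite le_max lexx orbT.
- exact: measurable_maxr.
- by move=> x; rewrite le_max lexx orbT.
Qed.

(** The density [w] is positive everywhere, so [nu] and Lebesgue measure have the same null sets. *)
Lemma ae_nu (P : R -> Prop) : {ae leb, forall x, P x} <-> {ae nu hU, forall x, P x}.
Proof.
have nuE (N : set R) : measurable N -> (nu hU N = 0 <-> leb N = 0)%E.
  move=> mN; rewrite /nu /=; split => [h|h].
    have /ae_eq_integral_abs : (\int[leb]_(x in N) `|(w x)%:E| = 0)%E.
      by rewrite -h; apply: eq_integral => x _; rewrite gee0_abs// lee_fin expR_ge0.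
    case => //; first by apply/measurable_EFinP; exact: measurable_funS mw.
    move=> M [mM M0 NM].
    apply/eqP; rewrite eq_le measure_ge0 andbT -M0 le_measure ?inE//.
    move=> x Nx; apply: NM => /= /(_ Nx) /eqP.
    by rewrite eqe gt_eqF// expR_gt0.
  have -> : (\int[leb]_(x in N) (w x)%:E = \int[leb]_(x in N) `|(w x)%:E|)%E.
    by apply: eq_integral => x _; rewrite gee0_abs// lee_fin expR_ge0.
  rewrite integral_abs_eq0//.
  by apply/measurable_EFinP; exact: measurable_funS mw.
by split => -[N [mN N0 PN]]; exists N; split => //; exact/(nuE N mN).
Qed.

End gibbs_measure.

(** * Integration on the phase space *)

Section phase_space_measure.
Context {R : realType}.
Local Notation leb := (@lebesgue_measure R).
Variable U : R -> R.
Hypothesis hU : C2 U.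
Local Notation w := (fun x => expR (- U x)).

Lemma measurable_sliceP d (T : measurableType d) (f : R * bool -> T) :
  measurable_fun setT f <-> forall th, measurable_fun setT (fun x => f (x, th)).
Proof.
split=> [mf th|mf]; first exact: (measurableT_comp mf (pair2_measurable th)).
rewrite (_ : f = fun y => if y.2 then f (y.1, true) else f (y.1, false)); last first.
  by apply/funext => -[x []].
exact: (measurable_fun_if_pair (mf true) (mf false)).
Qed.

Lemma ge0_integral_mu (f : R * bool -> R) : measurable_fun setT f ->
  (forall y, 0 <= f y) ->
  (\int[mu hU]_y (f y)%:E =
   \int[leb]_x (f (x, true) * w x)%:E + \int[leb]_x (f (x, false) * w x)%:E)%E.
Proof.
move=> mf f0; have ms := (measurable_sliceP f).1 mf.
have mE : measurable_fun setT (EFin \o f) by exact/measurable_EFinP.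
rewrite /mu ge0_integral_measure_add//; last by move=> y _; rewrite lee_fin.
have key th : (\int[nu_at hU th]_y (f y)%:E = \int[leb]_x (f (x, th) * w x)%:E)%E.
  rewrite -ge0_integral_nu//.
  have := @ge0_integral_pushforward _ _ _ _ R _ (pair2_measurable th) (nu hU) setT
    (EFin \o f) measurableT mE.
  by apply => y _; rewrite lee_fin.
by rewrite !key.
Qed.

Lemma ae_mu (P : R * bool -> Prop) :
  (forall th, {ae leb, forall x, P (x, th)}) <-> {ae mu hU, forall y, P y}.
Proof.
have muE (N : set (R * bool)) :
    (mu hU N = nu_at hU true N + nu_at hU false N)%E by exact: measure_addE.
have nuE (N : set (R * bool)) th : (nu_at hU th N = nu hU [set x | N (x, th)])%E by [].
split=> [h|[N [mN N0 PN]] th].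
  have h' th : {ae nu hU, forall x, P (x, th)} by exact/(ae_nu hU).
  have [[N1 [mN1 N10 P1]] [N2 [mN2 N20 P2]]] := (h' true, h' false).
  exists [set y | if y.2 then N1 y.1 else N2 y.1]; split.
  - rewrite (_ : [set y | _] = (N1 `*` [set true]) `|` (N2 `*` [set false])).
      by apply: measurableU; apply: measurableX.
    apply/seteqP; split=> [[x []]|[x []]] /=; rewrite ?setXE/=; [by left|by right| |].
      by case=> [[]|[]].
    by case=> [[]|[]].
  - by rewrite muE !nuE /= N10 N20 adde0.
  - by move=> [x []] /= nP; [exact: P1|exact: P2].
apply/(ae_nu hU); exists [set x | N (x, th)]; split.
- have := pair2_measurable th measurableT mN.
  by rewrite setTI.
- move: N0; rewrite muE => /eqP; rewrite padde_eq0//.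
  by case: th => /andP[/eqP h1 /eqP h2].
- by move=> x nP; exact: PN.
Qed.

Lemma sq_integrable_mu (f : R * bool -> R) : sq_integrable (mu hU) f <->
  forall th, measurable_fun setT (fun x => f (x, th)) /\
    (\int[leb]_x (f (x, th) ^+ 2 * w x)%:E < +oo)%E.
Proof.
have i0 th : (0 <= \int[leb]_x (f (x, th) ^+ 2 * w x)%:E)%E.
  by apply: integral_ge0 => x _; rewrite lee_fin mulr_ge0 ?sqr_ge0 ?expR_ge0.
split=> [[mf fi] th|h].
  split; first exact: (measurable_sliceP f).1.
  move: fi; rewrite (@ge0_integral_mu (fun y => f y ^+ 2)); last 2 first.
    exact: measurable_funX.
    by move=> y; exact: sqr_ge0.
  apply: le_lt_trans; case: th; [by rewrite leeDl|by rewrite leeDr].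
have mf : measurable_fun setT f by apply/measurable_sliceP => th; case: (h th).
split => //; rewrite (@ge0_integral_mu (fun y => f y ^+ 2)).
- by apply: lte_add_pinfty; [case: (h true)|case: (h false)].
- exact: measurable_funX.
- by move=> y; exact: sqr_ge0.
Qed.

Lemma dot_mu (f g : R * bool -> R) : sq_integrable (mu hU) f ->
  sq_integrable (mu hU) g ->
  dot (mu hU) f g = \int[leb]_x (f (x, true) * g (x, true) * w x) +
                    \int[leb]_x (f (x, false) * g (x, false) * w x).
Proof.
move=> fi gi; have ifg := sq_integrableM fi gi.
have [mf _] := fi; have [mg _] := gi.
have mfg : measurable_fun setT (fun y => f y * g y) by exact: measurable_funM.
have mE : measurable_fun setT (fun y => (f y * g y)%:E) by exact/measurable_EFinP.
have mfgn : measurable_fun setT (fun y => `|(f y * g y)%:E|%E) by exact: measurableT_comp.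
have ith th : (nu_at hU th).-integrable setT (fun y => (f y * g y)%:E).
  have /integrableP[_ fin] := ifg; apply/integrableP; split => //.
  move: fin; rewrite /mu ge0_integral_measure_add//.
  by apply: le_lt_trans; case: th; [rewrite leeDl ?integral_ge0|rewrite leeDr ?integral_ge0].
have inu th : (nu hU).-integrable setT (fun x => (f (x, th) * g (x, th))%:E).
  have /integrableP[_ fin] := ith th; apply/integrableP; split.
    exact: (measurableT_comp mE (pair2_measurable th)).
  move: fin; congr (_ < _)%E.
  have := @ge0_integral_pushforward _ _ _ _ R _ (pair2_measurable th) (nu hU) setT
    (fun y => `|(f y * g y)%:E|%E) measurableT mfgn.
  by apply => y _.
have key th : (\int[nu_at hU th]_y (f y * g y)%:E = \int[nu hU]_x (f (x, th) * g (x, th))%:E)%E.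
  have := @integral_pushforward _ _ _ _ R _ (pair2_measurable th) (nu hU) setT
    (fun y => (f y * g y)%:E) mE.
  by apply => //; exact: inu.
rewrite /dot {1}/Rintegral /mu (integral_measure_add measurableT (ith true) (ith false)) !key fineD; last 2 first.
- exact: integrable_fin_num.
- exact: integrable_fin_num.
have mth th : measurable_fun setT (fun x => f (x, th) * g (x, th)).
  exact: ((measurable_sliceP (fun y => f y * g y)).1 mfg th).
by congr (_ + _); rewrite -[LHS]/(Rintegral (nu hU) setT _) Rintegral_nu.
Qed.

End phase_space_measure.

(** * Square integrable functions and test functions on the line *)

Section real_resolvent.
Context {R : realType}.
Local Notation leb := (@lebesgue_measure R).
Local Notation locint := (locally_integrable [set: R]).
Variable U : R -> R.
Hypothesis hU : C2 U.
Local Notation V := (derive1 U).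
Local Notation w := (fun x => expR (- U x)).
Local Notation sqi := (sq_integrable (nu hU)).

Lemma sq_integrable_le d (T : measurableType d) (m : {measure set T -> \bar R})
  (f g : T -> R) : measurable_fun setT f -> (forall x, `|f x| <= `|g x|) ->
  sq_integrable m g -> sq_integrable m f.
Proof.
move=> mf fg [mg gi]; split => //; apply: le_lt_trans gi.
apply: ge0_le_integral => //.
- by move=> x _; rewrite lee_fin sqr_ge0.
- exact: measurable_sq.
- exact: measurable_sq.
- move=> x _; rewrite lee_fin -[f x ^+ 2]real_normK ?num_real//.
  by rewrite -[g x ^+ 2]real_normK ?num_real// lerXn2r ?nnegrE.
Qed.

Lemma sq_integrable_ae d (T : measurableType d) (m : {measure set T -> \bar R})
  (f g : T -> R) : measurable_fun setT f -> {ae m, forall x, f x = g x} ->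
  sq_integrable m g -> sq_integrable m f.
Proof.
move=> mf fg [mg gi]; split => //; move: gi; congr (_ < _)%E.
apply: ge0_ae_eq_integral => //.
- exact: measurable_sq.
- exact: measurable_sq.
- by move=> x _; rewrite lee_fin sqr_ge0.
- by move=> x _; rewrite lee_fin sqr_ge0.
- by apply: ae_imp fg => x -> _.
Qed.

Lemma sq_nuE (f : R -> R) : measurable_fun setT f ->
  (\int[nu hU]_x (f x ^+ 2)%:E = \int[leb]_x (f x ^+ 2 * w x)%:E)%E.
Proof.
move=> mf; apply: (@ge0_integral_nu _ _ hU (fun x => f x ^+ 2)).
  exact: measurable_funX.
by move=> x; exact: sqr_ge0.
Qed.

Lemma sq_integrable_nu (f : R -> R) : sqi f <->
  measurable_fun setT f /\ (\int[leb]_x (f x ^+ 2 * w x)%:E < +oo)%E.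
Proof. by split=> -[mf fi]; split => //; move: fi; rewrite sq_nuE. Qed.

Lemma sq_integrable_mu_slice (f : R * bool -> R) :
  sq_integrable (mu hU) f <-> forall th, sqi (fun x => f (x, th)).
Proof.
split=> [/sq_integrable_mu h th|h]; first exact/sq_integrable_nu.
by apply/sq_integrable_mu => th; apply/sq_integrable_nu.
Qed.

Lemma sq_integrable_local (f : R -> R) (a b : R) : sqi f ->
  (\int[leb]_(x in `[a, b]) (f x ^+ 2)%:E < +oo)%E.
Proof.
move=> /sq_integrable_nu[mf fi].
pose r := `|a| + `|b|.
have [c c0 hc] := weight_lower_bound hU r.
have I0 : (0 <= \int[leb]_x (f x ^+ 2 * w x)%:E)%E.
  by apply: integral_ge0 => x _; rewrite lee_fin mulr_ge0 ?sqr_ge0 ?expR_ge0.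
have IE : (\int[leb]_x (f x ^+ 2 * w x)%:E =
    (fine (\int[leb]_x (f x ^+ 2 * w x)%:E))%:E)%E by rewrite fineK// ge0_fin_numE.
have := @weighted_local_bound R U hU (fun x => f x ^+ 2) _ r
  (measurable_funX 2 mf) (fun x => sqr_ge0 (f x)) _ c c0 hc a b.
move=> /(_ (fine (\int[leb]_x (f x ^+ 2 * w x)%:E)%E)) h.
apply: le_lt_trans (h _ _ _) (ltry _).
- by rewrite -IE.
- by rewrite /r lerNl (le_trans (ler_norm _))// normrN lerDl.
- by rewrite /r (le_trans (ler_norm _))// lerDr.
Qed.

Lemma sq_integrable_locint (f : R -> R) : sqi f -> locint f.
Proof.
move=> fi; have [mf _] := fi; split => //; first exact: openT.
move=> K _ cK; have [r _ Kr] := compact_sub_itv cK.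
have mE (g : R -> R) D : measurable_fun setT g -> measurable_fun D (fun x => (g x)%:E).
  by move=> mg; apply/measurable_EFinP; exact: measurable_funS mg.
have mfn : measurable_fun setT (fun x => `|f x|) by exact: measurableT_comp.
have mf2 : measurable_fun setT (fun x => f x ^+ 2) by exact: measurable_funX.
have i2 : leb.-integrable `[- r, r] (EFin \o (fun x => f x ^+ 2)).
  apply/integrableP; split; first exact: mE.
  apply: le_lt_trans (sq_integrable_local (- r) r fi).
  by under eq_integral do rewrite /= ger0_norm ?sqr_ge0//.
have i1 := locint_itv (- r) r (continuous_locint (@cst_continuous R R 1)).
have /integrableP[_] : leb.-integrable `[- r, r] (EFin \o f).
  apply: le_integrable (integrableD _ i1 i2) => //=; first exact: mE.
  move=> x _; rewrite lee_fin [leRHS]ger0_norm ?addr_ge0 ?sqr_ge0//.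
  rewrite -[f x ^+ 2]real_normK ?num_real//.
  by have := sqr_ge0 (`|f x| - 1); rewrite sqrrB; have := normr_ge0 (f x); nra.
apply: le_lt_trans; apply: ge0_subset_integral => //; first exact: compact_measurable.
exact: mE.
Qed.

Lemma continuous_compact_sq_integrable (f : R -> R) (r : R) : continuous f ->
  (forall x, ~ (- r <= x <= r) -> f x = 0) -> sqi f.
Proof.
move=> cf f0; have mf := continuous_measurable_fun cf.
apply/sq_integrable_nu; split => //.
have ch : continuous (fun x => f x ^+ 2 * w x).
  have cw : continuous w.
    have -> : w = (fun x => expR (-1 * U x)) by apply/funext => x; rewrite mulN1r.
    exact: weight_continuous.
  move=> x; apply: cvgM; last exact: cw.
  by rewrite expr2; under eq_fun do rewrite expr2; apply: cvgM; exact: cf.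
have /integrableP[_] := locint_itv (- r) r (continuous_locint ch).
apply: le_lt_trans; rewrite [leRHS]integral_mkcond; apply: ge0_le_integral => //.
- by move=> x _; rewrite lee_fin mulr_ge0 ?sqr_ge0 ?expR_ge0.
- by apply/measurable_EFinP; exact: continuous_measurable_fun.
- apply/(measurable_restrictT _ _).1 => //; apply/measurable_EFinP.
  apply: measurableT_comp => //; apply: (@measurable_funS _ _ _ _ setT) => //.
  exact: continuous_measurable_fun.
- move=> x _; rewrite patchE mem_setE in_itv/=; case: ifPn => [_|/negP xr].
    by rewrite lee_fin ler_norm.
  by rewrite f0// expr0n mul0r.
Qed.

Lemma test_functionP (phi : R -> R) : smooth phi ->
  (exists r, forall x, ~ (- r <= x <= r) -> phi x = 0) -> test_function phi.
Proof.
move=> sphi [r hr]; split => //; exists `[- r, r]%classic; first exact: segment_compact.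
by move=> x xr; apply: hr => xr'; apply: xr; rewrite /= in_itv.
Qed.

Lemma test_function_lincomb (phi psi : R -> R) a : test_function phi ->
  test_function psi -> test_function (fun x => phi x + a * psi x).
Proof.
move=> tphi tpsi; apply: test_functionP.
  exact: smooth_lincomb (test_function_smooth tphi) (test_function_smooth tpsi).
have [r1 r10 h1] := test_function_support tphi.
have [r2 r20 h2] := test_function_support tpsi.
exists (r1 + r2) => x xr.
have [-> _] : phi x = 0 /\ derive1 phi x = 0 by apply: h1 => xr1; apply: xr; lra.
have [-> _] : psi x = 0 /\ derive1 psi x = 0 by apply: h2 => xr1; apply: xr; lra.
by rewrite mulr0 addr0.
Qed.

Lemma derive1_lincomb (phi psi : R -> R) a x : test_function phi ->
  test_function psi ->
  derive1 (fun x => phi x + a * psi x) x = derive1 phi x + a * derive1 psi x.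
Proof.
move=> /test_function_smooth sphi /test_function_smooth spsi; rewrite derive1E.
by rewrite (derive_val (is_derive :=
  is_deriveD (smooth_is_derive sphi x) (is_deriveZ a (smooth_is_derive spsi x)))).
Qed.

Lemma test_function0 : test_function (fun _ : R => 0).
Proof.
apply: test_functionP; last by exists 0.
apply: (@smooth_closure R (fun f => f = (fun _ => 0))) => // _ ->.
by exists (fun _ => 0) => // x; exact: is_derive_cst.
Qed.

End real_resolvent.

(** * Real solutions of the resolvent equation *)

Section real_resolvent_existence.
Context {R : realType}.
Local Notation leb := (@lebesgue_measure R).
Local Notation locint := (locally_integrable [set: R]).
Variable U : R -> R.
Hypothesis hU : C2 U.
Local Notation V := (derive1 U).
Local Notation w := (fun x => expR (- U x)).
Local Notation sqi := (sq_integrable (nu hU)).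
Implicit Types (f g phi psi q : R -> R).

Lemma rweak_test phi psi : test_function phi -> test_function psi ->
  \int[leb]_x (phi x * derive1 psi x) = - \int[leb]_x (derive1 phi x * psi x).
Proof.
move=> tphi tpsi; have sphi := test_function_smooth tphi.
have pphi := primitive_C1 (smooth_is_derive sphi)
  (smooth_continuous (smooth_derive1 sphi)).
by have [_ _] := primitive_rweak pphi; exact.
Qed.

(* Embeds [phi] so that |embed phi|^2 is the Dirichlet form
   int (phi'^2 / q^2 + gamma phi^2) d nu with q^2 = gamma + lambda^+ + lambda^-. *)
Let embed (c : R) q phi : R * bool -> R :=
  fun y => if y.2 then derive1 phi y.1 / q y.1 else c * phi y.1.

(* (z1, z2) is the projection of (p1, p2) on the closure of the range of [embed]. *)
Let orthogonality c q (p1 p2 : R -> R) : 0 < c -> continuous q ->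
  (forall x, 0 < q x) -> sqi p1 -> sqi p2 ->
  exists z1 z2, [/\ sqi z1, sqi z2,
    rweak (fun x => z2 x / c) (fun x => q x * z1 x) &
    forall psi, test_function psi ->
      \int[leb]_x ((p1 x - z1 x) * (derive1 psi x / q x) * w x) +
      \int[leb]_x ((p2 x - z2 x) * (c * psi x) * w x) = 0].
Proof.
move=> c0 cq q0 p1i p2i.
have cqi : continuous (fun x => (q x)^-1).
  by move=> x; apply: cvgV; [rewrite gt_eqF|exact: cq].
have cu a : continuous (fun x => expR (a * U x)) by exact: weight_continuous.
have testc phi : test_function phi ->
    [/\ continuous phi, continuous (derive1 phi) & exists r,
      forall x, ~ (- r <= x <= r) -> phi x = 0 /\ derive1 phi x = 0].
  move=> tphi; have sphi := test_function_smooth tphi; split.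
  - exact: smooth_continuous.
  - exact: smooth_continuous (smooth_derive1 sphi).
  - by have [r _ hr] := test_function_support tphi; exists r.
have embi phi : test_function phi -> sq_integrable (mu hU) (embed c q phi).
  move=> /testc[cphi cdphi [r hr]]; apply/sq_integrable_mu_slice => -[] /=.
    apply: (@continuous_compact_sq_integrable _ _ _ _ r).
      by move=> x; apply: cvgM; [exact: cdphi|exact: cqi].
    by move=> x /hr[_ d0]; rewrite /embed/= d0 mul0r.
  apply: (@continuous_compact_sq_integrable _ _ _ _ r).
    by move=> x; apply: cvgM; [exact: cvg_cst|exact: cphi].
  by move=> x /hr[p0 _]; rewrite /embed/= p0 mulr0.
pose W := [set f | exists2 phi, test_function phi & f = embed c q phi].
pose g (y : R * bool) := if y.2 then p1 y.1 else p2 y.1.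
have gi : sq_integrable (mu hU) g by apply/sq_integrable_mu_slice => -[].
have [||||z [w_ [zi Ww wz ort]]] := @orthogonal_projection _ _ _ (mu hU) W g.
- by exists (embed c q (fun _ => 0)), (fun _ => 0); first exact: test_function0.
- by move=> _ [phi tphi ->]; exact: embi.
- move=> _ _ a [phi tphi ->] [psi tpsi ->].
  exists (fun x => phi x + a * psi x); first exact: test_function_lincomb.
  apply/funext => -[x []]; rewrite /embed/=; last by ring.
  by rewrite derive1_lincomb//; ring.
- exact: gi.
have [phi_ hphi] := choice (fun n => let: ex_intro2 f tf wf := Ww n in
   ex_intro (fun f => test_function f /\ w_ n = embed c q f) f (conj tf wf)).
have tphi_ n : test_function (phi_ n) by case: (hphi n).
have wE n : w_ n = embed c q (phi_ n) by case: (hphi n).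
have w_i n : sq_integrable (mu hU) (w_ n) by rewrite wE; exact: embi.
pose z1 x := z (x, true); pose z2 x := z (x, false).
have z1i : sqi z1 by have /sq_integrable_mu_slice := zi; exact.
have z2i : sqi z2 by have /sq_integrable_mu_slice := zi; exact.
have wn0 x : w x != 0 by rewrite gt_eqF// expR_gt0.
have winv x : (w x)^-1 = expR (1 * U x) by rewrite mul1r expRN invrK.
have qn0 x : q x != 0 by rewrite gt_eqF.
have cn0 : c != 0 by rewrite gt_eqF.
have zero (h : R -> R) : \int[leb]_x (h x * 0 * w x) = 0.
  by under eq_Rintegral do rewrite mulr0 mul0r; rewrite Rintegral_cst// mul0r.
exists z1, z2; split => //.
- split.
  + have := locintM (sq_integrable_locint z2i) (@cst_continuous R R c^-1).
    by [].
  + have := locintM (sq_integrable_locint z1i) cq.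
    by congr locally_integrable; apply/funext => x; rewrite mulrC.
  move=> psi tpsi; have [cpsi cdpsi [r hr]] := testc psi tpsi.
  (* Dividing by the weight makes the products with k1 and k2 integrals for Lebesgue measure: they
     become the two sides of the weak derivative relation between z2 / c and q z1. *)
  pose k1 (y : R * bool) := if y.2 then 0 else derive1 psi y.1 * (w y.1)^-1 / c.
  pose k2 (y : R * bool) := if y.2 then q y.1 * (psi y.1 * (w y.1)^-1) else 0.
  have k1i : sq_integrable (mu hU) k1.
    apply/sq_integrable_mu_slice => -[] /=; first exact: sq_integrable0.
    apply: (@continuous_compact_sq_integrable _ _ _ _ r).
      rewrite -/(continuous (fun x => k1 (x, false))).
      have -> : (fun x => k1 (x, false)) = (fun x => derive1 psi x * expR (1 * U x) / c).
        by apply/funext => x; rewrite /k1/= winv.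
      move=> x; apply: cvgM; last exact: cvg_cst.
      by apply: cvgM; [exact: cdpsi|exact: cu].
    by move=> x /hr[_ d0]; rewrite /k1/= d0 !mul0r.
  have k2i : sq_integrable (mu hU) k2.
    apply/sq_integrable_mu_slice => -[] /=; last exact: sq_integrable0.
    apply: (@continuous_compact_sq_integrable _ _ _ _ r).
      rewrite -/(continuous (fun x => k2 (x, true))).
      have -> : (fun x => k2 (x, true)) = (fun x => q x * (psi x * expR (1 * U x))).
        by apply/funext => x; rewrite /k2/= winv.
      move=> x; apply: cvgM; first exact: cq.
      by apply: cvgM; [exact: cpsi|exact: cu].
    by move=> x /hr[p0 _]; rewrite /k2/= p0 mul0r mulr0.
  have dot1 (f : R * bool -> R) : sq_integrable (mu hU) f ->
      dot (mu hU) f k1 = \int[leb]_x (f (x, false) / c * derive1 psi x).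
    move=> fi; rewrite dot_mu//= zero add0r; apply: eq_Rintegral => x _.
    rewrite /k1/=; move: (wn0 x) => /=; set ww := expR _ => w0.
    by field; rewrite cn0 w0.
  have dot2 (f : R * bool -> R) : sq_integrable (mu hU) f ->
      dot (mu hU) f k2 = \int[leb]_x (q x * f (x, true) * psi x).
    move=> fi; rewrite dot_mu//= zero addr0; apply: eq_Rintegral => x _.
    rewrite /k2/=; move: (wn0 x) => /=; set ww := expR _ => w0.
    by field; rewrite w0.
  have l1 := sq_cvg_dot w_i zi k1i wz.
  have l2 := sq_cvg_dot w_i zi k2i wz.
  (* For the image of a test function the relation is plain integration by parts; both products pass
     to the limit, so it holds for [z]. *)
  have E n : dot (mu hU) (w_ n) k1 = - dot (mu hU) (w_ n) k2.
    rewrite dot1// dot2// wE /embed/=.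
    under eq_Rintegral do rewrite (mulrC c) mulfK//.
    under [in RHS]eq_Rintegral do rewrite mulrCA divff// mulr1.
    exact: rweak_test.
  have l1' : dot (mu hU) (w_ n) k1 @[n --> \oo] --> - dot (mu hU) z k2.
    by under eq_fun do rewrite E; exact: cvgN.
  have := cvg_unique _ l1 l1'.
  by rewrite dot1// dot2//; apply.
- move=> psi tpsi.
  have := ort (embed c q psi); rewrite dot_mu//=.
  + by apply; exists psi.
  + exact: sq_integrableB.
  + exact: embi.
Qed.

(** The vector to project is (-H / q, G / c). Its projection (z1, z2) gives s = z2 / c and s' = q
    z1, and orthogonality then reads int (u0 psi' + (gam s - G) psi) d nu = 0 with u0 = (H + s') /
    (gam + lam). *)
Lemma real_resolvent_exists (gam : R) (lam G H : R -> R) : 0 < gam ->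
  continuous lam -> (forall x, 0 <= lam x) -> sqi G -> sqi H ->
  exists s s' u u', [/\ primitive s s', primitive u u', sqi s, sqi u &
    {ae leb, forall x, gam * s x - u' x + V x * u x = G x /\
                       gam * u x + lam x * u x - s' x = H x}].
Proof.
move=> g0 clam lam0 Gi Hi.
pose rho x := gam + lam x.
have rho0 x : 0 < rho x by rewrite ltr_wpDr.
have crho : continuous rho by move=> x; apply: cvgD; [exact: cvg_cst|exact: clam].
pose q x := Num.sqrt (rho x).
have cq : continuous q.
  move=> x; apply: (@continuous_comp _ _ _ rho Num.sqrt); first exact: crho.
  exact: sqrt_continuous.
have q0 x : 0 < q x by rewrite sqrtr_gt0.
have q2 x : q x ^+ 2 = rho x by rewrite sqr_sqrtr// ltW.
have qn0 x : q x != 0 by rewrite gt_eqF.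
pose c := Num.sqrt gam.
have c0 : 0 < c by rewrite sqrtr_gt0.
have c2 : c ^+ 2 = gam by rewrite sqr_sqrtr// ltW.
have cn0 : c != 0 by rewrite gt_eqF.
have cqle x : c <= q x by rewrite ler_sqrt ?lerDl// ltW.
have mq : measurable_fun setT q by exact: continuous_measurable_fun.
have cqi : continuous (fun x => (q x)^-1).
  by move=> x; apply: cvgV; [rewrite gt_eqF|exact: cq].
have mqi : measurable_fun setT (fun x => (q x)^-1) by exact: continuous_measurable_fun.
(* Dividing by q or by c preserves square integrability as q >= c > 0. *)
have divq f : sqi f -> sqi (fun x => f x / q x).
  move=> fi; have [mf _] := fi.
  apply: sq_integrable_le (sq_integrableZ c^-1 fi).
    exact: measurable_funM.
  move=> x; rewrite !normrM mulrC ler_wpM2r// !normfV !gtr0_norm//.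
  by rewrite lef_pV2// posrE.
have p1i : sqi (fun x => - (H x / q x)).
  have := sq_integrableZ (-1) (divq _ Hi).
  by congr sq_integrable; apply/funext => x; rewrite mulN1r.
have p2i : sqi (fun x => G x / c).
  have := sq_integrableZ c^-1 Gi.
  by congr sq_integrable; apply/funext => x; rewrite mulrC.
have [z1 [z2 [z1i z2i wk ort]]] := orthogonality c0 cq q0 p1i p2i.
have [mz1 _] := z1i; have [mz2 _] := z2i; have [mG _] := Gi; have [mH _] := Hi.
pose u0 x := (H x + q x * z1 x) / rho x.
have u0i : sqi u0.
  have := sq_integrableD 1 (divq _ (divq _ Hi)) (divq _ z1i).
  congr sq_integrable; apply/funext => x; rewrite /u0 -q2; field; exact: qn0.
have mu0 : measurable_fun setT u0 by case: u0i.
have cw : continuous w.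
  have -> : w = (fun x => expR (-1 * U x)) by apply/funext => x; rewrite mulN1r.
  exact: weight_continuous.
have gGi : sqi (fun x => gam * (z2 x / c) - G x).
  have := sq_integrableD (-1) (sq_integrableZ (gam / c) z2i) Gi.
  by congr sq_integrable; apply/funext => x; ring.
(* The orthogonality relation says (u0 w)' = (gam s - G) w, which is u' - V u = gam s - G multiplied
   by w. *)
have wk2 : rweak (fun x => u0 x * w x) (fun x => (gam * (z2 x / c) - G x) * w x).
  have l1 : locint (fun x => u0 x * w x) by apply: locintM cw; exact: sq_integrable_locint u0i.
  have l2 : locint (fun x => (gam * (z2 x / c) - G x) * w x).
    by apply: locintM cw; exact: sq_integrable_locint gGi.
  split => // psi tpsi.
  have [_ i1] := locint_test l1 tpsi; have [i2 _] := locint_test l2 tpsi.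
  have := ort psi tpsi.
  have -> : (fun x => (- (H x / q x) - z1 x) * (derive1 psi x / q x) * w x) =
            (fun x => -1 * (u0 x * w x * derive1 psi x)).
    by apply/funext => x; rewrite /u0 -q2; field; exact: qn0.
  have -> : (fun x => (G x / c - z2 x) * (c * psi x) * w x) =
            (fun x => -1 * ((gam * (z2 x / c) - G x) * w x * psi x)).
    by apply/funext => x; rewrite -c2; field.
  rewrite !RintegralZl// => /eqP; rewrite addr_eq0 => /eqP h.
  move: h; clear; rewrite !mulN1r opprK => h.
  by rewrite -h opprK.
have [s ps sE] := rweak_primitive wk.
have [W0 pW WE] := rweak_primitive wk2.
(* Multiplying the representative of u0 w by exp(U) recovers u; the derivative of exp(U) contributes
   the term V u. *)
have pu := primitiveM pW (primitive_weight hU 1).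
pose u x := W0 x * expR (1 * U x).
have uE : {ae leb, forall x, u0 x = u x}.
  apply: ae_imp WE => x h; rewrite /u -h mul1r -mulrA -expRD addrC subrr expR0.
  by rewrite mulr1.
have cs := primitive_continuous ps; have cu := primitive_continuous pu.
exists s, (fun x => q x * z1 x), u, (fun x =>
  (gam * (z2 x / c) - G x) * w x * expR (1 * U x) + W0 x * (1 * V x * expR (1 * U x))).
split; [exact: ps|exact: pu| | |].
- apply: sq_integrable_ae (sq_integrableZ c^-1 z2i).
    exact: continuous_measurable_fun.
  by apply/(ae_nu hU); apply: ae_imp sE => x <-; rewrite mulrC.
- apply: sq_integrable_ae u0i; first exact: continuous_measurable_fun.
  by apply/(ae_nu hU); apply: ae_imp uE => x <-.
- apply: ae_imp2 sE uE => x sx ux; split.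
    rewrite -sx /u.
    have e1 : expR (- U x) * expR (1 * U x) = 1 by rewrite mul1r -expRD addrC subrr expR0.
    rewrite -[in X in X - _ + _](mulr1 (z2 x / c)).
    have -> : (gam * (z2 x / c) - G x) * expR (- U x) * expR (1 * U x) +
        W0 x * (1 * V x * expR (1 * U x)) =
        (gam * (z2 x / c) - G x) * (expR (- U x) * expR (1 * U x)) +
        W0 x * (V x * expR (1 * U x)) by ring.
    by rewrite e1; ring.
  rewrite -ux /u0 -mulrDl -/(rho x).
  by field; rewrite gt_eqF.
Qed.

End real_resolvent_existence.

(** * Bounds for the generator *)

Section generator_bounds.
Context {R : realType}.
Local Notation leb := (@lebesgue_measure R).
Variables (U lambda_refr : R -> R).
Hypothesis hU : C2 U.
Local Notation V := (derive1 U).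
Local Notation V' := (derive1n 2 U).
Local Notation w := (fun x => expR (- U x)).
Local Notation rate := (jump_rate U lambda_refr).
Implicit Types (f d : R * bool -> R) (h : R -> R).

(** The derivative is a separate argument, so that [f] can be exchanged for an almost everywhere
    equal representative while [d] is kept. *)
Definition real_generator f d : R * bool -> R := fun y =>
  velocity R y.2 * d y + rate y.1 y.2 * (f (y.1, ~~ y.2) - f y).

Definition wint h : \bar R := (\int[leb]_x (h x * w x)%:E)%E.

Let measurable_hw h : measurable_fun setT h ->
  measurable_fun setT (fun x => (h x * w x)%:E).
Proof.
move=> mh; apply/measurable_EFinP; apply: measurable_funM => //.
exact: C2_measurable_expR.
Qed.

Lemma le_wint h1 h2 : measurable_fun setT h1 -> measurable_fun setT h2 ->
  (forall x, 0 <= h1 x) -> (forall x, h1 x <= h2 x) -> (wint h1 <= wint h2)%E.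
Proof.
move=> m1 m2 h0 h12; apply: ge0_le_integral => //.
- by move=> x _; rewrite lee_fin mulr_ge0 ?expR_ge0.
- exact: measurable_hw.
- exact: measurable_hw.
- by move=> x _; rewrite lee_fin ler_wpM2r ?expR_ge0.
Qed.

Lemma wintD h1 h2 : measurable_fun setT h1 -> measurable_fun setT h2 ->
  (forall x, 0 <= h1 x) -> (forall x, 0 <= h2 x) ->
  wint (fun x => h1 x + h2 x) = (wint h1 + wint h2)%E.
Proof.
move=> m1 m2 h10 h20; rewrite /wint -ge0_integralD//.
- by apply: eq_integral => x _; rewrite mulrDl.
- by move=> x _; rewrite lee_fin mulr_ge0 ?expR_ge0.
- exact: measurable_hw.
- by move=> x _; rewrite lee_fin mulr_ge0 ?expR_ge0.
- exact: measurable_hw.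
Qed.

Lemma wintZ c h : 0 <= c -> measurable_fun setT h -> (forall x, 0 <= h x) ->
  wint (fun x => c * h x) = (c%:E * wint h)%E.
Proof.
move=> c0 mh h0; rewrite /wint (ge0_integral_scale leb c0).
- by apply: eq_integral => x _; rewrite mulrA.
- by apply/measurable_EFinP; exact: measurable_hw.
- by move=> x; rewrite mulr_ge0 ?expR_ge0.
Qed.

Lemma ge0_integral_mu_wint f : measurable_fun setT f -> (forall y, 0 <= f y) ->
  (\int[mu hU]_y (f y)%:E = wint (fun x => (f (x, true) + f (x, false))%R))%E.
Proof.
move=> mf f0; have ms := (measurable_sliceP f).1 mf.
by rewrite (ge0_integral_mu hU)// wintD.
Qed.

Definition weak_pair f d := forall th, rweak (fun x => f (x, th)) (fun x => d (x, th)).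

Lemma weak_pair_measurable f d : weak_pair f d ->
  measurable_fun setT f /\ measurable_fun setT d.
Proof.
by move=> fd; split; apply/measurable_sliceP => th;
  have [lf ld _] := fd th; exact: locint_measurable.
Qed.

(** The equality is recorded at both velocities over the same position, because the generator
    evaluates [f] at the flipped velocity too. *)
Lemma weak_pair_primitive f d : weak_pair f d ->
  exists F : R * bool -> R,
    [/\ forall th, primitive (fun x => F (x, th)) (fun x => d (x, th)),
        measurable_fun setT F &
        {ae mu hU, forall y, f y = F y /\ f (y.1, ~~ y.2) = F (y.1, ~~ y.2)}].
Proof.
move=> fd; have [F1 p1 e1] := rweak_primitive (fd true).
have [F2 p2 e2] := rweak_primitive (fd false).
exists (fun y => if y.2 then F1 y.1 else F2 y.1); split; first by case.
- apply/measurable_sliceP => -[]; apply: continuous_measurable_fun.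
    exact: primitive_continuous p1.
  exact: primitive_continuous p2.
- by apply/ae_mu => -[]; apply: ae_imp2 e1 e2 => x /= -> ->.
Qed.

Lemma ae_mu_integral (f1 f2 : R * bool -> R) : measurable_fun setT f1 ->
  measurable_fun setT f2 -> (forall y, 0 <= f1 y) -> (forall y, 0 <= f2 y) ->
  {ae mu hU, forall y, f1 y = f2 y} ->
  (\int[mu hU]_y (f1 y)%:E = \int[mu hU]_y (f2 y)%:E)%E.
Proof.
move=> m1 m2 f10 f20 e; apply: ge0_ae_eq_integral => //.
- exact/measurable_EFinP.
- exact/measurable_EFinP.
- by move=> y _; rewrite lee_fin.
- by move=> y _; rewrite lee_fin.
- by apply: ae_imp e => y -> _.
Qed.

Lemma ae_mu_sq (f1 f2 : R * bool -> R) : measurable_fun setT f1 ->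
  measurable_fun setT f2 -> {ae mu hU, forall y, f1 y = f2 y} ->
  (\int[mu hU]_y (f1 y ^+ 2)%:E = \int[mu hU]_y (f2 y ^+ 2)%:E)%E.
Proof.
move=> m1 m2 e; apply: (@ae_mu_integral (fun y => f1 y ^+ 2) (fun y => f2 y ^+ 2)).
- exact: measurable_funX.
- exact: measurable_funX.
- by move=> y; exact: sqr_ge0.
- by move=> y; exact: sqr_ge0.
- by apply: ae_imp e => y ->.
Qed.

Lemma mu_sq_wint f : measurable_fun setT f ->
  (\int[mu hU]_y (f y ^+ 2)%:E = wint (fun x => (f (x, true) ^+ 2 + f (x, false) ^+ 2)%R))%E.
Proof.
move=> mf; rewrite (@ge0_integral_mu_wint (fun y => f y ^+ 2))//; first exact: measurable_funX.
by move=> y; exact: sqr_ge0.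
Qed.

Lemma wint_combine (X S Y : R -> R) (p q K : R) : measurable_fun setT X ->
  measurable_fun setT S -> measurable_fun setT Y ->
  (forall x, 0 <= X x) -> (forall x, 0 <= S x) -> (forall x, 0 <= Y x) ->
  0 <= p -> 0 <= q -> 0 <= K -> (forall x, X x <= p * S x + q * Y x) ->
  (wint Y <= K%:E * wint S)%E -> (wint X <= (p + q * K)%:E * wint S)%E.
Proof.
move=> mX mS mY X0 S0 Y0 p0 q0 K0 XSY YS.
have [mp mq] : measurable_fun setT (fun x => p * S x) /\
    measurable_fun setT (fun x => q * Y x) by split; exact: measurable_funM.
have pS x : 0 <= p * S x by rewrite mulr_ge0.
have qY x : 0 <= q * Y x by rewrite mulr_ge0.
apply: le_trans (le_wint mX (measurable_funD mp mq) X0 XSY) _.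
rewrite (wintD mp mq pS qY) !wintZ// EFinD ge0_muleDl ?lee_fin ?mulr_ge0//.
by rewrite leeD2l// EFinM -muleA lee_wpmul2l.
Qed.

Section bounds.
Hypothesis mrefr : measurable_fun setT lambda_refr.

Lemma measurable_jump_rate th : measurable_fun setT (fun x => rate x th).
Proof.
apply: measurable_funD => //; apply: measurable_maxr => //.
by apply: measurable_funM => //; exact: measurable_V.
Qed.

Lemma measurable_real_generator f d : measurable_fun setT f -> measurable_fun setT d ->
  measurable_fun setT (real_generator f d).
Proof.
move=> mf md; apply/measurable_sliceP => th; rewrite /real_generator/=.
have mfs := (measurable_sliceP f).1 mf; have mds := (measurable_sliceP d).1 md.
apply: measurable_funD.
  by apply: measurable_funM => //; exact: mds.
by apply: measurable_funM; [exact: measurable_jump_rate|exact: measurable_funB].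
Qed.

Lemma jump_rateB x : rate x true - rate x false = V x.
Proof.
rewrite /jump_rate /velocity mul1r mulN1r.
case: (lerP 0 (V x)) => v0.
  by rewrite (max_idPr _) ?oppr_le0//; ring.
by rewrite (max_idPl _) ?oppr_ge0 ?(ltW v0)//; ring.
Qed.

Lemma jump_rateD x : rate x true + rate x false = `|V x| + 2 * lambda_refr x.
Proof.
rewrite /jump_rate /velocity mul1r mulN1r.
case: (lerP 0 (V x)) => v0.
  by rewrite ger0_norm// (max_idPr _) ?oppr_le0//; ring.
by rewrite ltr0_norm// (max_idPl _) ?oppr_ge0 ?(ltW v0)//; ring.
Qed.

Section growth.
Variables c1 c2 : R.
Hypothesis hc1 : 0 <= c1.
Hypothesis refr_ge0 : forall x, 0 <= lambda_refr x.
Hypothesis refr_le : forall x, lambda_refr x <= c1 + c2 * `|V x|.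

Lemma jump_rate_bound x th : 0 <= rate x th <= c1 + (1 + c2) * `|V x|.
Proof.
rewrite /jump_rate addr_ge0 ?le_max ?lexx ?orbT//=.
have h : Num.max (velocity R th * V x) 0 <= `|V x|.
  rewrite ge_max normr_ge0 andbT /velocity; case: th; rewrite ?mul1r ?mulN1r.
    exact: ler_norm.
  by rewrite -normrN ler_norm.
by have := refr_le x; lra.
Qed.

Let k := 1 + c2.

Let rate_sq x th (t : R) : (rate x th * t) ^+ 2 <=
  2 * c1 ^+ 2 * t ^+ 2 + 2 * k ^+ 2 * (V x * t) ^+ 2.
Proof.
have /andP[r0 r1] := jump_rate_bound x th.
have v2 : V x ^+ 2 = `|V x| ^+ 2 by rewrite real_normK ?num_real.
rewrite !exprMn v2 [X in _ <= _ + X]mulrA -mulrDl ler_wpM2r ?sqr_ge0//.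
have : rate x th ^+ 2 <= (c1 + (1 + c2) * `|V x|) ^+ 2 by rewrite lerXn2r ?nnegrE// (le_trans r0).
by have := sqr_ge0 (c1 - k * `|V x|); rewrite /k; nra.
Qed.

Let diff_sq (a b : R) : (a - b) ^+ 2 <= 2 * a ^+ 2 + 2 * b ^+ 2.
Proof. by have := sqr_ge0 (a + b); nra. Qed.

(** The jump part of the generator sees only the difference of the two velocity components, so V
    times that difference is all that has to be bounded. *)
Let diff_potential (delta A : R) : delta < 1 -> 0 < A ->
  (forall x, V' x <= delta * `|V x| ^+ 2 + A) ->
  exists2 C, 0 < C & forall F d, 
    (forall th, primitive (fun x => F (x, th)) (fun x => d (x, th))) ->
    (wint (fun x => ((V x * (F (x, true) - F (x, false))) ^+ 2)%R) <=
     C%:E * wint (fun x => ((F (x, true) - F (x, false)) ^+ 2 +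
                         (d (x, true) - d (x, false)) ^+ 2)%R))%E.
Proof.
move=> d1 A0 hV; have [C C0 hC] := potential_sq_bound hU d1 A0 hV.
by exists C => // F d p; exact: hC (primitiveB (p true) (p false)).
Qed.

Section potential.
Variables a delta A : R.
Hypotheses (hdelta : delta < 1) (hA : 0 < A).
Hypothesis hV' : forall x, a <= V' x <= delta * `|V x| ^+ 2 + A.

Let hV2 x : V' x <= delta * `|V x| ^+ 2 + A.
Proof. by have /andP[] := hV' x. Qed.

Let hVa x : a <= V' x.
Proof. by have /andP[] := hV' x. Qed.

(** The sum of the two components of the generator is u' - V u with u = F^+ - F^-, so [derive_bound]
    controls u' and then [potential_sq_bound] controls V u. Each derivative is, up to sign, the
    generator plus or minus a rate times u, and the rate is at most c1 + k |V|. *)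
Lemma derivative_bound : exists2 C, 0 < C & forall f d, weak_pair f d ->
  (\int[mu hU]_y (d y ^+ 2)%:E <=
   C%:E * \int[mu hU]_y (f y ^+ 2 + real_generator f d y ^+ 2)%:E)%E.
Proof.
have [C1 C10 hC1] := derive_bound hU hVa.
have [C2 C20 hC2] := diff_potential hdelta hA hV2.
have C1p : 0 <= 2 + 2 * C1 by rewrite addr_ge0 ?mulr_ge0 ?(ltW C10).
have C2p : 0 <= C2 * (2 + 2 * C1) by rewrite mulr_ge0 ?(ltW C20).
(* The squares of the two derivatives are at most twice those of the generator plus 8 c1^2 u^2 + 8
   k^2 (V u)^2. Here u^2 <= 2 S, the integral of u'^2 is at most 2 C1 times that of S, and C2 is the
   constant for V u. *)
exists (2 + 16 * c1 ^+ 2 + 8 * k ^+ 2 * (C2 * (2 + 2 * C1))).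
  have p0 : 0 <= 8 * k ^+ 2 * (C2 * (2 + 2 * C1)) by rewrite mulr_ge0// mulr_ge0 ?sqr_ge0.
  by have := sqr_ge0 c1; lra.
move=> f d fd; have [mf md] := weak_pair_measurable fd.
have [F [pF mF fF]] := weak_pair_primitive fd.
pose G := real_generator F d.
have [mg mG] := (measurable_real_generator mf md, measurable_real_generator mF md).
rewrite integral_sqD// (ae_mu_sq mf mF) ?(ae_mu_sq mg mG); last 2 first.
- by apply: ae_imp fF => y [e1 e2]; rewrite /real_generator e1 e2.
- by apply: ae_imp fF => y [].
rewrite -integral_sqD// (ge0_integral_mu_wint (f := fun y => F y ^+ 2 + G y ^+ 2)); last 2 first.
- by apply: measurable_funD; exact: measurable_funX.
- by move=> y; rewrite addr_ge0 ?sqr_ge0.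
rewrite mu_sq_wint//.
pose S x := F (x, true) ^+ 2 + G (x, true) ^+ 2 + (F (x, false) ^+ 2 + G (x, false) ^+ 2).
pose u x := F (x, true) - F (x, false); pose u' x := d (x, true) - d (x, false).
have mFs := (measurable_sliceP F).1 mF; have mGs := (measurable_sliceP G).1 mG.
have mds := (measurable_sliceP d).1 md.
have mu : measurable_fun setT u by exact: measurable_funB.
have mu' : measurable_fun setT u' by exact: measurable_funB.
have mVu : measurable_fun setT (fun x => V x * u x).
  by apply: measurable_funM => //; exact: measurable_V.
have mS : measurable_fun setT S.
  by apply: measurable_funD; apply: measurable_funD; exact: measurable_funX.
have S0 x : 0 <= S x by rewrite !addr_ge0 ?sqr_ge0.
have u'V x : u' x - V x * u x = G (x, true) + G (x, false).
  by rewrite -jump_rateB /G /real_generator/= /u /u'; ring.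
have uS x : u x ^+ 2 <= 2 * S x.
  have := diff_sq (F (x, true)) (F (x, false)); rewrite -/(u x) /S.
  by have := sqr_ge0 (G (x, true)); have := sqr_ge0 (G (x, false)); lra.
have hu : (wint (fun x => (u x ^+ 2)%R) <= 2%:E * wint S)%E.
  rewrite -wintZ//; apply: le_wint => //; first exact: measurable_funX.
    exact: measurable_funM.
  by move=> x; exact: sqr_ge0.
have hu' : (wint (fun x => (u' x ^+ 2)%R) <= (2 * C1)%:E * wint S)%E.
  apply: le_trans (hC1 _ _ (primitiveB (pF true) (pF false))) _.
  rewrite mulrC EFinM -muleA lee_pmul2l// ?lte_fin// -wintZ//.
  apply: le_wint.
  - apply: measurable_funD; last exact: measurable_funX.
    by apply: measurable_funX; exact: measurable_funB.
  - exact: measurable_funM.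
  - by move=> x; rewrite addr_ge0 ?sqr_ge0.
  - move=> x; rewrite -/(u x) -/(u' x) u'V.
    have := sqr_ge0 (G (x, true) - G (x, false)).
    by have := sqr_ge0 (F (x, true) + F (x, false)); rewrite /S /u; nra.
apply: (wint_combine (Y := fun x => (V x * u x) ^+ 2)) => //.
- by apply: measurable_funD; exact: measurable_funX.
- exact: measurable_funX.
- by move=> x; rewrite addr_ge0 ?sqr_ge0.
- by move=> x; exact: sqr_ge0.
- by rewrite addr_ge0 ?mulr_ge0 ?sqr_ge0.
- by rewrite mulr_ge0 ?sqr_ge0.
- move=> x.
  have dt : d (x, true) = G (x, true) - rate x true * (- u x).
    by rewrite /G /real_generator/= /u; ring.
  have df : d (x, false) = rate x false * u x - G (x, false).
    by rewrite /G /real_generator/= /u; ring.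
  have h1 := diff_sq (G (x, true)) (rate x true * (- u x)).
  have h2 := diff_sq (rate x false * u x) (G (x, false)).
  have h3 := rate_sq x true (- u x); have h4 := rate_sq x false (u x).
  have h7 := sqr_ge0 (F (x, true)); have h8 := sqr_ge0 (F (x, false)).
  rewrite mulrN !sqrrN in h3 h1; rewrite dt df mulrN.
  have h9 : c1 ^+ 2 * u x ^+ 2 <= c1 ^+ 2 * (2 * S x) by rewrite ler_wpM2l ?sqr_ge0.
  move: h1 h2 h3 h4 h9 h7 h8; rewrite /S mulrN; nra.
- apply: le_trans (hC2 _ _ pF) _; rewrite EFinM -muleA lee_pmul2l// ?lte_fin//.
  rewrite EFinD ge0_muleDl ?lee_fin// ?mulr_ge0 ?(ltW C10)//.
  rewrite (wintD (measurable_funX 2 mu) (measurable_funX 2 mu') (fun x => sqr_ge0 _) (fun x => sqr_ge0 _)).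
  exact: leeD hu hu'.
Qed.

(** The formulas for the two components are used in the other direction: now u and u' are bounded
    directly by f and d, so [potential_sq_bound] alone controls V u. *)
Lemma generator_bound : exists2 C, 0 < C & forall f d, weak_pair f d ->
  (\int[mu hU]_y (real_generator f d y ^+ 2)%:E <=
   C%:E * \int[mu hU]_y (f y ^+ 2 + d y ^+ 2)%:E)%E.
Proof.
have [C2 C20 hC2] := diff_potential hdelta hA hV2.
exists (2 + 16 * c1 ^+ 2 + 8 * k ^+ 2 * (C2 * 2)).
  have p0 : 0 <= 8 * k ^+ 2 * (C2 * 2).
    by apply: mulr_ge0; [rewrite mulr_ge0// sqr_ge0|rewrite mulr_ge0// (ltW C20)].
  by have := sqr_ge0 c1; lra.
move=> f d fd; have [mf md] := weak_pair_measurable fd.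
have [F [pF mF fF]] := weak_pair_primitive fd.
pose G := real_generator F d.
have [mg mG] := (measurable_real_generator mf md, measurable_real_generator mF md).
rewrite integral_sqD// (ae_mu_sq mf mF) ?(ae_mu_sq mg mG); last 2 first.
- by apply: ae_imp fF => y [e1 e2]; rewrite /real_generator e1 e2.
- by apply: ae_imp fF => y [].
rewrite -integral_sqD// (ge0_integral_mu_wint (f := fun y => F y ^+ 2 + d y ^+ 2)); last 2 first.
- by apply: measurable_funD; exact: measurable_funX.
- by move=> y; rewrite addr_ge0 ?sqr_ge0.
rewrite mu_sq_wint//.
pose S x := F (x, true) ^+ 2 + d (x, true) ^+ 2 + (F (x, false) ^+ 2 + d (x, false) ^+ 2).
pose u x := F (x, true) - F (x, false).
have mFs := (measurable_sliceP F).1 mF; have mGs := (measurable_sliceP G).1 mG.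
have mds := (measurable_sliceP d).1 md.
have mS : measurable_fun setT S.
  by apply: measurable_funD; apply: measurable_funD; exact: measurable_funX.
have S0 x : 0 <= S x by rewrite !addr_ge0 ?sqr_ge0.
apply: (wint_combine (Y := fun x => (V x * u x) ^+ 2)) => //.
- by apply: measurable_funD; exact: measurable_funX.
- apply: measurable_funX; apply: measurable_funM; [exact: measurable_V|exact: measurable_funB].
- by move=> x; rewrite addr_ge0 ?sqr_ge0.
- by move=> x; exact: sqr_ge0.
- by rewrite addr_ge0 ?mulr_ge0 ?sqr_ge0.
- by rewrite mulr_ge0 ?sqr_ge0.
- by rewrite mulr_ge0// ltW.
- move=> x.
  have dt : G (x, true) = d (x, true) - rate x true * u x.
    by rewrite /G /real_generator/= /u; ring.
  have df : G (x, false) = rate x false * u x - d (x, false).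
    by rewrite /G /real_generator/= /u; ring.
  have h1 := diff_sq (d (x, true)) (rate x true * u x).
  have h2 := diff_sq (rate x false * u x) (d (x, false)).
  have h3 := rate_sq x true (u x); have h4 := rate_sq x false (u x).
  have h5 := diff_sq (F (x, true)) (F (x, false)).
  have h7 := sqr_ge0 (F (x, true)); have h8 := sqr_ge0 (F (x, false)).
  have h10 := sqr_ge0 (d (x, true)); have h11 := sqr_ge0 (d (x, false)).
  rewrite -/G dt df.
  have h9 : c1 ^+ 2 * u x ^+ 2 <= c1 ^+ 2 * (2 * S x).
    by rewrite ler_wpM2l ?sqr_ge0// /u /S; lra.
  by move: h1 h2 h3 h4 h9 h7 h8 h10 h11; rewrite /S; nra.
- apply: le_trans (hC2 _ _ pF) _; rewrite EFinM -muleA lee_pmul2l// ?lte_fin//.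
  rewrite -wintZ//; apply: le_wint.
  + by apply: measurable_funD; apply: measurable_funX; exact: measurable_funB.
  + exact: measurable_funM.
  + by move=> x; rewrite addr_ge0 ?sqr_ge0.
  + move=> x; have h1 := diff_sq (F (x, true)) (F (x, false)).
    by have h2 := diff_sq (d (x, true)) (d (x, false)); rewrite /S; lra.
Qed.

End potential.
End growth.

(** Apply [dissipation_bound] to s = F^+ + F^- and u = F^+ - F^-. On both sides the sum of the two
    squares is twice the sum over the velocities; square integrability of [f] supplies the
    finiteness asked for there. *)
Lemma resolvent_bound gamma : 0 < gamma -> (forall x, 0 <= lambda_refr x) ->
  exists2 C, 0 < C & forall f d, weak_pair f d -> sq_integrable (mu hU) f ->
  (\int[mu hU]_y (f y ^+ 2)%:E <=
   C%:E * \int[mu hU]_y ((gamma * f y - real_generator f d y) ^+ 2)%:E)%E.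
Proof.
move=> g0 refr_ge0.
have mlam : measurable_fun setT (fun x => `|V x| + 2 * lambda_refr x).
  apply: measurable_funD; last exact: measurable_funM.
  by apply: measurableT_comp => //; exact: measurable_V.
have lam0 x : 0 <= `|V x| + 2 * lambda_refr x by rewrite addr_ge0 ?mulr_ge0.
have [C C0 hC] := dissipation_bound hU g0 lam0 mlam.
exists (C * 2); first by rewrite mulr_gt0.
move=> f d fd fi; have [mf md] := weak_pair_measurable fd.
have [F [pF mF fF]] := weak_pair_primitive fd.
have [mg mG] := (measurable_real_generator mf md, measurable_real_generator mF md).
have {fi} [_] := fi; rewrite (ae_mu_sq mf mF); last by apply: ae_imp fF => y [].
move=> fin.
have mk (f1 : R * bool -> R) : measurable_fun setT f1 ->
    measurable_fun setT (fun y => gamma * f1 y - real_generator f1 d y).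
  move=> m1; apply: measurable_funB; last exact: measurable_real_generator.
  exact: measurable_funM.
rewrite (ae_mu_sq (mk f mf) (mk F mF)); last first.
  by apply: ae_imp fF => y [e1 e2]; rewrite /real_generator e1 e2.
have mFs := (measurable_sliceP F).1 mF.
move: fin; rewrite (mu_sq_wint mF) (mu_sq_wint (mk F mF)).
pose h x := F (x, true) ^+ 2 + F (x, false) ^+ 2; rewrite -/h => fin.
pose g x := (gamma * F (x, true) - real_generator F d (x, true)) ^+ 2 +
  (gamma * F (x, false) - real_generator F d (x, false)) ^+ 2; rewrite -/g.
have mh : measurable_fun setT h by apply: measurable_funD; exact: measurable_funX.
have h0 x : 0 <= h x by rewrite addr_ge0 ?sqr_ge0.
have mgs := (measurable_sliceP _).1 (mk F mF).
have mg0 : measurable_fun setT g by apply: measurable_funD; apply: measurable_funX; exact: mgs.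
have g00 x : 0 <= g x by rewrite addr_ge0 ?sqr_ge0.
have := hC _ _ _ _ (primitiveD (pF true) (pF false)) (primitiveB (pF true) (pF false)).
have -> : (\int[leb]_x (((F (x, true) + F (x, false)) ^+ 2 +
    (F (x, true) - F (x, false)) ^+ 2) * w x)%:E = 2%:E * wint h)%E.
  by rewrite -wintZ//; apply: eq_integral => x _; rewrite /h; congr EFin; ring.
have -> : (\int[leb]_x (((gamma * (F (x, true) + F (x, false)) - (d (x, true) - d (x, false)) +
      V x * (F (x, true) - F (x, false))) ^+ 2 +
    (gamma * (F (x, true) - F (x, false)) + (`|V x| + 2 * lambda_refr x) *
      (F (x, true) - F (x, false)) - (d (x, true) + d (x, false))) ^+ 2) * w x)%:E =
    2%:E * wint g)%E.
  rewrite -wintZ//; apply: eq_integral => x _; rewrite -jump_rateD -jump_rateB.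
  by rewrite /g /real_generator/=; congr EFin; ring.
move=> H; rewrite EFinM -muleA; apply: le_trans (H _).
  by rewrite -wintZ//; apply: le_wint => //; [exact: measurable_funM|move=> x; have := h0 x; lra].
by rewrite lte_mul_pinfty// lee_fin.
Qed.

End bounds.
End generator_bounds.

(** * The complex zigzag process *)

Section complex_parts.
Context {R : realType}.
Local Notation leb := (@lebesgue_measure R).
Implicit Types (z : R[i]) (b : bool).

(** A boolean index for the real part ([true]) and the imaginary part ([false]), so that statements
    about both are made once. Multiplication by a real number commutes with it, hence so does the
    generator. *)
Definition part b z : R := if b then complex.Re z else complex.Im z.

Lemma partD b (z1 z2 : R[i]) : part b (z1 + z2) = part b z1 + part b z2.
Proof. by case: b; case: z1; case: z2. Qed.

Lemma partN b z : part b (- z) = - part b z.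
Proof. by case: b; case: z. Qed.

Lemma partB b (z1 z2 : R[i]) : part b (z1 - z2) = part b z1 - part b z2.
Proof. by rewrite partD partN. Qed.

Lemma partZ b (r : R) z : part b (r%:C%C * z) = r * part b z.
Proof. by case: b; case: z => x y /=; rewrite !mul0r ?subr0 ?addr0. Qed.

Lemma partZr b (r : R) z : part b (z * r%:C%C) = part b z * r.
Proof. by rewrite mulrC partZ mulrC. Qed.

Lemma part_inj (z1 z2 : R[i]) : (forall b, part b z1 = part b z2) -> z1 = z2.
Proof. by case: z1 z2 => [a1 b1] [a2 b2] h; have := h true; have := h false => /= -> ->. Qed.

Lemma normc_sq z : Normc.normc z ^+ 2 = part true z ^+ 2 + part false z ^+ 2.
Proof. by case: z => x y; rewrite /Normc.normc sqr_sqrtr// addr_ge0 ?sqr_ge0. Qed.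

Section norm.
Context d (T : measurableType d) (m : {measure set T -> \bar R}).
Implicit Types f g : T -> R[i].

Definition csq f : \bar R := (\int[m]_x (part true (f x) ^+ 2)%:E +
                              \int[m]_x (part false (f x) ^+ 2)%:E)%E.

Lemma csq_ge0 f : (0 <= csq f)%E.
Proof. by apply: adde_ge0; exact: sq_ge0. Qed.

Lemma cmeasurableP f : cmeasurable f <-> forall b, measurable_fun setT (fun x => part b (f x)).
Proof. by split=> [[h1 h2] []//|h]; split; [exact: (h true)|exact: (h false)]. Qed.

Lemma L2norm_ge0 f : (0 <= L2norm m f)%E. Proof. exact: Lnorm_ge0. Qed.

Lemma L2norm_sq f : cmeasurable f -> (L2norm m f `^ 2 = csq f)%E.
Proof.
move=> /cmeasurableP mf; rewrite /L2norm poweR_Lnorm// /csq -integral_sqD//.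
apply: eq_integral => x _.
by rewrite /= powR_mulrn ?normr_ge0// real_normK ?num_real// normc_sq.
Qed.

Lemma L2norm_csq f : cmeasurable f -> L2norm m f = (csq f `^ 2^-1)%E.
Proof.
move=> mf; rewrite -L2norm_sq// -poweRrM divff// poweRe1//.
exact: L2norm_ge0.
Qed.

Lemma le_poweR (r : R) (x y : \bar R) : 0 <= r -> (0 <= x)%E -> (x <= y)%E ->
  (x `^ r <= y `^ r)%E.
Proof.
move=> r0 x0 xy; apply: gt0_ler_poweR => //; rewrite in_itv/= leey andbT//.
exact: le_trans xy.
Qed.

Lemma csq_le f (C : R) : cmeasurable f -> (L2norm m f <= C%:E)%E ->
  (csq f <= (C ^+ 2)%:E)%E.
Proof.
move=> mf fC; have C0 : 0 <= C by rewrite -lee_fin (le_trans (L2norm_ge0 f)).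
rewrite -L2norm_sq// -powR_mulrn// -poweR_EFin; apply: le_poweR => //.
exact: L2norm_ge0.
Qed.

Lemma L2norm_le f (C : R) : cmeasurable f -> 0 <= C -> (csq f <= (C ^+ 2)%:E)%E ->
  (L2norm m f <= C%:E)%E.
Proof.
move=> mf C0 h; rewrite L2norm_csq//.
have -> : C%:E = ((C ^+ 2)%:E `^ 2^-1)%E.
  by rewrite poweR_EFin -powR_mulrn// -powRrM divff// powRr1.
by apply: le_poweR => //; exact: csq_ge0.
Qed.

Lemma L2norm_scale_le f g (C : R) : cmeasurable f -> cmeasurable g -> 0 <= C ->
  (csq f <= C%:E * csq g)%E -> (L2norm m f <= (Num.sqrt C)%:E * L2norm m g)%E.
Proof.
move=> mf mg C0 h; rewrite !L2norm_csq//.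
have -> : (Num.sqrt C)%:E = (C%:E `^ 2^-1)%E by rewrite poweR_EFin powR12_sqrt.
rewrite -poweRM ?lee_fin ?csq_ge0//; apply: le_poweR => //; exact: csq_ge0.
Qed.

Lemma L2P f : L2 m f <-> forall b, sq_integrable m (fun x => part b (f x)).
Proof.
split=> [[mf fi] b|h].
  have /cmeasurableP mfb := mf; split; first exact: mfb.
  have : (csq f < +oo)%E by rewrite -L2norm_sq// poweR_lty.
  apply: le_lt_trans; rewrite /csq.
  by case: b; [rewrite leeDl// sq_ge0|rewrite leeDr// sq_ge0].
have mf : cmeasurable f by apply/cmeasurableP => b; have [] := h b.
split => //; rewrite L2norm_csq//; apply: poweR_lty.
by apply: lte_add_pinfty; [have [] := h true|have [] := h false].
Qed.

Lemma L2norm_cvg0 (v : nat -> T -> R[i]) : (forall n, cmeasurable (v n)) ->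
  (forall e : R, 0 < e -> exists N, forall n, (N <= n)%N -> (csq (v n) <= e%:E)%E) ->
  L2norm m (v n) @[n --> \oo] --> 0%E.
Proof.
move=> mv h.
have key (e : R) : 0 < e -> \forall n \near \oo, (L2norm m (v n) <= e%:E)%E.
  move=> e0; have [N HN] := h (e ^+ 2) (exprn_gt0 2 e0).
  by exists N => // n /= Nn; apply: L2norm_le; [exact: mv|exact: ltW|exact: HN].
have fin : \forall n \near \oo, L2norm m (v n) \is a fin_num.
  have := key 1 ltr01; apply: filterS => n hn.
  by rewrite ge0_fin_numE ?L2norm_ge0// (le_lt_trans hn)// ltry.
apply/fine_cvgP; split => //.
apply/cvgrPdist_le => e e0; have := key e e0; apply: filterS2 fin => n fn hn.
rewrite sub0r normrN /= ger0_norm ?fine_ge0 ?L2norm_ge0//.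
by rewrite -lee_fin fineK.
Qed.

End norm.

Lemma is_weak_derivativeP (f g : R -> R[i]) : is_weak_derivative f g <->
  forall b, rweak (fun x => part b (f x)) (fun x => part b (g x)).
Proof.
have cint (h : R -> R[i]) (p : R -> R) :
    cintegral (fun x => h x * (p x)%:C%C) =
    Complex (\int[leb]_x (part true (h x) * p x)) (\int[leb]_x (part false (h x) * p x)).
  rewrite /cintegral; congr Complex; apply: eq_Rintegral => x _.
    exact: (partZr true).
  exact: (partZr false).
split=> [[[lf1 lf2] [lg1 lg2] h] b|h].
  by split; [by case: b|by case: b|move=> phi /h]; rewrite !cint => -[h1 h2]; case: b.
have [lf1 lg1 h1] := h true; have [lf2 lg2 h2] := h false.
split; [by split|by split|move=> phi tphi].
by rewrite !cint h1// h2.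
Qed.

Lemma weak_derivativeP (f g : R -> R[i]) : is_weak_derivative f g ->
  is_weak_derivative f (weak_derivative f).
Proof. by move=> fg; rewrite /weak_derivative; case: xgetP => [h -> //|/(_ g)]. Qed.

(** The two continuous representatives of [f] agree almost everywhere, hence everywhere, and one
    function determines its density up to a null set. *)
Lemma rweak_unique (f g h : R -> R) : rweak f g -> rweak f h ->
  {ae leb, forall x, g x = h x}.
Proof.
move=> /rweak_primitive[F pF fF] /rweak_primitive[H pH fH].
have FH : F = H.
  apply: ae_eq_continuous; [exact: primitive_continuous pF|exact: primitive_continuous pH|].
  by apply: ae_imp2 fF fH => x -> ->.
by apply: primitive_unique pF _; rewrite FH.
Qed.

End complex_parts.

(** * The domain of the generator *)

Section zigzag_domain.
Context {R : realType}.
Local Notation leb := (@lebesgue_measure R).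
Variables (U lambda_refr : R -> R).
Hypothesis hU : C2 U.
Local Notation V := (derive1 U).
Local Notation w := (fun x => expR (- U x)).
Local Notation rate := (jump_rate U lambda_refr).
Local Notation gen := (real_generator U lambda_refr).
Local Notation L := (zigzag_generator U lambda_refr).
Local Notation sqi := (sq_integrable (nu hU)).
Local Notation sqmu := (sq_integrable (mu hU)).
Local Notation pt b f := (fun y => part b (f y)).
Implicit Types (f g : R * bool -> R[i]) (b th : bool).

Lemma part_generator b f y : part b (L f y) = gen (pt b f) (pt b (partial_x f)) y.
Proof. by case: y => x th; rewrite /zigzag_generator partD !partZ partB. Qed.

Lemma sq_integrable_L2loc (f : R -> R[i]) : (forall b, sqi (pt b f)) -> L2loc f.
Proof.
move=> fi; split; first by apply/cmeasurableP => b; have [] := fi b.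
move=> K cK; have [r _ Kr] := compact_sub_itv cK.
have ms b : measurable_fun setT (fun x => part b (f x) ^+ 2).
  by have [mf _] := fi b; exact: measurable_funX.
have mE b D : measurable_fun D (fun x => (part b (f x) ^+ 2)%:E).
  by apply/measurable_EFinP; exact: measurable_funS (ms b).
pose h x := ((part true (f x) ^+ 2)%:E + (part false (f x) ^+ 2)%:E)%E.
have -> : (fun x => (Normc.normc (f x) ^+ 2)%:E) = h.
  by apply/funext => x; rewrite normc_sq.
have : (\int[leb]_(x in K) h x <= \int[leb]_(x in `[(- r)%R, r]) h x)%E.
  apply: ge0_subset_integral => //; first exact: compact_measurable.
  - by rewrite /h; apply: emeasurable_funD; exact: mE.
  - by move=> x _; rewrite adde_ge0// lee_fin sqr_ge0.
move=> le1; apply: (le_lt_trans le1); rewrite /h.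
have p b (x : R) : `[- r, r]%classic x -> (0 <= (part b (f x) ^+ 2)%:E)%E.
  by move=> _; rewrite lee_fin sqr_ge0.
rewrite (ge0_integralD leb (measurable_itv _) (p true) (mE true _) (p false) (mE false _)).
by apply: lte_add_pinfty; exact: (sq_integrable_local _ _ (fi _)).
Qed.

Lemma W12loc_weak_pair f : W12loc_E f ->
  forall b, weak_pair (pt b f) (pt b (partial_x f)).
Proof.
move=> fW b th; have [_ [g fg _]] := fW th.
by have /is_weak_derivativeP := weak_derivativeP fg.
Qed.

Lemma weak_pair_slice b f g : (forall th, is_weak_derivative (slice f th) (slice g th)) ->
  weak_pair (pt b f) (pt b g).
Proof. by move=> fg th; have /is_weak_derivativeP := fg th. Qed.

(** [partial_x] is a value selected by choice, so it can be identified with a derivative known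
    explicitly only up to a null set. *)
Lemma weak_pair_partial_x f g : (forall b, weak_pair (pt b f) (pt b g)) ->
  (forall b, weak_pair (pt b f) (pt b (partial_x f))) /\
  {ae mu hU, forall y, partial_x f y = g y}.
Proof.
move=> fg.
have fp b : weak_pair (pt b f) (pt b (partial_x f)).
  apply: weak_pair_slice => th; apply: (@weak_derivativeP _ _ (slice g th)).
  by apply/is_weak_derivativeP => b'; exact: (fg b' th).
split => //; apply/ae_mu => th.
have h1 := rweak_unique (fp true th) (fg true th).
have h2 := rweak_unique (fp false th) (fg false th).
by apply: ae_imp2 h1 h2 => x e1 e2; apply: part_inj => -[].
Qed.

Lemma W12_muP f : W12_mu hU f <-> forall b,
  [/\ weak_pair (pt b f) (pt b (partial_x f)), sqmu (pt b f) &
      sqmu (pt b (partial_x f))].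
Proof.
split=> [fW|h].
  have [g hg] := choice (fun th => let: conj _ (ex_intro2 g wg Lg) := fW th in
    ex_intro (fun g : R -> R[i] => is_weak_derivative (slice f th) g /\ L2 (nu hU) g) g (conj wg Lg)).
  have fg b : weak_pair (pt b f) (pt b (fun y => g y.2 y.1)).
    by apply: weak_pair_slice => th; have [] := hg th.
  have [fp e] := weak_pair_partial_x fg.
  move=> b; have [_ mp] := weak_pair_measurable (fp b); split; first exact: fp.
    apply/sq_integrable_mu_slice => th; have [fL _] := fW th.
    by have /L2P := fL; exact.
  apply: (@sq_integrable_ae _ _ _ _ _ (pt b (fun y => g y.2 y.1))) => //.
    by apply: ae_imp e => y ->.
  apply/sq_integrable_mu_slice => th; have [_ /L2P gL] := hg th; exact: gL.
move=> th; split.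
  by apply/L2P => b; have [_ /sq_integrable_mu_slice fi _] := h b; exact: fi.
exists (slice (partial_x f) th).
  by apply/is_weak_derivativeP => b; have [fp _ _] := h b; exact: fp.
by apply/L2P => b; have [_ _ /sq_integrable_mu_slice fi] := h b; exact: fi.
Qed.

Lemma W12_mu_W12loc f : W12_mu hU f -> W12loc_E f.
Proof.
move=> /W12_muP h th; split.
  by apply: sq_integrable_L2loc => b; have [_ /sq_integrable_mu_slice fi _] := h b; exact: fi.
exists (slice (partial_x f) th).
  by apply/is_weak_derivativeP => b; have [fp _ _] := h b; exact: fp.
by apply: sq_integrable_L2loc => b; have [_ _ /sq_integrable_mu_slice fi] := h b; exact: fi.
Qed.

Lemma L2_W12_mu f : W12_mu hU f -> L2 (mu hU) f.
Proof. by move=> /W12_muP h; apply/L2P => b; have [] := h b. Qed.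

Section assumptions.
Variables a delta A c1 c2 : R.
Hypotheses (hdelta : delta < 1) (hA : 0 < A).
Hypothesis hV' : forall x, a <= derive1n 2 U x <= delta * `|V x| ^+ 2 + A.
Hypothesis hc1 : 0 <= c1.
Hypothesis crefr : continuous lambda_refr.
Hypothesis refr_ge0 : forall x, 0 <= lambda_refr x.
Hypothesis refr_le : forall x, lambda_refr x <= c1 + c2 * `|V x|.

Let mrefr : measurable_fun setT lambda_refr.
Proof. exact: continuous_measurable_fun. Qed.

Let sq_integrable_scale (f g h : R * bool -> R) C : measurable_fun setT f ->
  sqmu g -> sqmu h ->
  (\int[mu hU]_y (f y ^+ 2)%:E <= C%:E * \int[mu hU]_y (g y ^+ 2 + h y ^+ 2)%:E)%E ->
  0 <= C -> sqmu f.
Proof.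
move=> mf [mg gi] [mh hi] fC C0; split => //; apply: le_lt_trans fC _.
by rewrite integral_sqD// lte_mul_pinfty ?lee_fin// lte_add_pinfty.
Qed.

(** The local Sobolev condition is replaced by weak differentiability, the form in which
    [shifted_surj] obtains its solution. *)
Lemma zigzag_domain_sq f : L2 (mu hU) f -> L2 (mu hU) (L f) ->
  (forall b, weak_pair (pt b f) (pt b (partial_x f))) -> W12_mu hU f.
Proof.
move=> /L2P fi /L2P Lfi fp; apply/W12_muP => b; split; [exact: fp|exact: fi|].
have [C C0 hC] := derivative_bound hU mrefr hc1 refr_ge0 refr_le hdelta hA hV'.
have [_ mp] := weak_pair_measurable (fp b).
apply: sq_integrable_scale (fi b) (Lfi b) _ (ltW C0) => //.
under [in X in (_ <= _ * X)%E]eq_integral do rewrite part_generator.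
exact: hC (fp b).
Qed.

Lemma zigzag_domain_W12 : zigzag_domain hU lambda_refr = W12_mu hU.
Proof.
apply/seteqP; split=> f.
  by move=> [fL fW LfL]; apply: zigzag_domain_sq => //; exact: W12loc_weak_pair.
move=> fW; have /W12_muP fp := fW; split; [exact: L2_W12_mu|exact: W12_mu_W12loc|].
have [C C0 hC] := generator_bound hU mrefr hc1 refr_ge0 refr_le hdelta hA hV'.
apply/L2P => b; have [wf fi pi] := fp b.
have -> : pt b (L f) = gen (pt b f) (pt b (partial_x f)).
  by apply/funext => y; exact: part_generator.
apply: (sq_integrable_scale _ fi pi (hC _ _ wf) (ltW C0)).
by apply: measurable_real_generator; [| |have [] := fi|have [] := pi].
Qed.

End assumptions.
End zigzag_domain.

(** * The resolvent set contains the positive half-line *)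

Section zigzag_resolvent.
Context {R : realType}.
Local Notation leb := (@lebesgue_measure R).
Variables (U lambda_refr : R -> R).
Hypothesis hU : C2 U.
Local Notation V := (derive1 U).
Local Notation w := (fun x => expR (- U x)).
Local Notation rate := (jump_rate U lambda_refr).
Local Notation gen := (real_generator U lambda_refr).
Local Notation L := (zigzag_generator U lambda_refr).
Local Notation sqi := (sq_integrable (nu hU)).
Local Notation sqmu := (sq_integrable (mu hU)).
Local Notation pt b f := (fun y => part b (f y)).
Implicit Types (f g : R * bool -> R[i]) (b th : bool).

Lemma partM b (c z : R[i]) :
  part b (c * z) = part true c * part b z +
                   (if b then - part false c else part false c) * part (~~ b) z.
Proof. by case: c => p q; case: z => x y; case: b => /=; ring. Qed.

Lemma rweak_comb (c : R) (f1 d1 f2 d2 : R -> R) : rweak f1 d1 -> rweak f2 d2 ->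
  rweak (fun x => c * f1 x + f2 x) (fun x => c * d1 x + d2 x).
Proof.
move=> w1 w2; have [l1 _ _] := w1; have [l2 _ _] := w2.
have [F1 p1 e1] := rweak_primitive w1; have [F2 p2 e2] := rweak_primitive w2.
apply: rweak_ael (primitive_rweak (primitiveD (primitiveZ c p1) p2)).
  apply: measurable_funD; last exact: locint_measurable l2.
  by apply: measurable_funM => //; exact: locint_measurable l1.
by apply: ae_imp2 e1 e2 => x -> ->.
Qed.

Lemma sq_integrable_comb (c : R) (f1 f2 : R * bool -> R) : sqmu f1 -> sqmu f2 ->
  sqmu (fun y => c * f1 y + f2 y).
Proof.
move=> h1 h2; have := sq_integrableD c h2 h1.
by congr sq_integrable; apply/funext => y; rewrite addrC.
Qed.

Lemma W12_mu_comb (c : R[i]) f g : W12_mu hU f -> W12_mu hU g ->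
  W12_mu hU (fun y => c * f y + g y) /\
  {ae mu hU, forall y, partial_x (fun y => c * f y + g y) y =
                       c * partial_x f y + partial_x g y}.
Proof.
move=> /W12_muP fW /W12_muP gW.
have E b (f1 g1 : R * bool -> R[i]) : pt b (fun y => c * f1 y + g1 y) =
    (fun y => part true c * part b (f1 y) +
      ((if b then - part false c else part false c) * part (~~ b) (f1 y) + part b (g1 y))).
  by apply/funext => y; rewrite partD partM addrA.
have wp b : weak_pair (pt b (fun y => c * f y + g y))
                      (pt b (fun y => c * partial_x f y + partial_x g y)).
  have [w1 _ _] := fW b; have [w2 _ _] := fW (~~ b); have [w3 _ _] := gW b.
  by rewrite !E => th; exact: rweak_comb (w1 th) (rweak_comb _ (w2 th) (w3 th)).
have [wp' e] := weak_pair_partial_x hU wp; split => //.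
apply/W12_muP => b; split; first exact: wp'.
  have [_ i1 _] := fW b; have [_ i2 _] := fW (~~ b); have [_ i3 _] := gW b.
  by rewrite E; exact: sq_integrable_comb i1 (sq_integrable_comb _ i2 i3).
have [_ mp] := weak_pair_measurable (wp' b).
apply: (@sq_integrable_ae _ _ _ _ _ (pt b (fun y => c * partial_x f y + partial_x g y))) => //.
  by apply: ae_imp e => y ->.
have [_ _ i1] := fW b; have [_ _ i2] := fW (~~ b); have [_ _ i3] := gW b.
by rewrite E; exact: sq_integrable_comb i1 (sq_integrable_comb _ i2 i3).
Qed.

Lemma shifted_generator_comb gamma (c : R[i]) f g : W12_mu hU f -> W12_mu hU g ->
  {ae mu hU, forall y, shifted_generator U lambda_refr gamma (fun y => c * f y + g y) y =
    c * shifted_generator U lambda_refr gamma f y +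
    shifted_generator U lambda_refr gamma g y}.
Proof.
move=> fW gW; have [_] := W12_mu_comb c fW gW.
apply: ae_imp => -[x th] e; rewrite /shifted_generator /zigzag_generator e.
ring.
Qed.

Lemma ae_part (f g : R * bool -> R[i]) :
  (forall b, {ae mu hU, forall y, part b (f y) = part b (g y)}) ->
  {ae mu hU, forall y, f y = g y}.
Proof. by move=> h; apply: ae_imp2 (h true) (h false) => y h1 h2; apply: part_inj => -[]. Qed.

Lemma csq_eq0 (f : R * bool -> R[i]) : L2 (mu hU) f -> (csq (mu hU) f <= 0)%E ->
  {ae mu hU, forall y, f y = 0}.
Proof.
move=> /L2P fi f0; apply: (@ae_part _ (fun=> 0)) => b; have [mf _] := fi b.
have z : (\int[mu hU]_y `|(part b (f y) ^+ 2)%:E| = 0)%E.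
  under eq_integral do rewrite gee0_abs ?lee_fin ?sqr_ge0//.
  apply/eqP; rewrite eq_le sq_ge0 andbT; apply: le_trans f0; rewrite /csq.
  by case: b {mf}; [rewrite leeDl// sq_ge0|rewrite leeDr// sq_ge0].
have := (ae_eq_integral_abs _ measurableT (measurable_sq mf)).1 z.
apply: ae_imp => y /(_ I)/= [] /eqP; rewrite sqrf_eq0 => /eqP ->.
by case: b {mf z}.
Qed.

Section assumptions.
Variables a delta A c1 c2 : R.
Hypotheses (hdelta : delta < 1) (hA : 0 < A).
Hypothesis hV' : forall x, a <= derive1n 2 U x <= delta * `|V x| ^+ 2 + A.
Hypothesis hc1 : 0 <= c1.
Hypothesis crefr : continuous lambda_refr.
Hypothesis refr_ge0 : forall x, 0 <= lambda_refr x.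
Hypothesis refr_le : forall x, lambda_refr x <= c1 + c2 * `|V x|.
Variable gamma : R.
Hypothesis gamma0 : 0 < gamma.
Local Notation T := (shifted_generator U lambda_refr gamma).
Local Notation domain := (zigzag_domain hU lambda_refr).

Let mrefr : measurable_fun setT lambda_refr.
Proof. exact: continuous_measurable_fun. Qed.

Let domainE : domain = W12_mu hU.
Proof. exact: zigzag_domain_W12 hdelta hA hV' hc1 crefr refr_ge0 refr_le. Qed.

Lemma part_shifted b f y :
  part b (T f y) = gamma * part b (f y) - gen (pt b f) (pt b (partial_x f)) y.
Proof. by rewrite /shifted_generator partB partZ part_generator. Qed.

Lemma L2_shifted f : domain f -> L2 (mu hU) (T f).
Proof.
move=> [/L2P fL _ /L2P LfL]; apply/L2P => b.
have := sq_integrableD (-1) (sq_integrableZ gamma (fL b)) (LfL b).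
by congr sq_integrable; apply/funext => y; rewrite /shifted_generator partB partZ mulN1r.
Qed.

Lemma csq_shifted : exists2 C, 0 < C & forall f, domain f ->
  (csq (mu hU) f <= C%:E * csq (mu hU) (T f))%E.
Proof.
have [C C0 hC] := resolvent_bound hU mrefr gamma0 refr_ge0.
exists C => // f; rewrite domainE => /W12_muP fW.
have key b : (\int[mu hU]_y (part b (f y) ^+ 2)%:E <=
    C%:E * \int[mu hU]_y (part b (T f y) ^+ 2)%:E)%E.
  have [wf fi _] := fW b.
  by under [in X in (_ <= _ * X)%E]eq_integral do rewrite part_shifted; exact: hC wf fi.
by rewrite /csq ge0_muleDr ?sq_ge0// leeD.
Qed.

(** The bound of [csq_shifted] is applied to the difference. The derivative selected for a
    difference is the difference of the derivatives only almost everywhere, which is why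
    [shifted_generator_comb] comes in. *)
Lemma shifted_inj f g : domain f -> domain g ->
  {ae mu hU, forall y, T f y = T g y} -> {ae mu hU, forall y, f y = g y}.
Proof.
rewrite domainE => fW gW fg; have [hW _] := W12_mu_comb (-1) gW fW.
have hT := shifted_generator_comb gamma (-1) gW fW.
pose h y := -1 * g y + f y.
have : {ae mu hU, forall y, h y = 0}.
  apply: csq_eq0; first exact: L2_W12_mu.
  have [C _ hC] := csq_shifted; apply: le_trans (hC h _) _; first by rewrite domainE.
  suff z b : (\int[mu hU]_y (part b (T h y) ^+ 2)%:E = 0)%E by rewrite /csq !z adde0 mule0.
  have hD : domain h by rewrite domainE.
  have /L2P/(_ b)[mT _] := L2_shifted hD.
  rewrite (@ae_mu_integral _ _ hU (fun y => part b (T h y) ^+ 2) (fun=> 0)) ?integral0//.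
  - exact: measurable_funX.
  - by move=> y; exact: sqr_ge0.
  - by apply: ae_imp2 hT fg => y -> ->; rewrite mulN1r addNr; case: b {mT}; rewrite expr0n.
by apply: ae_imp => y /eqP; rewrite /h mulN1r addrC subr_eq0 => /eqP.
Qed.

(** The system for s and u is solved with right sides g^+ + g^- and g^+ - g^-, and the components
    are recovered as (s + u) / 2 and (s - u) / 2. *)
Lemma real_shifted_solution (g : R * bool -> R) : sqmu g ->
  exists f d : R * bool -> R, [/\ weak_pair f d, sqmu f &
    {ae mu hU, forall y, gamma * f y - gen f d y = g y}].
Proof.
move=> /sq_integrable_mu_slice gi.
pose lam x := `|V x| + 2 * lambda_refr x.
have clam : continuous lam.
  move=> x; apply: cvgD.
    by apply: continuous_comp; [exact: potential_derive_continuous|exact: norm_continuous].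
  by apply: cvgM; [exact: cvg_cst|exact: crefr].
have lam0 x : 0 <= lam x by rewrite addr_ge0 ?mulr_ge0.
have Gi := sq_integrableD 1 (gi true) (gi false).
have Hi := sq_integrableD (-1) (gi true) (gi false).
have [s [s' [u [u' [ps pu si ui e]]]]] := real_resolvent_exists gamma0 clam lam0 Gi Hi.
pose sgn th : R := if th then 1 else -1.
exists (fun y => 2^-1 * (s y.1 + sgn y.2 * u y.1)).
exists (fun y => 2^-1 * (s' y.1 + sgn y.2 * u' y.1)); split.
- by move=> th; exact: primitive_rweak (primitiveZ _ (primitiveD ps (primitiveZ _ pu))).
- by apply/sq_integrable_mu_slice => th; exact: sq_integrableZ (sq_integrableD _ si ui).
- apply/ae_mu => th; apply: ae_imp e => x [e1 e2].
  have rB := jump_rateB U lambda_refr x; have rD := jump_rateD U lambda_refr x.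
  rewrite -/(lam x) in rD; move: e1 e2; rewrite -rB -rD.
  by case: th; rewrite /real_generator /sgn /velocity /=;
    move: (rate x true) (rate x false) => r1 r2 e1 e2; lra.
Qed.

(** Real and imaginary parts are solved separately. The equation itself shows that L f = gamma f - g
    is square integrable, which places the solution in the domain. *)
Lemma shifted_surj g : L2 (mu hU) g -> exists2 f, domain f &
  {ae mu hU, forall y, T f y = g y}.
Proof.
move=> /L2P gi.
have [f1 [d1 [w1 i1 e1]]] := real_shifted_solution (gi true).
have [f2 [d2 [w2 i2 e2]]] := real_shifted_solution (gi false).
pose f y := Complex (f1 y) (f2 y); pose d y := Complex (d1 y) (d2 y).
have wfd b : weak_pair (pt b f) (pt b d) by case: b.
have [wfp e] := weak_pair_partial_x hU wfd.
have fL : L2 (mu hU) f by apply/L2P => -[].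
have fT : {ae mu hU, forall y, T f y = g y}.
  apply: ae_part => b; under eq_near do rewrite part_shifted.
  have h : {ae mu hU, forall y, gamma * part b (f y) - gen (pt b f) (pt b d) y = part b (g y)}.
    by case: b.
  by apply: ae_imp2 e h => y e0 <-; rewrite /real_generator e0.
exists f => //; rewrite domainE.
apply: (zigzag_domain_sq hdelta hA hV' hc1 crefr refr_ge0 refr_le fL _ wfp).
apply/L2P => b; have [mf md] := weak_pair_measurable (wfp b).
have := sq_integrableD (-1) (sq_integrableZ gamma ((L2P _ _).1 fL b)) (gi b).
apply: sq_integrable_ae.
  have -> : pt b (L f) = gen (pt b f) (pt b (partial_x f)).
    by apply/funext => y; exact: part_generator.
  exact: measurable_real_generator.
by apply: ae_imp fT => y <-; rewrite part_shifted part_generator; ring.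
Qed.

Lemma gamma_in_resolvent_set : in_resolvent_set hU lambda_refr gamma.
Proof.
split.
- move=> g /shifted_surj[f fD fg]; exists f => //.
  by apply: ae_imp fg => y -> _.
- move=> f1 f2 D1 D2 e; have e' : {ae mu hU, forall y, T f1 y = T f2 y}.
    by apply: ae_imp e => y; exact.
  by apply: ae_imp (shifted_inj D1 D2 e') => y ->.
- have [C C0 hC] := csq_shifted; exists (Num.sqrt C) => f fD.
  have [[mf _] _ _] := fD; have [mT _] := L2_shifted fD.
  by apply: L2norm_scale_le (hC _ fD) => //; exact: ltW.
Qed.

End assumptions.
End zigzag_resolvent.

(** * Compactness of the embedding *)

Section zigzag_compactness.
Context {R : realType}.
Local Notation leb := (@lebesgue_measure R).
Variables (U lambda_refr : R -> R).
Hypothesis hU : C2 U.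
Local Notation V := (derive1 U).
Local Notation w := (fun x => expR (- U x)).
Local Notation rate := (jump_rate U lambda_refr).
Local Notation gen := (real_generator U lambda_refr).
Local Notation L := (zigzag_generator U lambda_refr).
Local Notation sqi := (sq_integrable (nu hU)).
Local Notation sqmu := (sq_integrable (mu hU)).
Local Notation pt b f := (fun y => part b (f y)).
Implicit Types (f g : R * bool -> R[i]) (b th : bool).

Lemma increasing_le (k : nat -> nat) : {homo k : m n / (m < n)%N} ->
  forall n, (n <= k n)%N.
Proof. by move=> hk; elim=> // n /leq_ltn_trans; apply; exact: hk. Qed.

(** Successive extraction over a finite index set; the second hypothesis keeps the properties
    already obtained when a further subsequence is taken. *)
Lemma subsequence_finite (I : finType) (P : I -> (nat -> nat) -> Prop) :
  (forall i k, {homo k : m n / (m < n)%N} ->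
    exists2 k', {homo k' : m n / (m < n)%N} & P i (k \o k')) ->
  (forall i k k', {homo k' : m n / (m < n)%N} -> P i k -> P i (k \o k')) ->
  exists2 k, {homo k : m n / (m < n)%N} & forall i, P i k.
Proof.
move=> ex sub.
suff [k hk Pk] : exists2 k, {homo k : m n / (m < n)%N} & forall i, i \in enum I -> P i k.
  by exists k => // i; apply: Pk; rewrite mem_enum.
elim: (enum I) => [|i s [k hk Pk]]; first by exists id.
have [k' hk' Pk'] := ex i k hk; exists (k \o k').
  by move=> m n mn; apply: hk; exact: hk'.
by move=> j; rewrite inE => /orP[/eqP ->//|/Pk]; exact: sub.
Qed.

Lemma W12norm_csq f : W12_mu hU f ->
  W12norm hU f = ((csq (mu hU) f + csq (mu hU) (partial_x f)) `^ 2^-1)%E.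
Proof.
move=> /W12_muP fW; rewrite /W12norm !L2norm_sq//.
  by apply/cmeasurableP => b; have [_ _ []] := fW b.
by apply/cmeasurableP => b; have [_ []] := fW b.
Qed.

Lemma W12norm_le f M : W12_mu hU f -> (W12norm hU f <= M%:E)%E ->
  (csq (mu hU) f + csq (mu hU) (partial_x f) <= (M ^+ 2)%:E)%E.
Proof.
move=> fW; rewrite W12norm_csq// => h.
have s0 : (0 <= csq (mu hU) f + csq (mu hU) (partial_x f))%E by rewrite adde_ge0 ?csq_ge0.
have M0 : 0 <= M by rewrite -lee_fin (le_trans (poweR_ge0 _ _) h).
have := le_poweR (ler0n _ 2) (poweR_ge0 _ _) h.
by rewrite -poweRrM mulVf// poweRe1// poweR_EFin powR_mulrn.
Qed.

Lemma L2norm_le_W12norm f : W12_mu hU f -> (L2norm (mu hU) f <= W12norm hU f)%E.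
Proof.
move=> fW; have [mf _] := L2_W12_mu fW; rewrite W12norm_csq// L2norm_csq//.
by apply: le_poweR; rewrite ?csq_ge0// leeDl// csq_ge0.
Qed.

Lemma le_slice_csq b th f : cmeasurable f ->
  (wint U (fun x => (part b (f (x, th)) ^+ 2)%R) <= csq (mu hU) f)%E.
Proof.
move=> /cmeasurableP mf; have ms := (measurable_sliceP _).1 (mf b).
apply: (@le_trans _ _ (\int[mu hU]_y (part b (f y) ^+ 2)%:E)%E); last first.
  by rewrite /csq; case: b {ms}; [rewrite leeDl// sq_ge0|rewrite leeDr// sq_ge0].
rewrite (ge0_integral_mu_wint hU (f := fun y => part b (f y) ^+ 2)); last 2 first.
- exact: measurable_funX.
- by move=> y; exact: sqr_ge0.
apply: le_wint => //.
- by apply: measurable_funX; exact: ms.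
- by apply: measurable_funD; apply: measurable_funX; exact: ms.
- by move=> x; exact: sqr_ge0.
- by move=> x; case: th; rewrite ?lerDl ?lerDr sqr_ge0.
Qed.

Lemma ae_wint (h1 h2 : R -> R) : measurable_fun setT h1 -> measurable_fun setT h2 ->
  {ae leb, forall x, h1 x = h2 x} ->
  wint U (fun x => (h1 x ^+ 2)%R) = wint U (fun x => (h2 x ^+ 2)%R).
Proof.
move=> m1 m2 e; apply: ge0_ae_eq_integral => //.
- apply/measurable_EFinP; apply: measurable_funM; first exact: measurable_funX.
  exact: C2_measurable_expR.
- apply/measurable_EFinP; apply: measurable_funM; first exact: measurable_funX.
  exact: C2_measurable_expR.
- by move=> x _; rewrite lee_fin mulr_ge0 ?sqr_ge0 ?expR_ge0.
- by move=> x _; rewrite lee_fin mulr_ge0 ?sqr_ge0 ?expR_ge0.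
- by apply: ae_imp e => x -> _.
Qed.

Section assumptions.
Variables a delta A c1 c2 : R.
Hypotheses (hdelta : delta < 1) (hA : 0 < A).
Hypothesis hV' : forall x, a <= derive1n 2 U x <= delta * `|V x| ^+ 2 + A.
Hypothesis wi : leb.-integrable setT (fun x => (w x)%:E).
Hypothesis Vpinfty : V x @[x --> +oo] --> +oo.
Hypothesis Vninfty : V x @[x --> -oo] --> -oo.

Lemma potential_tail (l : R) : exists r, forall x, ~ (- r <= x <= r) -> l <= `|V x|.
Proof.
have /cvgryPge/(_ l)[r1 [_ h1]] := Vpinfty.
have /cvgrNyPle/(_ (- l))[r2 [_ h2]] := Vninfty.
exists (`|r1| + `|r2| + 1) => x hx.
have n1 := ler_norm r1; have n2 := ler_norm (- r2); rewrite normrN in n2.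
have p1 := normr_ge0 r1; have p2 := normr_ge0 r2.
have [xr|xr] := leP x (`|r1| + `|r2| + 1).
  have xr2 : x < r2.
    by rewrite ltNge; apply/negP => h; apply: hx; rewrite xr andbT; lra.
  by have := h2 x xr2; have := ler_norm (- V x); rewrite normrN => /= *; lra.
have xr1 : r1 < x by lra.
by have := h1 x xr1; have := ler_norm (V x) => /= *; lra.
Qed.

(** Rellich's argument works on the continuous representatives; the weighted integrals do not see
    the change on a null set, so the limit serves the given functions. *)
Lemma W12_slice_subsequence (v : nat -> R * bool -> R[i]) (M : R) b th :
  (forall n, W12_mu hU (v n) /\ (W12norm hU (v n) <= M%:E)%E) ->
  exists k (G : R -> R), [/\ {homo k : m n / (m < n)%N}, sqi G &
    forall e : R, 0 < e -> exists N, forall n, (N <= n)%N ->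
      (\int[leb]_x ((part b (v (k n) (x, th)) - G x) ^+ 2 * w x)%:E <= e%:E)%E].
Proof.
move=> hv.
have wf n : rweak (fun x => part b (v n (x, th))) (fun x => part b (partial_x (v n) (x, th))).
  by have [/W12_muP/(_ b)[fp _ _] _] := hv n; exact: fp.
have [F_ hF] := choice (fun n => let: ex_intro2 F pF e := rweak_primitive (wf n) in
  ex_intro (fun F : R -> R => primitive F (fun x => part b (partial_x (v n) (x, th))) /\
    {ae leb, forall x, part b (v n (x, th)) = F x}) F (conj pF e)).
have [C C0 hC] := potential_sq_bound hU hdelta hA (fun x => (andP (hV' x)).2).
have mv n : measurable_fun setT (fun x => part b (v n (x, th))).
  by have [l _ _] := wf n; exact: locint_measurable.
have mF n : measurable_fun setT (F_ n).
  by have [pF _] := hF n; exact: continuous_measurable_fun (primitive_continuous pF).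
have bound n : (\int[leb]_x ((F_ n x ^+ 2 + part b (partial_x (v n) (x, th)) ^+ 2) * w x)%:E
    <= (M ^+ 2)%:E)%E.
  have [vW vM] := hv n; apply: le_trans (W12norm_le vW vM).
  have [pF e] := hF n.
  have m1 : cmeasurable (v n) by apply/cmeasurableP => b'; have /W12_muP/(_ b')[_ []] := vW.
  have m2 : cmeasurable (partial_x (v n)).
    by apply/cmeasurableP => b'; have /W12_muP/(_ b')[_ _ []] := vW.
  have mp : measurable_fun setT (fun x => part b (partial_x (v n) (x, th))).
    by have [_ l _] := wf n; exact: locint_measurable.
  rewrite -/(wint U (fun x => (F_ n x ^+ 2 + part b (partial_x (v n) (x, th)) ^+ 2)%R)).
  rewrite (wintD hU (measurable_funX 2 (mF n)) (measurable_funX 2 mp)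
    (fun x => sqr_ge0 _) (fun x => sqr_ge0 _)).
  by rewrite -(ae_wint (mv n) (mF n) e) leeD// le_slice_csq.
have [k [G [hk mG GM cvG]]] := weighted_rellich hU wi C0 hC potential_tail
  (fun n => (hF n).1) bound.
exists k, G; split.
- exact: homo_ltn ltn_trans hk.
- by apply/sq_integrable_nu; split => //; exact: le_lt_trans GM (ltry _).
- move=> e e0; have [N HN] := cvG e e0; exists N => n Nn; apply: le_trans (HN n Nn).
  rewrite le_eqVlt; apply/orP; left; apply/eqP.
  apply: (ae_wint (measurable_funB (mv (k n)) mG) (measurable_funB (mF (k n)) mG)).
  by apply: ae_imp (hF (k n)).2 => x /= ->.
Qed.

Lemma W12_relatively_compact (M : R) :
  relatively_compact_L2 (mu hU) [set f | W12_mu hU f /\ (W12norm hU f <= M%:E)%E].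
Proof.
move=> v hv.
(* The index is a pair (real or imaginary part, velocity): a complex function on the phase space
   amounts to four real functions on the line, and a common subsequence is needed for them. *)
pose P (i : bool * bool) (k : nat -> nat) := exists2 G : R -> R, sqi G &
  forall e : R, 0 < e -> exists N, forall n, (N <= n)%N ->
    (\int[leb]_x ((part i.1 (v (k n) (x, i.2)) - G x) ^+ 2 * w x)%:E <= e%:E)%E.
have [||k hk Pk] := @subsequence_finite _ P.
- move=> [b th] k hk.
  have [k' [G [hk' Gi cvG]]] := W12_slice_subsequence b th (fun n => hv (k n)).
  by exists k' => //; exists G.
- move=> [b th] k k' hk' [G Gi cvG]; exists G => // e e0.
  have [N HN] := cvG e e0; exists N => n Nn; apply: HN.
  exact: leq_trans Nn (increasing_le hk' n).
have [G hG] := choice (fun i => let: ex_intro2 G Gi cvG := Pk i in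
  ex_intro (fun G : R -> R => sqi G /\ forall e : R, 0 < e -> exists N, forall n, (N <= n)%N ->
    (\int[leb]_x ((part i.1 (v (k n) (x, i.2)) - G x) ^+ 2 * w x)%:E <= e%:E)%E) G
    (conj Gi cvG)).
pose f (y : R * bool) := Complex (G (true, y.2) y.1) (G (false, y.2) y.1).
have fE b x th : part b (f (x, th)) = G (b, th) x by case: b.
have fL : L2 (mu hU) f.
  apply/L2P => b; apply/sq_integrable_mu_slice => th.
  by under eq_fun do rewrite fE; have [] := hG (b, th).
exists k, f; split => //.
have mvf n : cmeasurable (fun y => v (k n) y - f y).
  apply/cmeasurableP => b; have /cmeasurableP mf := fL.1.
  have /cmeasurableP mv := (L2_W12_mu (hv (k n)).1).1.
  under eq_fun do rewrite partB.
  exact: measurable_funB.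
apply: L2norm_cvg0 => // e e0.
have e40 : 0 < e / 4 by rewrite divr_gt0.
have [N hN] := choice (fun i => (hG i).2 _ e40).
exists (\max_i N i) => n Nn.
have key b th : (wint U (fun x => (part b (v (k n) (x, th) - f (x, th)) ^+ 2)%R) <= (e / 4)%:E)%E.
  have := hN (b, th) n (leq_trans (leq_bigmax (b, th)) Nn).
  by rewrite /wint; under [in X in _ -> X]eq_integral do rewrite partB fE.
have mu2 b : (\int[mu hU]_y (part b (v (k n) y - f y) ^+ 2)%:E <= (e / 2)%:E)%E.
  have /cmeasurableP mb := mvf n; have ms := (measurable_sliceP _).1 (mb b).
  rewrite (ge0_integral_mu_wint hU (f := fun y => part b (v (k n) y - f y) ^+ 2)); last 2 first.
  - exact: measurable_funX.
  - by move=> y; exact: sqr_ge0.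
  rewrite (wintD hU (measurable_funX 2 (ms true)) (measurable_funX 2 (ms false))
    (fun x => sqr_ge0 _) (fun x => sqr_ge0 _)).
  by apply: le_trans (leeD (key b true) (key b false)) _; rewrite -EFinD lee_fin; lra.
by apply: le_trans (leeD (mu2 true) (mu2 false)) _; rewrite -EFinD lee_fin; lra.
Qed.

Lemma W12_compact_embedding : compact_embedding_W12_L2 hU.
Proof.
split.
- by move=> f; exact: L2_W12_mu.
- by exists 1 => f fW; rewrite mul1e; exact: L2norm_le_W12norm.
- exact: W12_relatively_compact.
Qed.

End assumptions.
End zigzag_compactness.

(** * Compactness of the resolvent *)

Section resolvent_compactness.
Context {R : realType}.
Local Notation leb := (@lebesgue_measure R).
Variables (U lambda_refr : R -> R).
Hypothesis hU : C2 U.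
Local Notation V := (derive1 U).
Local Notation w := (fun x => expR (- U x)).
Local Notation rate := (jump_rate U lambda_refr).
Local Notation gen := (real_generator U lambda_refr).
Local Notation L := (zigzag_generator U lambda_refr).
Local Notation sqi := (sq_integrable (nu hU)).
Local Notation sqmu := (sq_integrable (mu hU)).
Local Notation pt b f := (fun y => part b (f y)).
Implicit Types (f g : R * bool -> R[i]) (b th : bool).

Variables a delta A c1 c2 : R.
Hypotheses (hdelta : delta < 1) (hA : 0 < A).
Hypothesis hV' : forall x, a <= derive1n 2 U x <= delta * `|V x| ^+ 2 + A.
Hypothesis hc1 : 0 <= c1.
Hypothesis crefr : continuous lambda_refr.
Hypothesis refr_ge0 : forall x, 0 <= lambda_refr x.
Hypothesis refr_le : forall x, lambda_refr x <= c1 + c2 * `|V x|.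
Variable gamma : R.
Hypothesis gamma0 : 0 < gamma.
Local Notation T := (shifted_generator U lambda_refr gamma).
Local Notation domain := (zigzag_domain hU lambda_refr).
Local Notation resolv := (resolvent hU lambda_refr gamma).

Let domainE : domain = W12_mu hU.
Proof. exact: zigzag_domain_W12 hdelta hA hV' hc1 crefr refr_ge0 refr_le. Qed.

Lemma resolventP g : L2 (mu hU) g ->
  domain (resolv g) /\ {ae mu hU, forall y, T (resolv g) y = g y}.
Proof.
move=> gL.
have [f fD fg] := shifted_surj hdelta hA hV' hc1 crefr refr_ge0 refr_le gamma0 gL.
rewrite /resolvent; case: xgetP => [h -> [hD hT]|/(_ f)[]].
  by split => //; apply: ae_imp hT => y; exact.
by split => //; apply: ae_imp fg => y -> _.
Qed.

Lemma csq_scale_bound (f g h : R * bool -> R[i]) (p q : R) : 0 <= p -> 0 <= q ->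
  cmeasurable f -> cmeasurable g -> cmeasurable h ->
  (forall b y, part b (f y) ^+ 2 <= p * part b (g y) ^+ 2 + q * part b (h y) ^+ 2) ->
  (csq (mu hU) f <= p%:E * csq (mu hU) g + q%:E * csq (mu hU) h)%E.
Proof.
move=> p0 q0 /cmeasurableP mf /cmeasurableP mg /cmeasurableP mh le.
have key b : (\int[mu hU]_y (part b (f y) ^+ 2)%:E <=
    p%:E * \int[mu hU]_y (part b (g y) ^+ 2)%:E +
    q%:E * \int[mu hU]_y (part b (h y) ^+ 2)%:E)%E.
  have sq0 (k : R * bool -> R[i]) y : 0 <= part b (k y) ^+ 2 by exact: sqr_ge0.
  have mpg : measurable_fun setT (fun y => p * part b (g y) ^+ 2).
    by apply: measurable_funM => //; exact: measurable_funX.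
  have mqh : measurable_fun setT (fun y => q * part b (h y) ^+ 2).
    by apply: measurable_funM => //; exact: measurable_funX.
  rewrite (ge0_integral_scale (mu hU) p0 (measurable_funX 2 (mg b)) (sq0 g)).
  rewrite (ge0_integral_scale (mu hU) q0 (measurable_funX 2 (mh b)) (sq0 h)).
  rewrite -ge0_integralD//; last 4 first.
  - by move=> y _; rewrite lee_fin mulr_ge0.
  - exact/measurable_EFinP.
  - by move=> y _; rewrite lee_fin mulr_ge0.
  - exact/measurable_EFinP.
  apply: ge0_le_integral => //.
  - by move=> y _; rewrite lee_fin.
  - by apply/measurable_EFinP; exact: measurable_funX.
  - by apply/measurable_EFinP; exact: measurable_funD.
  - by move=> y _; rewrite lee_fin.
have i0 (k : R * bool -> R[i]) b : (0 <= \int[mu hU]_y (part b (k y) ^+ 2)%:E)%E.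
  exact: sq_ge0.
rewrite /csq (ge0_muleDr p%:E (i0 g true) (i0 g false)).
rewrite (ge0_muleDr q%:E (i0 h true) (i0 h false)) [leRHS]addeACA; exact: leeD (key true) (key false).
Qed.

(** Since L f = gamma f - T f, the square of L f is bounded by 2 gamma^2 f^2 + 2 (T f)^2;
    [derivative_bound] then controls the derivative and [csq_shifted] the function. Hence the
    resolvent maps L^2 boundedly into W^{1,2}. *)
Lemma W12_shifted_bound : exists2 C, 0 < C & forall f, domain f ->
  (csq (mu hU) f + csq (mu hU) (partial_x f) <= C%:E * csq (mu hU) (T f))%E.
Proof.
have mrefr : measurable_fun setT lambda_refr by exact: continuous_measurable_fun.
have [C1 C10 hC1] := csq_shifted hU hdelta hA hV' hc1 crefr refr_ge0 refr_le gamma0.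
have [C2 C20 hC2] := derivative_bound hU mrefr hc1 refr_ge0 refr_le hdelta hA hV'.
pose p := 1 + C2 * (1 + 2 * gamma ^+ 2).
have p0 : 0 <= p by rewrite addr_ge0// mulr_ge0 ?(ltW C20)// addr_ge0// mulr_ge0 ?sqr_ge0.
exists (p * C1 + C2 * 2); first by rewrite ltr_wpDl ?mulr_ge0 ?(ltW C10)// mulr_gt0.
move=> f fD; have [fL _ LfL] := fD; have TL := L2_shifted gamma fD.
have /W12_muP fW : W12_mu hU f by rewrite -domainE.
have h1 := hC1 f fD.
have Lf : (csq (mu hU) (L f) <=
    (2 * gamma ^+ 2)%:E * csq (mu hU) f + 2%:E * csq (mu hU) (T f))%E.
  apply: csq_scale_bound => //; [by rewrite mulr_ge0 ?sqr_ge0|by case: LfL|by case: fL|by case: TL|].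
  move=> b y; rewrite part_shifted part_generator.
  by have := sqr_ge0 (gamma * part b (f y) * 2 - gen (pt b f) (pt b (partial_x f)) y); nra.
have pd : (csq (mu hU) (partial_x f) <= C2%:E * (csq (mu hU) f + csq (mu hU) (L f)))%E.
  have key b : (\int[mu hU]_y (part b (partial_x f y) ^+ 2)%:E <= C2%:E *
      (\int[mu hU]_y (part b (f y) ^+ 2)%:E + \int[mu hU]_y (part b (L f y) ^+ 2)%:E))%E.
    have [wf _ _] := fW b.
    have /L2P/(_ b)[m1 _] := fL; have /L2P/(_ b)[m2 _] := LfL.
    apply: le_trans (hC2 _ _ wf) _; rewrite -integral_sqD//.
    by under [in X in (_ <= _ * X)%E]eq_integral do rewrite part_generator.
  have i0 (k : R * bool -> R[i]) b : (0 <= \int[mu hU]_y (part b (k y) ^+ 2)%:E)%E.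
    exact: sq_ge0.
  rewrite /csq [in leRHS]addeACA (ge0_muleDr C2%:E (adde_ge0 (i0 f true) (i0 (L f) true))
    (adde_ge0 (i0 f false) (i0 (L f) false))); exact: leeD (key true) (key false).
move: h1 Lf pd; have := csq_ge0 (mu hU) f; have := csq_ge0 (mu hU) (T f).
move: (csq (mu hU) f) (csq (mu hU) (T f)) (csq (mu hU) (L f)) (csq (mu hU) (partial_x f)).
move=> x y z t y0 x0 h1 h2 h3.
have g20 : 0 <= 2 * gamma ^+ 2 by rewrite mulr_ge0 ?sqr_ge0.
apply: (@le_trans _ _ (C1%:E * y + C2%:E * (C1%:E * y +
    ((2 * gamma ^+ 2)%:E * (C1%:E * y) + 2%:E * y)))%E).
  apply: leeD => //; apply: (le_trans h3); rewrite lee_pmul2l ?lte_fin//.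
  apply: leeD => //; apply: (le_trans h2); rewrite leeD2r//.
  by rewrite lee_wpmul2l ?lee_fin.
(* For finite y both sides are the same real number; for y = +oo the right side is +oo because the
   constant is positive. *)
case: y {h1 h2} y0 => [y y0| _|//].
  by rewrite -!EFinM -!EFinD lee_fin le_eqVlt; apply/orP; left; apply/eqP; rewrite /p; ring.
by rewrite [leRHS]gt0_muley ?leey// lte_fin ltr_wpDl ?mulr_ge0 ?(ltW C10)// mulr_gt0.
Qed.

(** A bounded set of L^2 is sent into a bounded set of W^{1,2}, which is relatively compact by
    [W12_relatively_compact]. *)
Lemma resolvent_compact :
  leb.-integrable setT (fun x => (w x)%:E) ->
  V x @[x --> +oo] --> +oo -> V x @[x --> -oo] --> -oo ->
  compact_operator_L2 (mu hU) resolv.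
Proof.
move=> wi Vp Vn; split.
- by move=> g /resolventP[[]].
- move=> c g h gL hL; have [gD gT] := resolventP gL; have [hD hT] := resolventP hL.
  have ghL : L2 (mu hU) (fun y => c * g y + h y).
    apply/L2P => b; move: gL hL => /L2P gL /L2P hL.
    have := sq_integrable_comb (part true c) (gL b) (sq_integrable_comb
      (if b then - part false c else part false c) (gL (~~ b)) (hL b)).
    by congr sq_integrable; apply/funext => y; rewrite partD partM addrA.
  have [rD rT] := resolventP ghL.
  have sD : domain (fun y => c * resolv g y + resolv h y).
    by move: gD hD; rewrite domainE => gD hD; have [] := W12_mu_comb c gD hD.
  have sT : {ae mu hU, forall y, T (fun y => c * resolv g y + resolv h y) y = c * g y + h y}.
    have := gD; have := hD; rewrite domainE => hW gW.
    have e := shifted_generator_comb lambda_refr gamma c gW hW.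
    by apply: ae_imp2 e (filterI gT hT) => y -> [-> ->].
  (* The resolvent is selected by choice, so linearity is a matter of uniqueness: both candidates
     lie in the domain and solve the same equation, and [shifted_inj] identifies them almost
     everywhere. *)
  have rs : {ae mu hU, forall y, T (resolv (fun y => c * g y + h y)) y =
      T (fun y => c * resolv g y + resolv h y) y}.
    by apply: ae_imp2 rT sT => y -> ->.
  apply: ae_imp (shifted_inj hdelta hA hV' hc1 crefr refr_ge0 refr_le gamma0 rD sD rs).
  by move=> y ->.
- move=> M v hv; have [C C0 hC] := W12_shifted_bound.
  have M0 : 0 <= M.
    have [g [gL gM] _] := hv 0%N; rewrite -lee_fin; apply: le_trans gM; exact: L2norm_ge0.
  (* [W12_shifted_bound] compares squared norms with the constant C, so the images of the ball of
     radius M have W^{1,2} norm at most sqrt(C) M. *)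
  have hW := W12_relatively_compact hdelta hA hV' wi Vp Vn (M := Num.sqrt C * M).
  apply: hW => n; have [g [gL gM] <-] := hv n.
  have [rD rT] := resolventP gL; have := rD; rewrite domainE => rW; split => //.
  have [mf _ _] := rD.
  rewrite W12norm_csq//.
  have -> : (Num.sqrt C * M)%:E = ((C * M ^+ 2)%:E `^ 2^-1)%E.
    rewrite poweR_EFin powRM ?sqr_ge0 ?(ltW C0)// -powR_mulrn// -powRrM divff// powRr1//.
    by rewrite powR12_sqrt// ltW.
  apply: le_poweR => //; first by rewrite adde_ge0 ?csq_ge0.
  apply: le_trans (hC _ rD) _; rewrite EFinM lee_pmul2l ?lte_fin//.
  have <- : csq (mu hU) g = csq (mu hU) (T (resolv g)).
    have /L2P TL := L2_shifted gamma rD; move: (gL) => /L2P gL'.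
    congr (_ + _)%E; apply: ae_mu_sq.
    + by have [] := gL' true.
    + by have [] := TL true.
    + by apply: ae_imp rT => y ->.
    + by have [] := gL' false.
    + by have [] := TL false.
    + by apply: ae_imp rT => y ->.
  by apply: csq_le => //; case: gL.
Qed.

End resolvent_compactness.

Theorem theorem3p9 (R : realType) (U lambda_refr : R -> R) (hU : C2 U)
  (hU_int : (@lebesgue_measure R).-integrable [set: R]
              (fun x => (expR (- U x))%:E))
  (delta a A : R) (hdelta0 : 0 < delta) (hdelta1 : delta < 1) (hA : 0 < A)
  (hU2 : forall x, a <= derive1n 2 U x <= delta * `|derive1 U x| ^+ 2 + A)
  (c1 c2 : R) (hc1 : 0 <= c1) (hc2 : 0 <= c2)
  (hrefr_cont : continuous lambda_refr)
  (hrefr_ge0 : forall x, 0 <= lambda_refr x)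
  (hrefr : forall x, lambda_refr x <= c1 + c2 * `|derive1 U x|) :
  zigzag_domain hU lambda_refr = W12_mu hU /\
  (derive1 U x @[x --> +oo] --> +oo ->
   derive1 U x @[x --> -oo] --> -oo ->
   compact_embedding_W12_L2 hU /\
   forall gamma : R, 0 < gamma ->
     in_resolvent_set hU lambda_refr gamma /\
     compact_operator_L2 (mu hU) (resolvent hU lambda_refr gamma)).
Proof.
split; first exact: zigzag_domain_W12 hdelta1 hA hU2 hc1 hrefr_cont hrefr_ge0 hrefr.
move=> Vp Vn; split; first exact: W12_compact_embedding hdelta1 hA hU2 hU_int Vp Vn.
move=> gamma gamma0; split.
  exact: (gamma_in_resolvent_set hU hdelta1 hA hU2 hc1 hrefr_cont hrefr_ge0 hrefr gamma0).
exact: (resolvent_compact hU hdelta1 hA hU2 hc1 hrefr_cont hrefr_ge0 hrefr gamma0 hU_int Vp Vn).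
Qed.
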